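(* Let $E$ be a Banach space, $p>q\ge1$, and $C\ge1$. The following are equivalent: (1) $\mathrm{FBL}^{(p)}[E]$ is lattice $C$-isomorphic to $\mathrm{FBL}^{(q)}[E]$; (2) $\mathrm{FBL}^{(p)}[E]$ is canonically lattice $C$-isomorphic to $\mathrm{FBL}^{(q)}[E]$, that is, the map taking $\delta_x$ ($x\in E$) to itself generates a lattice $C$-isomorphism between $\mathrm{FBL}^{(p)}[E]$ and $\mathrm{FBL}^{(q)}[E]$; (3) every contraction $T:E\to L_q(\mu)$ $C$-strongly factors through a $p$-convex Banach lattice with $p$-convexity constant $1$; (4) every contraction $T:E\to L_q(\mu)$ $C$-multiplicatively factors through $L_p(\mu)$; (5) every contraction $T:E\to L_q(\mu)$ is $p$-convex with constant $C$, i.e. for all finite sequences $(x_k)_{k=1}^n$ in $E$, $$\Big\|\Big(\sum_{k=1}^n|Tx_k|^p\Big)^{1/p}\Big\|_{L_q(\mu)}\le C\Big(\sum_{k=1}^n\|x_k\|^p\Big)^{1/p}.$$ (In (3)--(5), $\mu$ ranges over all $\sigma$-finite measures.)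
   Context: Banach spaces are real. $H[E]$ is the vector lattice (pointwise operations) of positively homogeneous functions $f:E^*\to\mathbb R$. For $1\le r<\infty$ put $\|f\|_{\mathrm{FBL}^{(r)}[E]}=\sup\{(\sum_{k=1}^n|f(x_k^* )|^r)^{1/r}: n\in\mathbb N,\ x_1^*,\dots,x_n^*\in E^*,\ \sup_{x\in B_E}\sum_{k=1}^n|x_k^*(x)|^r\le 1\}$. For $x\in E$ let $\delta_x(x^* )=x^*(x)$. $\mathrm{FBL}^{(r)}[E]$ is the closure, in the space of $f\in H[E]$ with finite norm, of the sublattice generated by $\{\delta_x:x\in E\}$. Two Banach lattices are lattice $C$-isomorphic if there is a surjective lattice isomorphism $V$ between them with $\|V\|\|V^{-1}\|\le C$ (a lattice $C$-isomorphism). A Banach lattice $X$ is $p$-convex with constant $M$ if $\|(\sum|x_k|^p)^{1/p}\|\le M(\sum\|x_k\|^p)^{1/p}$ for all finite families; the $p$-convexity constant is the least such $M$. For a Banach space $E$ and Banach lattices $Z,X$, $T:E\to Z$ $C$-strongly factors through $X$ if $T=US$ with $S:E\to X$ a contraction and $U:X\to Z$ a lattice homomorphism with $\|U\|\le C$. If $X$ and $Z$ are spaces of functions on the same space, $T$ $C$-multiplicatively factors through $X$ if in addition $U$ can be taken to be implemented by multiplication by a function. A contraction is a bounded linear operator of norm at most $1$. *)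

(* Defs.v *)
From HB Require Import structures.
From mathcomp Require Import all_boot all_order all_algebra.
From mathcomp Require Import all_classical all_reals all_analysis.

Set Implicit Arguments.
Unset Strict Implicit.
Unset Printing Implicit Defensive.

Import Order.TTheory GRing.Theory Num.Theory.
Import numFieldNormedType.Exports.

Local Open Scope classical_set_scope.
Local Open Scope ring_scope.

Definition lp_norm (R : realType) (r : R) (n : nat) (a : 'I_n -> R) : R :=
  (\sum_(k < n) `|a k| `^ r) `^ r^-1.

Section dual_space.
Context (R : realType) (E : normedModType R).

Record dual_space := DualSpace {
  dual_fun :> {linear E -> R^o};
  dual_fun_continuous : continuous dual_fun }.

Definition delta (x : E) (u : dual_space) : R := u x.

End dual_space.

Section free_banach_lattice.
Context (R : realType) (E : normedModType R).
Implicit Types (r : R) (f g : dual_space E -> R).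

(* [u'] ranges over the functionals equal to [l] times [u]: this avoids putting
   a module structure on [dual_space E]. *)
Definition pos_homogeneous f := forall (l : R) (u u' : dual_space E), 0 <= l ->
  (forall x : E, u' x = l * u x) -> f u' = l * f u.

Definition fbl_norm r f : \bar R := ereal_sup
  [set y | exists n (u : 'I_n -> dual_space E),
     (forall x : E, `|x| <= 1 -> \sum_(k < n) `|u k x| `^ r <= 1) /\
     y = (lp_norm r (fun k => f (u k)))%:E].

Definition sublattice (A : set (dual_space E -> R)) :=
  [/\ A 0,
      forall (a : R) f g, A f -> A g -> A (a *: f + g) &
      forall f g, A f -> A g -> A (f \max g)].

Definition FBL r : set (dual_space E -> R) := [set f |
  [/\ pos_homogeneous f, (fbl_norm r f < +oo)%E &
      forall e : R, 0 < e -> exists2 g,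
        smallest sublattice (range (@delta R E)) g &
        (fbl_norm r (f - g)%R < e%:E)%E]].

End free_banach_lattice.

Section lattice_isomorphism.
Context (R : realType) (S : Type).
Implicit Types (A B : set (S -> R)) (nA nB : (S -> R) -> \bar R).

Definition op_norm A nA nB (V : (S -> R) -> S -> R) : \bar R :=
  ereal_sup [set nB (V f) | f in A `&` [set f | (nA f <= 1)%E]].

(* The lattices are sets of functions on [S] with pointwise operations, so [V]
   and its inverse [W] matter only on [A] and [B] respectively. *)
Definition lattice_C_isomorphism (C : R) A nA B nB (V : (S -> R) -> S -> R) :=
  [/\ forall (a : R) f g, A f -> A g -> V (a *: f + g) = a *: V f + V g,
      forall f g, A f -> A g -> V (f \max g) = V f \max V g &
      exists W : (S -> R) -> S -> R,
        [/\ forall f, A f -> B (V f) /\ W (V f) = f,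
            forall g, B g -> A (W g) /\ V (W g) = g,
            (op_norm A nA nB V < +oo)%E,
            (op_norm B nB nA W < +oo)%E &
            (op_norm A nA nB V * op_norm B nB nA W <= C%:E)%E]].

End lattice_isomorphism.

(* The order is carried by the structure itself: the order hierarchy has no
   structure joining lattices with modules. Meets are x /\ y = - (- x \/ - y). *)
HB.mixin Record isBanachLattice (R : realType) X of CompleteNormedModule R X := {
  ble : X -> X -> Prop;
  bjoin : X -> X -> X;
  ble_refl : forall x : X, ble x x;
  ble_anti : forall x y : X, ble x y -> ble y x -> x = y;
  ble_trans : forall x y z : X, ble x y -> ble y z -> ble x z;
  bleD2r : forall x y z : X, ble x y -> ble (x + z) (y + z);
  bleZ : forall (a : R) (x : X), 0 <= a -> ble 0 x -> ble 0 (a *: x);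
  ble_joinP : forall x y z : X, ble (bjoin x y) z <-> ble x z /\ ble y z;
  ble_norm : forall x y : X,
    ble (bjoin x (- x)) (bjoin y (- y)) -> `|x| <= `|y| }.

#[short(type=banachLatticeType)]
HB.structure Definition BanachLattice (R : realType) :=
  {X of isBanachLattice R X & CompleteNormedModule R X}.

Section pconvexity.
Context (R : realType) (X : banachLatticeType R).

Definition cont_homogeneous n (h : 'rV[R]_n -> R) :=
  continuous h /\ forall (l : R) t, 0 <= l -> h (l *: t) = l * h t.

(* The Yudin-Krivine functional calculus h |-> h(x_1, ..., x_n): the lattice
   homomorphism sending the i-th coordinate function to x_i. On continuous
   positively homogeneous functions it exists and is unique; elsewhere [tau] is
   unconstrained. *)
Definition functional_calculus n (x : 'I_n -> X) (tau : ('rV[R]_n -> R) -> X) :=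
  [/\ forall i, tau (fun t => t ord0 i) = x i,
      forall (a : R) h k, cont_homogeneous h -> cont_homogeneous k ->
        tau (a *: h + k) = a *: tau h + tau k &
      forall h k, cont_homogeneous h -> cont_homogeneous k ->
        tau (h \max k) = bjoin (tau h) (tau k)].

(* y = (|x_1|^p + ... + |x_n|^p)^(1/p) *)
Definition is_lp_sum (p : R) n (x : 'I_n -> X) (y : X) :=
  exists2 tau, functional_calculus x tau &
    y = tau (fun t => lp_norm p (fun i => t ord0 i)).

Definition p_convex (p M : R) := forall n (x : 'I_n -> X),
  exists2 y, is_lp_sum p x y & `|y| <= M * lp_norm p (fun k => `|x k|).

Definition p_convexity_constant (p M : R) :=
  p_convex p M /\ forall M', p_convex p M' -> M <= M'.

End pconvexity.

Lemma le1_EFin (R : realType) (r : R) : 1 <= r -> (1 <= r%:E)%E.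
Proof. by rewrite lee_fin. Qed.

Lemma le1_lt (R : realType) (p q : R) : 1 <= q -> q < p -> 1 <= p.
Proof. by move=> q1 qp; rewrite (le_trans q1)// ltW. Qed.

Definition Lp d (Om : measurableType d) (R : realType)
    (mu : {measure set Om -> \bar R}) (r : R) (r1 : 1 <= r) : Type :=
  LspaceType mu (le1_EFin r1).

(* Elements of [Lp] are a.e.-classes, on which the library puts no algebraic
   structure, hence the pointwise a.e. identities below; they do not depend on
   representatives. *)
Definition Lp_fun d (Om : measurableType d) (R : realType)
    (mu : {measure set Om -> \bar R}) (r : R) (r1 : 1 <= r)
    (f : Lp mu r1) : Om -> R := (f : LspaceType mu (le1_EFin r1)).
Coercion Lp_fun : Lp >-> Funclass.

Section operators.
Context (R : realType) d (Om : measurableType d) (mu : {measure set Om -> \bar R}).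

Definition LpN (r : R) (f : Om -> R) : \bar R := 'N[mu]_(r%:E)[EFin \o f].

Definition Lp_linear (V : lmodType R) (r : R) (r1 : 1 <= r) (T : V -> Lp mu r1) :=
  forall (a : R) (x y : V),
    {ae mu, forall w, T (a *: x + y) w = a * T x w + T y w}.

Definition Lp_contraction (E : normedModType R) (r : R) (r1 : 1 <= r)
    (T : E -> Lp mu r1) :=
  Lp_linear T /\ forall x : E, (LpN r (T x) <= `|x|%:E)%E.

Definition lattice_hom (X : banachLatticeType R) (r : R) (r1 : 1 <= r)
    (U : X -> Lp mu r1) :=
  Lp_linear U /\
  forall x y : X,
    {ae mu, forall w, U (bjoin x y) w = Num.max (U x w) (U y w)}.

Definition Lp_lattice_hom (p q : R) (p1 : 1 <= p) (q1 : 1 <= q)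
    (U : Lp mu p1 -> Lp mu q1) :=
  (forall (a : R) (f g h : Lp mu p1),
     {ae mu, forall w, h w = a * f w + g w} ->
     {ae mu, forall w, U h w = a * U f w + U g w}) /\
  (forall f g h : Lp mu p1,
     {ae mu, forall w, h w = Num.max (f w) (g w)} ->
     {ae mu, forall w, U h w = Num.max (U f w) (U g w)}).

Context (E : normedModType R) (q : R) (q1 : 1 <= q).

Definition strongly_factors (C : R) (X : banachLatticeType R)
    (T : E -> Lp mu q1) :=
  exists (S : {linear E -> X}) (U : X -> Lp mu q1),
    [/\ forall x : E, `|S x| <= `|x|,
        lattice_hom U,
        forall x : X, (LpN q (U x) <= (C * `|x|)%:E)%E &
        forall x : E, {ae mu, forall w, T x w = U (S x) w}].

Definition multiplicatively_factors (C p : R) (p1 : 1 <= p)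
    (T : E -> Lp mu q1) :=
  exists (S : E -> Lp mu p1) (U : Lp mu p1 -> Lp mu q1),
    [/\ Lp_contraction S,
        Lp_lattice_hom U,
        forall f : Lp mu p1, (LpN q (U f) <= C%:E * LpN p f)%E,
        forall x : E, {ae mu, forall w, T x w = U (S x) w} &
        exists2 g : Om -> R, measurable_fun setT g &
          forall f : Lp mu p1, {ae mu, forall w, U f w = g w * f w}].

Definition p_convex_operator (p C : R) (T : E -> Lp mu q1) :=
  forall n (x : 'I_n -> E),
    (LpN q (fun w => lp_norm p (fun k => T (x k) w))
      <= (C * lp_norm p (fun k => `|x k|))%:E)%E.

End operators.

(* Main.v *)
From HB Require Import structures.
Require Import Defs.
From mathcomp Require Import all_boot all_order all_algebra.
From mathcomp Require Import all_classical all_reals all_analysis.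
From mathcomp Require Import measurable_realfun.
From mathcomp Require Import ring lra.

Set Implicit Arguments.
Unset Strict Implicit.
Unset Printing Implicit Defensive.

Import Order.TTheory GRing.Theory Num.Theory.
Import numFieldNormedType.Exports.

Local Open Scope classical_set_scope.
Local Open Scope ring_scope.

(** The hub is a finite inequality: whenever functionals [u_1, ..., u_m] satisfy
[sum_j |u_j x|^q <= 1] on the unit ball,
[(sum_j (sum_k |u_j(x_k)|^p)^(q/p))^(1/q) <= C (sum_k |x_k|^p)^(1/p)].

A lattice isomorphism [V] with inverse [W], canonical or not, forces it: for
finitely many [a^j] in the unit ball of the dual of [l_p^n] the function
[h = max_j sum_k a^j_k W(delta_(x_k))] is dominated by
[(sum_k |W(delta_(x_k))|^p)^(1/p)], hence is controlled in FBL^(p), whereas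
[V h = max_j sum_k a^j_k delta_(x_k)] takes at [u_j] a value at least
[(sum_k |u_j(x_k)|^p)^(1/p)] as soon as [a^j] norms [(u_j(x_k))_k].

The finite inequality is (5) for discrete measures. For a general [T] one cuts the
measure space into sets [A_i] on which [|T y_i|], for a suitable combination [y_i]
of the [x_k], is almost [(sum_k |T x_k|^p)^(1/p)], and composes [T] with the
functional norming [T y_i] in [L_q(A_i)].

Maurey's theorem gives (5) => (4): among the convex family of the densities
[sum_k |T x_k|^p] with [sum_k |x_k|^p <= 1], a maximizing sequence for
[f |-> int f^(q/p)] converges, and its limit [f0] yields the multiplier
[g = C^(q/p) f0^((1 - q/p)/p)].

Applied to counting measure on [nat] and [x |-> (u_j x)_j], (4) writes
[u_j = g_j v_j] with [(v_j)] admissible for [p], so that the norm of FBL^(q) is at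
most [C] times that of FBL^(p) on positively homogeneous functions; the reverse
inequality always holds with constant 1. Hence the identity is an isomorphism. *)

(** * Finite-dimensional l_p norms *)

(** An [l_p] norm is treated throughout as a supremum of linear forms [t |-> sum_k a_k t_k], taken
    one at a time or, up to a factor [1 - e], from a countable list. This shapes the proof because
    the maps at hand are only known to respect linear combinations and finite joins, and for maps
    into [L_q] only a.e., with one null set per identity: neither [V] nor the [U] of (3) is assumed
    to commute with p-sums. The constant stays exactly [C], since [e] tends to 0 at the end. The
    obstacle in Maurey's step is that the supremum of [int f^(q/p)] need not be attained on the
    convex family and that no compactness is at hand. Concavity of the power [q/p < 1] is made
    quantitative instead: two near-maximizers, raised to the power [q/(2p)], are close in [L_2], so
    a fast maximizing sequence converges a.e. The exponent in [g] is forced: [g^(-p)] has to be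
    [C^(-q) f0^(q/p - 1)], the weight in the first-order condition at [f0]; Hoelder's inequality
    then bounds multiplication by [g] by [C]. *)

Lemma continuous_norm_powR (R : realType) (r : R) : 0 < r ->
  continuous (fun x : R => `|x| `^ r).
Proof.
move=> r0 x; have [->|x0] := eqVneq x 0.
  apply/cvgrPdist_lt => e e0 /=; near=> y.
  rewrite normr0 powR0 ?gt_eqF// sub0r normrN ger0_norm ?powR_ge0//.
  rewrite (_ : e = (e `^ r^-1) `^ r); last first.
    by rewrite -powRrM mulVf ?gt_eqF// powRr1// ltW.
  apply: gt0_ltr_powR; rewrite ?nnegrE ?powR_ge0//.
  near: y; have /cvgrPdist_lt : @id R x @[x --> (0:R)] --> (0 : R) by exact: cvg_id.
  by move=> /(_ (e `^ r^-1)); under eq_near do rewrite sub0r normrN; apply; rewrite powR_gt0.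
have nx0 : 0 < `|x| by rewrite normr_gt0.
apply: (@continuous_comp _ _ _ (fun z : R => `|z|) (fun y => y `^ r)).
  exact: norm_continuous.
apply/differentiable_continuous/derivable1_diffP.
by apply: derivable_powR; rewrite in_itv/= nx0.
Unshelve. all: by end_near. Qed.

Lemma cvg_norm_powR (R : realType) (r : R) (u : nat -> R) (l : R) : 0 < r ->
  u @ \oo --> l -> `|u n| `^ r @[n --> \oo] --> `|l| `^ r.
Proof.
move=> r0 ul; have h := @continuous_norm_powR R r r0 l.
exact: (cvg_comp u (fun x : R => `|x| `^ r) ul h).
Qed.

Section lp_norm_theory.
Context (R : realType) (p : R) (p1 : 1 <= p).
Implicit Types (n : nat).

Let p0 : 0 < p. Proof. exact: lt_le_trans p1. Qed.
Let p_ge0 : 0 <= p. Proof. exact: ltW. Qed.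
Let pi_ge0 : 0 <= p^-1. Proof. by rewrite invr_ge0. Qed.

Lemma powRK (x : R) : 0 <= x -> (x `^ p) `^ p^-1 = x.
Proof. by move=> x0; rewrite -powRrM mulfV ?gt_eqF// powRr1. Qed.

Lemma powRVK (x : R) : 0 <= x -> (x `^ p^-1) `^ p = x.
Proof. by move=> x0; rewrite -powRrM mulVf ?gt_eqF// powRr1. Qed.

Lemma sum_powR_ge0 n (a : 'I_n -> R) : 0 <= \sum_k `|a k| `^ p.
Proof. by apply: sumr_ge0 => k _; exact: powR_ge0. Qed.

Lemma lp_norm_ge0 n (a : 'I_n -> R) : 0 <= lp_norm p a.
Proof. exact: powR_ge0. Qed.

Lemma lp_norm_pow n (a : 'I_n -> R) : lp_norm p a `^ p = \sum_k `|a k| `^ p.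
Proof. by rewrite powRVK// sum_powR_ge0. Qed.

Lemma eq_lp_norm n (a b : 'I_n -> R) : a =1 b -> lp_norm p a = lp_norm p b.
Proof. by move=> ab; congr (_ `^ _); apply: eq_bigr => k _; rewrite ab. Qed.

Lemma ler_lp_norm n (a b : 'I_n -> R) : (forall k, `|a k| <= `|b k|) ->
  lp_norm p a <= lp_norm p b.
Proof.
move=> ab; apply: ge0_ler_powR; rewrite ?nnegrE ?sum_powR_ge0//.
by apply: ler_sum => k _; apply: ge0_ler_powR; rewrite ?nnegrE.
Qed.

Lemma lp_norm_leP n (a : 'I_n -> R) (c : R) : 0 <= c ->
  (lp_norm p a <= c) = (\sum_k `|a k| `^ p <= c `^ p).
Proof.
move=> c0; apply/idP/idP => h.
  by rewrite -lp_norm_pow; apply: ge0_ler_powR; rewrite ?nnegrE ?lp_norm_ge0.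
by rewrite -(powRK c0); apply: ge0_ler_powR; rewrite ?nnegrE ?sum_powR_ge0 ?powR_ge0.
Qed.

Lemma lp_normZ n (l : R) (a : 'I_n -> R) : lp_norm p (fun k => l * a k) = `|l| * lp_norm p a.
Proof.
rewrite /lp_norm; under eq_bigr do rewrite normrM powRM//.
by rewrite -mulr_sumr powRM ?sum_powR_ge0 ?powR_ge0// powRK.
Qed.

Lemma lp_norm0 n : lp_norm p (fun _ : 'I_n => 0) = 0.
Proof.
rewrite (eq_lp_norm (b := fun k => 0 * 0)); last by move=> k; rewrite mul0r.
by rewrite lp_normZ normr0 mul0r.
Qed.

Lemma le_coord_lp_norm n (a : 'I_n -> R) k : `|a k| <= lp_norm p a.
Proof.
rewrite -(powRK (normr_ge0 (a k))); apply: ge0_ler_powR; rewrite ?nnegrE ?powR_ge0 ?sum_powR_ge0//.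
by rewrite (bigD1 k)//= lerDl; apply: sumr_ge0 => j _; exact: powR_ge0.
Qed.

Lemma lp_norm_eq0 n (a : 'I_n -> R) : lp_norm p a = 0 -> forall k, a k = 0.
Proof.
by move=> a0 k; apply/eqP; rewrite -normr_le0 -a0; exact: le_coord_lp_norm.
Qed.

Lemma young_powR (x y : R) : 0 <= x -> 0 <= y ->
  x `^ (p - 1) * y <= (1 - p^-1) * x `^ p + p^-1 * y `^ p.
Proof.
move=> x0 y0; move: p1; rewrite le_eqVlt => /predU1P[<-|gt1].
  by rewrite subrr powRr0 invr1 subrr mul0r add0r !mul1r powRr1.
have q0 : 0 < p / (p - 1) by rewrite divr_gt0// subr_gt0.
have h := @conjugate_powR R (x `^ (p - 1)) y (p / (p - 1)) p _ _ q0 p0 _.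
apply: le_trans (h _ _ _) _ => //; first exact: powR_ge0.
  by rewrite invf_div mulrBl mul1r mulfV ?gt_eqF// subrK.
rewrite -powRrM mulrCA mulfV ?mulr1; last by rewrite gt_eqF// subr_gt0.
rewrite invf_div mulrBl mul1r mulfV ?gt_eqF//.
by rewrite mulrC (mulrC (y `^ p)).
Qed.

Lemma lp_norm_support n (b : 'I_n -> R) : exists a : 'I_n -> R,
  (forall t, \sum_k a k * t k <= lp_norm p t) /\ \sum_k a k * b k = lp_norm p b.
Proof.
have [b0|b0] := eqVneq (lp_norm p b) 0.
  exists (fun=> 0); split=> [t|]; first by rewrite big1 ?lp_norm_ge0// => k _; rewrite mul0r.
  by rewrite b0 big1// => k _; rewrite mul0r.
set B := lp_norm p b in b0 *.
have B0 : 0 < B by rewrite lt_neqAle eq_sym b0 lp_norm_ge0.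
pose c k := b k / B.
have c1 : \sum_k `|c k| `^ p = 1.
  rewrite -lp_norm_pow (eq_lp_norm (b := fun k => B^-1 * b k)); last first.
    by move=> k; rewrite mulrC.
  by rewrite lp_normZ gtr0_norm ?invr_gt0// -/B mulVf// powR1.
exists (fun k => Num.sg (b k) * `|c k| `^ (p - 1)); split=> [t|]; last first.
  under eq_bigr => k _.
    have -> : Num.sg (b k) * `|c k| `^ (p - 1) * b k = B * `|c k| `^ p.
      have bE : `|b k| = B * `|c k| by rewrite normrM normfV (gtr0_norm B0) mulrCA mulfV// mulr1.
      by rewrite mulrAC -normrEsg bE -mulrA mulr_powRB1.
    over.
  by rewrite -mulr_sumr c1 mulr1.
have [t0|t0] := eqVneq (lp_norm p t) 0.
  by rewrite t0 big1// => k _; rewrite (lp_norm_eq0 t0) mulr0.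
set A := lp_norm p t in t0 *.
have A0 : 0 < A by rewrite lt_neqAle eq_sym t0 lp_norm_ge0.
pose s k := `|t k| / A.
have s1 : \sum_k s k `^ p = 1.
  have <- : lp_norm p (fun k => A^-1 * t k) `^ p = 1.
    by rewrite lp_normZ gtr0_norm ?invr_gt0// -/A mulVf// powR1.
  rewrite lp_norm_pow; apply: eq_bigr => k _.
  by rewrite normrM gtr0_norm ?invr_gt0// mulrC.
apply: (@le_trans _ _ (A * \sum_k `|c k| `^ (p - 1) * s k)).
  rewrite mulr_sumr; apply: ler_sum => k _.
  rewrite /s mulrCA (mulrCA A) mulfV// mulr1 mulrAC mulrC.
  rewrite ler_wpM2l ?powR_ge0// (le_trans (ler_norm _))// normrM ler_piMl//.
  by rewrite normr_sg; case: (_ != _).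
rewrite ler_piMr ?(ltW A0)//.
(* Young's inequality termwise: [c] and [s] both have p-power sum 1, so the weights [1 - p^-1] and
   [p^-1] add up to 1. *)
apply: (@le_trans _ _ (\sum_k ((1 - p^-1) * `|c k| `^ p + p^-1 * s k `^ p))).
  apply: ler_sum => k _; apply: young_powR => //.
  exact: divr_ge0 (normr_ge0 _) (ltW A0).
by rewrite big_split/= -!mulr_sumr c1 s1 !mulr1 subrK.
Qed.

(** Minkowski by duality: the form that norms the sum is at most the norm on each summand. *)
Lemma ler_lp_normD n (a b : 'I_n -> R) :
  lp_norm p (fun k => a k + b k) <= lp_norm p a + lp_norm p b.
Proof.
have [c [c1 <-]] := lp_norm_support (fun k => a k + b k).
by under eq_bigr do rewrite mulrDr; rewrite big_split/= lerD.
Qed.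

Lemma lp_norm_le_sum n (a : 'I_n -> R) : lp_norm p a <= \sum_k `|a k|.
Proof.
have [c [c1 <-]] := lp_norm_support a.
apply: ler_sum => k _; apply: le_trans (ler_norm _) _; rewrite normrM ler_piMl//.
(* Multiples of the [k]-th unit vector, with both signs, show that [|c k| <= 1]. *)
have e1 (s : R) : lp_norm p (fun j => s * (j == k)%:R) <= `|s|.
  rewrite lp_normZ ler_piMr// /lp_norm (bigD1 k)//= eqxx normr1 powR1 big1 ?addr0 ?powR1//.
  by move=> j /negbTE ->; rewrite normr0 powR0// gt_eqF.
have h s : c k * s <= `|s|.
  apply: le_trans (e1 s); apply: le_trans (c1 _); rewrite (bigD1 k)//= eqxx mulr1.
  rewrite big1 ?addr0// => j /negbTE ->; by rewrite !mulr0.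
rewrite ler_norml; have := h 1; have := h (- 1); rewrite normrN normr1 mulr1 mulrN1.
by rewrite lerNl => -> ->.
Qed.

(* The [a i] norm the points with rational coordinates. *)
Lemma lp_norm_dense n (e : R) : 0 < e -> exists a : nat -> 'I_n -> R,
  (forall i t, \sum_k a i k * t k <= lp_norm p t) /\
  (forall t, exists i, (1 - e) * lp_norm p t <= \sum_k a i k * t k).
Proof.
move=> e0.
have aux (X Y Z : R) : Z <= X + e * Z / 2 -> X - Y <= e * Z / 2 -> (1 - e) * Z <= Y.
  by move=> ? ?; lra.
have /choice[c cP] : forall z : {ffun 'I_n -> rat}, exists a : 'I_n -> R,
    (forall t, \sum_k a k * t k <= lp_norm p t) /\
    \sum_k a k * ratr (z k) = lp_norm p (fun k => ratr (z k)).
  by move=> z; exact: lp_norm_support.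
pose a i : 'I_n -> R := if unpickle i is Some z then c z else fun=> 0.
have a_le i t : \sum_k a i k * t k <= lp_norm p t.
  rewrite /a; case: unpickle => [z|]; first exact: (cP z).1.
  by rewrite big1 ?lp_norm_ge0// => k _; rewrite mul0r.
exists a; split=> // t.
have [t0|t0] := eqVneq (lp_norm p t) 0.
  exists 0%N; rewrite t0 mulr0 big1// => k _; by rewrite (lp_norm_eq0 t0) mulr0.
set A := lp_norm p t in t0 *.
have A0 : 0 < A by rewrite lt_neqAle eq_sym t0 lp_norm_ge0.
(* The rounding error has [l_1] norm at most [n * dl <= e * A / 2]. It is spent twice: once in
   comparing the two norms, once in the pairing with the norming vector. *)
pose dl := e * A / (2 * n.+1%:R).
have dl0 : 0 < dl by rewrite divr_gt0// mulr_gt0.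
have /choice[z zP] : forall k, exists z : rat, `|t k - ratr z| <= dl.
  move=> k; have : t k - dl < t k + dl by lra.
  move=> /rat_in_itvoo[z]; rewrite in_itv/= => /andP[h1 h2]; exists z.
  by rewrite ler_norml; apply/andP; split; lra.
pose z' := [ffun k => z k].
exists (pickle z'); rewrite /a pickleK.
have [c1 c2] := cP z'.
have dist : lp_norm p (fun k => t k - ratr (z k)) <= e * A / 2.
  apply: le_trans (lp_norm_le_sum _) _.
  apply: (@le_trans _ _ (\sum_(k < n) dl)); first exact: ler_sum.
  rewrite sumr_const card_ord -[leLHS]mulr_natr /dl.
  rewrite invfM mulrA -mulrA ler_piMr ?divr_ge0 ?mulr_ge0 ?ltW//.
  by rewrite ltr_pdivrMl ?mulr1 ?ltr_nat.
have h1 : A <= lp_norm p (fun k => ratr (z k)) + e * A / 2.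
  apply: (@le_trans _ _ (lp_norm p (fun k => ratr (z k) + (t k - ratr (z k))))).
    by rewrite le_eqVlt; apply/orP; left; apply/eqP/eq_lp_norm => k; rewrite addrC subrK.
  by apply: le_trans (ler_lp_normD _ _) _; rewrite lerD2l.
have c2' : \sum_k c z' k * ratr (z k) = lp_norm p (fun k => ratr (z k)).
  rewrite (eq_lp_norm (b := fun k => ratr (z' k))); last by move=> k; rewrite ffunE.
  by rewrite -c2; apply: eq_bigr => k _; rewrite ffunE.
have h2 : \sum_k c z' k * (ratr (z k) - t k) <= e * A / 2.
  apply: le_trans (c1 _) _; apply: le_trans dist.
  by apply: ler_lp_norm => k; rewrite distrC.
have h3 : \sum_k c z' k * (ratr (z k) - t k) =
    lp_norm p (fun k => ratr (z k)) - \sum_k c z' k * t k.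
  by rewrite -c2' -sumrB; apply: eq_bigr => k _; rewrite mulrBr.
by apply: aux h1 _; rewrite -h3.
Qed.

Lemma cont_homogeneous_lp_norm n :
  cont_homogeneous (fun t : 'rV[R]_n => lp_norm p (fun i => t ord0 i)).
Proof.
split=> [t|l t l0]; last first.
  rewrite -{2}(ger0_norm l0) -lp_normZ; apply: eq_lp_norm => k; by rewrite mxE.
have h : {for t, continuous (fun t : 'rV[R]_n => \sum_(k < n) `|t ord0 k| `^ p)}.
  apply: (@cvg_big _ _ _ _ _ _ _ (nbhs t)) => [|k _]; first exact: add_continuous.
  apply: (@continuous_comp _ _ _ (fun t : 'rV[R]_n => t ord0 k) (fun x => `|x| `^ p)).
    exact: coord_continuous.
  exact: continuous_norm_powR.
have -> : (fun t : 'rV[R]_n => lp_norm p (fun i => t ord0 i)) =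
   (fun x : R => `|x| `^ p^-1) \o (fun t : 'rV[R]_n => \sum_(k < n) `|t ord0 k| `^ p).
  by apply/funext => s /=; rewrite ger0_norm ?sum_powR_ge0.
apply: continuous_comp; first exact: h.
by apply: continuous_norm_powR; rewrite invr_gt0.
Qed.

End lp_norm_theory.

(** * Almost everywhere limits and L_p as a Banach lattice *)

Section ae_limits.
Context d (Om : measurableType d) (R : realType) (mu : {measure set Om -> \bar R}).

(** Fatou's lemma, the limit being a.e. the [limn_einf], whose measurability comes from that of the
    [limn_esup] of the opposites. *)
Lemma fatou_ae_const (g : nat -> Om -> R) (G : Om -> R) (k : \bar R) :
  (forall m, measurable_fun setT (g m)) -> (forall m w, 0 <= g m w) ->
  measurable_fun setT G -> (forall w, 0 <= G w) ->
  {ae mu, forall w, g m w @[m --> \oo] --> G w} ->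
  (forall m, \int[mu]_w (g m w)%:E <= k)%E -> (\int[mu]_w (G w)%:E <= k)%E.
Proof.
move=> mg g0 mG G0 gG gk.
have mgE m : measurable_fun setT (fun w => (g m w)%:E) by exact/measurable_EFinP.
have -> : (\int[mu]_w (G w)%:E = \int[mu]_w limn_einf (fun m => (g m w)%:E))%E.
  apply: ae_eq_integral => //; first exact/measurable_EFinP.
    rewrite (_ : (fun w => limn_einf _) = (fun w => - limn_esup (fun m => - (g m w)%:E))%E).
      apply: measurableT_comp => //; apply: measurable_fun_limn_esup => m.
      exact: measurableT_comp.
    apply/funext => w; rewrite -limn_einfN; congr limn_einf.
    by apply/funext => m; exact/esym/oppeK.
  apply: filterS gG => w gG _; apply/esym.
  by apply: (cvg_limn_einf_sup _).1; apply: cvg_EFin => //; exact: nearW.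
apply: le_trans (fatou mu measurableT mgE _) _ => [m w _|]; first by rewrite lee_fin.
rewrite limn_einf_lim; apply: lime_le; first exact: is_cvg_einfs.
apply: nearW => m; apply: le_trans (gk m).
by apply: ereal_inf_lbound; exists m => /=.
Qed.

(** On a tail of the sequence the bounds [K m] are below [k + e], and passing to a tail does not
    change the a.e. limit. *)
Lemma fatou_ae (g : nat -> Om -> R) (G : Om -> R) (K : nat -> R) (k : R) :
  (forall m, measurable_fun setT (g m)) -> (forall m w, 0 <= g m w) ->
  measurable_fun setT G -> (forall w, 0 <= G w) ->
  {ae mu, forall w, g m w @[m --> \oo] --> G w} ->
  (forall m, \int[mu]_w (g m w)%:E <= (K m)%:E)%E -> K @ \oo --> k ->
  (\int[mu]_w (G w)%:E <= k%:E)%E.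
Proof.
move=> mg g0 mG G0 gG gK Kk; apply/lee_addgt0Pr => e e0.
have [N _ NK] : \forall m \near \oo, K m <= k + e.
  by move/cvgr_le : Kk; apply; rewrite ltrDl.
apply: (@fatou_ae_const (fun m => g (m + N)%N)) => //.
  by apply: filterS gG => w; rewrite (cvg_shiftn N (g^~ w)).
move=> m; apply: le_trans (gK _) _; rewrite -EFinD lee_fin; apply: NK.
by rewrite /= leq_addl.
Qed.

Lemma ae_lty_of_integral (g : Om -> \bar R) : measurable_fun setT g ->
  (forall w, 0 <= g w)%E -> (\int[mu]_w g w < +oo)%E ->
  {ae mu, forall w, (g w < +oo)%E}.
Proof.
move=> mg g0 gy.
have /(integrable_ae measurableT) : mu.-integrable setT g.
  by apply/integrableP; split=> //; under eq_integral do rewrite gee0_abs//.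
by apply: filterS => w /(_ I); rewrite ge0_fin_numE.
Qed.

(** The weights [2 ^+ n] keep the integrals of [g n] summable and make the increments a.e.
    [O(2^-n)]. Only increments are estimated, so that the lemma serves both the completeness of
    [L_r] and the maximizing sequence in Maurey's theorem. *)
Lemma fast_cvg_ae (r c : R) (u : nat -> Om -> R) : 1 <= r -> 0 <= c ->
  (forall n, measurable_fun setT (u n)) ->
  (forall n, \int[mu]_w (`|u n.+1 w - u n w| `^ r)%:E
     <= ((c * 4^-1 ^+ n) `^ r)%:E)%E ->
  exists2 f : Om -> R, measurable_fun setT f &
    {ae mu, forall w, u n w @[n --> \oo] --> f w}.
Proof.
move=> r1 c0 mu_ du.
have r0 : 0 < r by exact: lt_le_trans r1.
pose g n w := (2 ^+ n * `|u n.+1 w - u n w|) `^ r.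
have mg n : measurable_fun setT (g n).
  apply: (@measurableT_comp _ _ _ _ _ _ (@powR R ^~ r)) => //.
  apply: measurable_funM => //; apply: measurableT_comp => //.
  exact: measurable_funB.
have mgE n : measurable_fun setT (EFin \o g n) by exact/measurable_EFinP.
have g0 n w : 0 <= g n w by exact: powR_ge0.
have gint n : (\int[mu]_w (g n w)%:E <= (c `^ r * 2^-1 ^+ n)%:E)%E.
  under eq_integral do rewrite /g powRM// EFinM.
  rewrite ge0_integralZl//; last first.
    apply/measurable_EFinP; apply: (@measurableT_comp _ _ _ _ _ _ (@powR R ^~ r)) => //.
    by apply: measurableT_comp => //; exact: measurable_funB.
  apply: le_trans (lee_wpmul2l _ (du n)) _; first by rewrite lee_fin powR_ge0.
  rewrite -EFinM lee_fin -powRM// ?mulr_ge0//.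
  rewrite mulrCA -exprMn powRM// ?exprn_ge0//.
  rewrite ler_wpM2l ?powR_ge0//.
  rewrite (_ : 2 * 4^-1 = 2^-1 :> R); last by field.
  apply: ge1r_powR => //.
  by rewrite exprn_gt0//= exprn_ile1// invf_le1// ler1n.
have : {ae mu, forall w, (\sum_(0 <= n <oo) (g n w)%:E < +oo)%E}.
  apply: ae_lty_of_integral.
  - have -> : (fun w => \sum_(0 <= n <oo) (g n w)%:E)%E =
        (fun w => \sum_(0 <= n <oo | n \in xpredT) (g n w)%:E)%E.
      by apply/funext => w; exact: eq_eseriesl.
    by apply: ge0_emeasurable_sum => [n w _ _|n _]; [rewrite lee_fin|exact: mgE].
  - by move=> w; apply: nneseries_ge0 => n _ _; rewrite lee_fin.
  rewrite integral_nneseries//; last by move=> n w _; rewrite lee_fin.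
  apply: (@le_lt_trans _ _ (\sum_(0 <= n <oo) (c `^ r * 2^-1 ^+ n)%:E)%E).
    apply: lee_nneseries => // n _ _; apply: integral_ge0 => w _.
    by rewrite lee_fin.
  apply: (@le_lt_trans _ _ (c `^ r * 2)%:E); last by rewrite ltry.
  apply: lime_le; first by apply: is_cvg_nneseries => n _ _; rewrite lee_fin mulr_ge0 ?powR_ge0.
  apply: nearW => N; rewrite sumEFin lee_fin.
  have := congr1 (@^~ N) (geometric_seriesE (c `^ r) (z := 2^-1 : R) _).
  rewrite /series/= => ->; last by rewrite lt_eqF// invf_lt1// ltr1n.
  rewrite (_ : 1 - 2^-1 = 2^-1 :> R); last by field.
  rewrite invrK ler_wpM2r// ler_piMr ?powR_ge0// gerBl exprn_ge0//.
move=> sg.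
have cv : {ae mu, forall w, cvgn (u^~ w)}.
  apply: filterS sg => w sw.
  set s := (\sum_(0 <= n <oo) (g n w)%:E)%E in sw.
  have s0 : (0 <= s)%E by apply: nneseries_ge0 => n _ _; rewrite lee_fin.
  have gs n : g n w <= fine s.
    rewrite -lee_fin fineK ?ge0_fin_numE//.
    apply: le_trans (nneseries_lim_ge n.+1 _); last by move=> k _ _; rewrite lee_fin.
    by rewrite big_nat_recr//= leeDr// sume_ge0// => k _; rewrite lee_fin.
  have du' n : `|telescope (u^~ w) n| <= geometric (fine s `^ r^-1) 2^-1 n.
    rewrite /telescope/geometric/= exprVn ler_pdivlMr ?exprn_gt0// mulrC.
    have -> : 2 ^+ n * `|u n.+1 w - u n w| = g n w `^ r^-1.
      by rewrite /g -powRrM mulfV ?gt_eqF// powRr1// mulr_ge0.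
    by rewrite ge0_ler_powR ?nnegrE ?invr_ge0 ?(ltW r0) ?fine_ge0.
  have : cvgn (series (telescope (u^~ w))).
    apply: (@normed_cvg R R^o).
    apply: series_le_cvg du' _ => //=.
      by move=> n; rewrite mulr_ge0 ?powR_ge0.
    by apply: is_cvg_geometric_series; rewrite ger0_norm// invf_lt1// ltr1n.
  rewrite telescopeK => cvu.
  rewrite (_ : u^~ w = (fun n => (u n w - u 0 w) + u 0 w)).
    by apply: is_cvgD => //; exact: is_cvg_cst.
  by apply/funext => n; rewrite subrK.
(* A limsup is measurable on the whole space; it agrees with the limit on the set of convergence,
   the only place where its value matters. *)
pose F w := limn_esup (fun n => (u n w)%:E).
have mF : measurable_fun setT F.
  by apply: measurable_fun_limn_esup => n; exact/measurable_EFinP.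
exists (fine \o F); first by apply: measurableT_comp => //; exact: fine_measurable.
apply: filterS cv => w cw.
rewrite /F /=.
have -> : limn_esup (fun n => (u n w)%:E) = (limn (u^~ w))%:E.
  by apply: (cvg_limn_einf_sup _).2; apply: cvg_EFin; [exact: nearW|].
exact: cw.
Qed.
End ae_limits.

Section LpN_theory.
Context d (Om : measurableType d) (R : realType) (mu : {measure set Om -> \bar R}).
Variables (r : R) (r1 : 1 <= r).

Lemma LpN_powE (f : Om -> R) :
  (LpN mu r f = (\int[mu]_w (`|f w| `^ r)%:E) `^ r^-1)%E.
Proof.
by rewrite /LpN unlock.
Qed.

Lemma measurable_powR_norm (f : Om -> R) : measurable_fun setT f ->
  measurable_fun setT (fun w => (`|f w| `^ r)%:E).
Proof.
move=> mf; apply/measurable_EFinP.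
apply: (@measurableT_comp _ _ _ _ _ _ (@powR R ^~ r)) => //.
exact: measurableT_comp.
Qed.

Lemma LpN_ae (f g : Om -> R) : measurable_fun setT f -> measurable_fun setT g ->
  f = g %[ae mu] -> LpN mu r f = LpN mu r g.
Proof.
move=> mf mg fg.
suff E : (\int[mu]_w (`|f w| `^ r)%:E = \int[mu]_w (`|g w| `^ r)%:E)%E.
  by rewrite (LpN_powE f) (LpN_powE g) E.
apply: ae_eq_integral => //.
- exact: measurable_powR_norm.
- exact: measurable_powR_norm.
- by apply: filterS fg => w /[apply] /= ->.
Qed.

Let r0 : 0 < r. Proof. exact: lt_le_trans r1. Qed.

Lemma LpN_cst0 : LpN mu r (cst 0) = 0%E.
Proof. by rewrite /LpN Lnorm0// eqe gt_eqF. Qed.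

Lemma LpNZ (a : R) (f : Om -> R) : measurable_fun setT f ->
  LpN mu r (fun w => a * f w)%R = (`|a|%:E * LpN mu r f)%E.
Proof.
move=> mf; rewrite !LpN_powE.
under eq_integral do rewrite normrM powRM// EFinM.
rewrite ge0_integralZl//; last exact: measurable_powR_norm.
rewrite poweRM ?integral_ge0// ?lee_fin ?powR_ge0//.
by rewrite poweR_EFin -powRrM mulfV ?gt_eqF// powRr1.
Qed.

Lemma LpN_mono (f g : Om -> R) : measurable_fun setT f -> measurable_fun setT g ->
  {ae mu, forall w, `|f w| <= `|g w|} -> (LpN mu r f <= LpN mu r g)%E.
Proof.
move=> mf mg fg; rewrite !LpN_powE.
have ri : 0 <= r^-1 by rewrite invr_ge0 ltW.
apply: (gt0_ler_poweR ri).
- by rewrite in_itv/= leey andbT integral_ge0// => w _; rewrite lee_fin powR_ge0.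
- by rewrite in_itv/= leey andbT integral_ge0// => w _; rewrite lee_fin powR_ge0.
apply: ae_ge0_le_integral => //.
- exact: measurable_powR_norm.
- exact: measurable_powR_norm.
- by apply: filterS fg => w fg _; rewrite lee_fin ge0_ler_powR// ?nnegrE// ltW.
Qed.

Lemma LpND (f g : Om -> R) : measurable_fun setT f -> measurable_fun setT g ->
  (LpN mu r (fun w => f w + g w)%R <= LpN mu r f + LpN mu r g)%E.
Proof. by move=> mf mg; exact: minkowski_EFin. Qed.

Lemma LpN_leP (f : Om -> R) (c : R) : 0 <= c ->
  ((LpN mu r f <= c%:E) <-> (\int[mu]_w (`|f w| `^ r)%:E <= (c `^ r)%:E))%E.
Proof.
move=> c0.
have I0 : (0 <= \int[mu]_w (`|f w| `^ r)%:E)%E.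
  by apply: integral_ge0 => w _; rewrite lee_fin powR_ge0.
have rge0 : 0 <= r by exact: ltW.
have ri0 : 0 <= r^-1 by rewrite invr_ge0.
split=> [h|h]; last first.
  rewrite LpN_powE; have -> : c%:E = ((c `^ r)%:E `^ r^-1)%E.
    by rewrite poweR_EFin -powRrM mulfV ?gt_eqF// powRr1.
  apply: (gt0_ler_poweR ri0) => //; first by rewrite in_itv/= leey andbT.
  by rewrite in_itv/= leey lee_fin powR_ge0.
have -> : (\int[mu]_w (`|f w| `^ r)%:E = LpN mu r f `^ r)%E.
  by rewrite LpN_powE -poweRrM mulVf ?gt_eqF// poweRe1.
rewrite -poweR_EFin; apply: (gt0_ler_poweR rge0) => //.
- by rewrite in_itv/= leey Lnorm_ge0.
- by rewrite in_itv/= leey lee_fin c0.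
Qed.

End LpN_theory.

(** * The Banach lattice of a.e. classes in [L_r(mu)] *)

Section LpSpace.
Context d (Om : measurableType d) (R : realType) (mu : {measure set Om -> \bar R}).
Variables (r : R) (r1 : 1 <= r).

Let r0 : 0 < r. Proof. exact: lt_le_trans r1. Qed.

Lemma Lp_measurable (f : Lp mu r1) : measurable_fun setT f.
Proof. exact: (@measurable_funPT _ _ _ _ (repr (LebesgueSpace.sort f))). Qed.

Lemma Lp_finite (f : Lp mu r1) : (LpN mu r f < +oo)%E.
Proof. exact: Lebesgue_finite. Qed.

(** The classes coincide in the quotient, and the packed finiteness proofs coincide by proof
    irrelevance. All algebraic and lattice laws of [Lp] can thus be checked a.e. *)
Lemma Lp_ext (f g : Lp mu r1) : {ae mu, forall w, f w = g w} -> f = g.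
Proof.
move=> fg.
have: LebesgueSpace.sort f = LebesgueSpace.sort g.
  apply/eqP; rewrite -[LebesgueSpace.sort f]reprK -[LebesgueSpace.sort g]reprK.
  by rewrite eqmodE; apply/asboolP; apply: filterS fg.
move: f g {fg} => [f [[fP]]] [g [[gP]]] /= fg.
subst g; congr LebesgueSpace.Pack; congr LebesgueSpace.Class.
by congr isFinLebesgue.Axioms_; exact: Prop_irrelevance.
Qed.

Lemma mkLp_ex (f : Om -> R) : measurable_fun setT f -> (LpN mu r f < +oo)%E ->
  {F : Lp mu r1 | {ae mu, forall w, F w = f w}}.
Proof.
move=> mf ff.
have mf' : measurable_fun setT (f : Om -> measurableTypeR R) by exact: mf.
pose f' : {mfun Om >-> measurableTypeR R} :=
  HB.pack (f : Om -> measurableTypeR R) (isMeasurableFun.Build _ _ _ _ _ mf').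
pose F : {mfun_ mu, Om >-> measurableTypeR R} := (\pi_({mfun_ mu, Om >-> measurableTypeR R}) f')%qT.
have Ff : ae_eq mu setT (repr F) f.
  have : repr F = f' %[mod {mfun_ mu, Om >-> measurableTypeR R}]%qT by rewrite reprK.
  by move/eqmodP/asboolP.
have finF : finite_norm mu r%:E F.
  rewrite /finite_norm (_ : Lnorm _ _ _ = LpN mu r f)//.
  apply: LpN_ae => //.
  exact: (@measurable_funPT _ _ _ _ (repr F)).
pose X : LspaceType mu (le1_EFin r1) :=
  @LebesgueSpace.Pack _ _ _ _ _ _ F
    (LebesgueSpace.Class (@isFinLebesgue.Axioms_ _ _ _ _ _ (le1_EFin r1) F finF)).
by exists X; apply: filterS Ff => w; exact.
Qed.

(* The class of [f], and of [0] when [f] is not in L_r. *)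
Definition Lp_of (f : Om -> R) : Lp mu r1 :=
  if pselect (measurable_fun setT f /\ (LpN mu r f < +oo)%E) is left h
  then sval (mkLp_ex h.1 h.2)
  else sval (mkLp_ex (measurable_cst (0 : R))
    (@eq_ind_r _ _ (fun x => x < +oo)%E (ltry 0) _ (LpN_cst0 mu r1))).

Lemma Lp_ofE (f : Om -> R) : measurable_fun setT f -> (LpN mu r f < +oo)%E ->
  {ae mu, forall w, Lp_of f w = f w}.
Proof.
move=> mf ff; rewrite /Lp_of; case: pselect => [h|]; first by case: mkLp_ex.
by move=> /(_ (conj mf ff)).
Qed.


Let fin (f : Lp mu r1) : LpN mu r f \is a fin_num.
Proof. by rewrite ge0_fin_numE ?Lp_finite// Lnorm_ge0. Qed.

Definition Lp_add (f g : Lp mu r1) := Lp_of (fun w => f w + g w).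
Definition Lp_opp (f : Lp mu r1) := Lp_of (fun w => - f w).
Definition Lp_scale (a : R) (f : Lp mu r1) := Lp_of (fun w => a * f w).
Definition Lp_zero := Lp_of (cst 0).

Let Lp_addE (f g : Lp mu r1) : {ae mu, forall w, Lp_add f g w = f w + g w}.
Proof.
apply: Lp_ofE; first by apply: measurable_funD; exact: Lp_measurable.
apply: le_lt_trans (LpND mu r1 (Lp_measurable f) (Lp_measurable g)) _.
by rewrite lte_add_pinfty// Lp_finite.
Qed.

Let Lp_scaleE (a : R) (f : Lp mu r1) : {ae mu, forall w, Lp_scale a f w = a * f w}.
Proof.
apply: Lp_ofE; first by apply: measurable_funM => //; exact: Lp_measurable.
by rewrite (LpNZ mu r1) ?lte_mul_pinfty ?Lp_finite//; exact: Lp_measurable.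
Qed.

Let Lp_oppE (f : Lp mu r1) : {ae mu, forall w, Lp_opp f w = - f w}.
Proof.
apply: Lp_ofE; first by apply: measurableT_comp => //; exact: Lp_measurable.
rewrite (_ : (fun w => _) = (fun w => -1 * f w)).
  by rewrite (LpNZ mu r1) ?lte_mul_pinfty ?Lp_finite//; exact: Lp_measurable.
by apply/funext => w; rewrite mulN1r.
Qed.

Let Lp_zeroE : {ae mu, forall w, Lp_zero w = 0}.
Proof. by apply: (Lp_ofE (measurable_cst _)); rewrite (LpN_cst0 mu r1). Qed.

Let Lp_addA : associative Lp_add.
Proof.
move=> f g h; apply: Lp_ext; near=> w.
by rewrite (near (Lp_addE _ _) w)// (near (Lp_addE g h) w)// (near (Lp_addE _ _) w)// (near (Lp_addE f g) w)// addrA.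
Unshelve. all: by end_near. Qed.

Let Lp_addC : commutative Lp_add.
Proof.
move=> f g; apply: Lp_ext; near=> w.
by rewrite (near (Lp_addE _ _) w)// (near (Lp_addE g f) w)// addrC.
Unshelve. all: by end_near. Qed.

Let Lp_add0 : left_id Lp_zero Lp_add.
Proof.
move=> f; apply: Lp_ext; near=> w.
by rewrite (near (Lp_addE _ _) w)// (near Lp_zeroE w)// add0r.
Unshelve. all: by end_near. Qed.

Let Lp_addN : left_inverse Lp_zero Lp_opp Lp_add.
Proof.
move=> f; apply: Lp_ext; near=> w.
by rewrite (near (Lp_addE _ _) w)// (near Lp_zeroE w)// (near (Lp_oppE f) w)// addNr.
Unshelve. all: by end_near. Qed.

HB.instance Definition _ := gen_eqMixin (Lp mu r1).
HB.instance Definition _ := gen_choiceMixin (Lp mu r1).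
HB.instance Definition _ := @GRing.isZmodule.Build (Lp mu r1) Lp_zero Lp_opp Lp_add
  Lp_addA Lp_addC Lp_add0 Lp_addN.

Lemma LpDE (f g : Lp mu r1) : {ae mu, forall w, (f + g : Lp mu r1) w = f w + g w}.
Proof. exact: Lp_addE. Qed.

Lemma Lp0E : {ae mu, forall w, (0 : Lp mu r1) w = 0}.
Proof. exact: Lp_zeroE. Qed.

Lemma LpNE (f : Lp mu r1) : {ae mu, forall w, (- f : Lp mu r1) w = - f w}.
Proof. exact: Lp_oppE. Qed.

Let Lp_scaleA a b (f : Lp mu r1) : Lp_scale a (Lp_scale b f) = Lp_scale (a * b) f.
Proof.
apply: Lp_ext; near=> w.
by rewrite (near (Lp_scaleE a _) w)// (near (Lp_scaleE b f) w)// (near (Lp_scaleE (a * b) f) w)// mulrA.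
Unshelve. all: by end_near. Qed.

Let Lp_scale1 : left_id 1 Lp_scale.
Proof.
move=> f; apply: Lp_ext; near=> w.
by rewrite (near (Lp_scaleE 1 _) w)// mul1r.
Unshelve. all: by end_near. Qed.

Let Lp_scaleDr : right_distributive Lp_scale +%R.
Proof.
move=> a f g; apply: Lp_ext; near=> w.
rewrite (near (Lp_scaleE a _) w)// (near (LpDE f g) w)//.
rewrite (near (LpDE (Lp_scale a f) (Lp_scale a g)) w)//.
by rewrite (near (Lp_scaleE a f) w)// (near (Lp_scaleE a g) w)// mulrDr.
Unshelve. all: by end_near. Qed.

Let Lp_scaleDl f : {morph Lp_scale^~ f : a b / a + b}.
Proof.
move=> a b; apply: Lp_ext; near=> w.
rewrite (near (Lp_scaleE (a + b) _) w)// (near (LpDE (Lp_scale a f) (Lp_scale b f)) w)//.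
by rewrite (near (Lp_scaleE a f) w)// (near (Lp_scaleE b f) w)// mulrDl.
Unshelve. all: by end_near. Qed.

HB.instance Definition _ := @GRing.Zmodule_isLmodule.Build R (Lp mu r1) Lp_scale
  Lp_scaleA Lp_scale1 Lp_scaleDr Lp_scaleDl.

Lemma LpZE a (f : Lp mu r1) : {ae mu, forall w, (a *: f : Lp mu r1) w = a * f w}.
Proof. exact: Lp_scaleE. Qed.

Definition Lp_norm (f : Lp mu r1) : R := fine (LpN mu r f).

Lemma Lp_normE (f : Lp mu r1) : (Lp_norm f)%:E = LpN mu r f.
Proof. by rewrite fineK. Qed.

Let Lp_normD f g : Lp_norm (f + g) <= Lp_norm f + Lp_norm g.
Proof.
rewrite -lee_fin EFinD !Lp_normE.
apply: le_trans (LpND mu r1 (Lp_measurable f) (Lp_measurable g)).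
have -> // : LpN mu r (f + g : Lp mu r1) = LpN mu r (fun w => f w + g w)%R.
apply: LpN_ae; first exact: Lp_measurable.
- by apply: measurable_funD; exact: Lp_measurable.
- by apply: filterS (LpDE f g).
Qed.

Let Lp_normZ a f : Lp_norm (a *: f) = `|a| * Lp_norm f.
Proof.
apply/EFin_inj; rewrite EFinM !Lp_normE -(LpNZ mu r1); last exact: Lp_measurable.
apply: LpN_ae; first exact: Lp_measurable.
- by apply: measurable_funM => //; exact: Lp_measurable.
- by apply: filterS (LpZE a f).
Qed.

Let Lp_norm0_eq0 f : Lp_norm f = 0 -> f = 0.
Proof.
move=> h0; have := Lp_normE f; rewrite h0 => /esym/Lnorm_eq0_eq0 f0.
have {f0} f0 : {ae mu, forall w, f w = 0}.
  have /f0 : measurable_fun setT (EFin \o f).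
    by apply/measurable_EFinP; exact: Lp_measurable.
  by move=> /(_ r0); apply: filterS => w /(_ I) [].
apply: Lp_ext; near=> w.
by rewrite (near Lp0E w)// (near f0 w).
Unshelve. all: by end_near. Qed.

HB.instance Definition _ := @Lmodule_isNormed.Build R (Lp mu r1) Lp_norm
  Lp_normD Lp_normZ Lp_norm0_eq0.

Lemma Lp_normrE (f : Lp mu r1) : `|f|%:E = LpN mu r f.
Proof. exact: Lp_normE. Qed.

Lemma LpBE (f g : Lp mu r1) : {ae mu, forall w, (f - g : Lp mu r1) w = f w - g w}.
Proof.
near=> w; rewrite (near (LpDE f (- g)) w)// (near (LpNE g) w)//.
Unshelve. all: by end_near. Qed.

Let normBE (f g : Lp mu r1) : `|f - g|%:E = LpN mu r (fun w => f w - g w).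
Proof.
rewrite Lp_normrE; apply: LpN_ae; first exact: Lp_measurable.
- by apply: measurable_funB; exact: Lp_measurable.
- by apply: filterS (LpBE f g).
Qed.

(** Riesz-Fischer for filters: centres [x n] of balls of radius [e n] that belong to [F] form a
    sequence to which [fast_cvg_ae] applies, as [2 * e n <= 4^-1 ^+ n]. Fatou's lemma turns the a.e.
    limit into a limit in norm. *)
Lemma Lp_complete (F : set_system (Lp mu r1)) : ProperFilter F -> cauchy F -> cvg F.
Proof.
move=> FF /cauchyP Fc.
pose e n : R := 8^-1 * 4^-1 ^+ n.
have e0 n : 0 < e n by rewrite mulr_gt0// exprn_gt0.
have edec n m : (n <= m)%N -> e m <= e n.
  by move=> nm; rewrite ler_pM2l// ler_wiXn2l// invf_le1// ler1n.
have /choice[x Fx] : forall n, exists x : Lp mu r1, F (ball x (e n)).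
  by move=> n; exact: Fc.
have xd n m : (n <= m)%N -> `|x m - x n| <= 2 * e n.
  move=> nm; have [y [yn ym]] := filter_ex (filterI (Fx n) (Fx m)).
  move: yn ym; rewrite -!ball_normE /ball_/= => yn ym.
  rewrite -(subrK y (x m)) -addrA (le_trans (ler_normD _ _))//.
  have := edec _ _ nm; rewrite distrC in yn; lra.
have mx n : measurable_fun setT (x n) by exact: Lp_measurable.
have mxd n m : measurable_fun setT (fun w => x m w - x n w) by exact: measurable_funB.
have ixd n m : (n <= m)%N ->
    (\int[mu]_w (`|x m w - x n w| `^ r)%:E <= ((2 * e n) `^ r)%:E)%E.
  move=> nm; apply/(LpN_leP mu r1); first by rewrite mulr_ge0// ltW.
  by rewrite -normBE lee_fin; exact: xd.
have [f mf xf] : exists2 f : Om -> R, measurable_fun setT f &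
    {ae mu, forall w, x n w @[n --> \oo] --> f w}.
  apply: (@fast_cvg_ae _ _ _ mu r 1) => // n.
  apply: le_trans (ixd _ _ (leqnSn n)) _; rewrite lee_fin.
  apply: ge0_ler_powR; rewrite ?nnegrE ?(ltW r0)//.
  - by rewrite mulr_ge0// ltW.
  rewrite /e mul1r mulrA ler_piMl ?exprn_ge0//; lra.
have fx n : (LpN mu r (fun w => f w - x n w)%R <= (2 * e n)%:E)%E.
  apply/(LpN_leP mu r1); first by rewrite mulr_ge0// ltW.
  apply: (@fatou_ae_const _ _ _ mu (fun m w => `|x (m + n)%N w - x n w| `^ r)) => //.
  - by move=> m; apply/measurable_EFinP/measurable_powR_norm; exact: mxd.
  - by apply/measurable_EFinP/measurable_powR_norm; exact: measurable_funB.
  - apply: filterS xf => w xf.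
    apply: cvg_norm_powR => //.
    apply: cvgB; last exact: cvg_cst.
    by rewrite (cvg_shiftn n (x^~ w)).
  - by move=> m; apply: ixd; exact: leq_addl.
have ff : (LpN mu r f < +oo)%E.
  rewrite (_ : f = (fun w => (f w - x 0 w) + x 0 w)); last first.
    by apply/funext => w; rewrite subrK.
  apply: le_lt_trans (LpND mu r1 _ _) _ => //; first exact: measurable_funB.
  by rewrite lte_add_pinfty ?Lp_finite// (le_lt_trans (fx 0%N))// ltry.
pose l := Lp_of f.
have lf : {ae mu, forall w, l w = f w} by exact: Lp_ofE.
have lx n : `|l - x n| <= 2 * e n.
  rewrite -lee_fin normBE; apply: le_trans (fx n).
  apply: (LpN_mono r1); [exact: measurable_funB (Lp_measurable l) _|exact: measurable_funB|].
  by apply: filterS lf => w ->.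
apply/cvg_ex; exists l; apply/cvg_ballP => eps eps0.
have [n en] : exists n, 3 * e n < eps.
  have : (fun n => 3 * e n) @ \oo --> (0 : R).
    rewrite (_ : (fun n => _) = geometric (3 * 8^-1) 4^-1).
      by apply: cvg_geometric; rewrite ger0_norm// invf_lt1// ltr1n.
    by apply/funext => n; rewrite /e mulrA.
  by move/cvgr_lt => /(_ _ eps0) [N _ /(_ N) h]; exists N; exact: h (leqnn N).
apply: filterS (Fx n) => y; rewrite -!ball_normE /ball_/= => yn.
rewrite -(subrK (x n) l) -addrA (le_lt_trans (ler_normD _ _))//.
apply: le_lt_trans en; rewrite (_ : 3 * e n = 2 * e n + e n); last by ring.
by apply: lerD => //; exact: ltW.
Qed.

HB.instance Definition _ := Uniform_isComplete.Build (Lp mu r1) Lp_complete.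

Definition Lp_le (f g : Lp mu r1) : Prop := {ae mu, forall w, f w <= g w}.
Definition Lp_join (f g : Lp mu r1) : Lp mu r1 := Lp_of (fun w => Num.max (f w) (g w)).

Lemma Lp_dominated (f : Om -> R) (g : Lp mu r1) : measurable_fun setT f ->
  {ae mu, forall w, `|f w| <= `|g w|} -> {ae mu, forall w, Lp_of f w = f w}.
Proof.
move=> mf fg; apply: Lp_ofE => //; apply: le_lt_trans (Lp_finite g).
by apply: (LpN_mono r1) => //; exact: Lp_measurable.
Qed.

Let Lp_abs_of (f : Lp mu r1) : {ae mu, forall w, Lp_of (fun w => `|f w|) w = `|f w|}.
Proof.
apply: (@Lp_dominated _ f); last by apply: aeW => w; rewrite normr_id.
by apply: measurableT_comp => //; exact: Lp_measurable.
Qed.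

Let Lp_join_ae (f g : Lp mu r1) : {ae mu, forall w, Lp_join f g w = Num.max (f w) (g w)}.
Proof.
apply: (@Lp_dominated _ (Lp_of (fun w => `|f w|) + Lp_of (fun w => `|g w|))).
  by apply: measurable_maxr; exact: Lp_measurable.
near=> w.
rewrite (near (LpDE (Lp_of (fun w => `|f w|)) (Lp_of (fun w => `|g w|))) w)//.
rewrite (near (Lp_abs_of f) w)// (near (Lp_abs_of g) w)//.
by rewrite (@ger0_norm _ (_ + _)) ?addr_ge0// maxEle; case: ifP => _; rewrite ?lerDl ?lerDr.
Unshelve. all: by end_near. Qed.

Let Lp_le_refl (f : Lp mu r1) : Lp_le f f. Proof. exact: aeW. Qed.

Let Lp_le_anti (f g : Lp mu r1) : Lp_le f g -> Lp_le g f -> f = g.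
Proof. by move=> fg gf; apply: Lp_ext; apply: filterS2 fg gf => w a b; apply/le_anti/andP. Qed.

Let Lp_le_trans (f g h : Lp mu r1) : Lp_le f g -> Lp_le g h -> Lp_le f h.
Proof. by move=> fg gh; apply: filterS2 fg gh => w; exact: le_trans. Qed.

Let Lp_leD2r (f g h : Lp mu r1) : Lp_le f g -> Lp_le (f + h) (g + h).
Proof.
by move=> fg; apply: filterS3 fg (LpDE f h) (LpDE g h) => w fg -> ->; rewrite lerD2r.
Qed.

Let Lp_leZ (a : R) (f : Lp mu r1) : 0 <= a -> Lp_le 0 f -> Lp_le 0 (a *: f).
Proof.
move=> a0 f0; apply: filterS3 f0 Lp0E (LpZE a f) => w f0 z zf; by rewrite z zf mulr_ge0// -z.
Qed.

Let Lp_joinP (f g h : Lp mu r1) : Lp_le (Lp_join f g) h <-> Lp_le f h /\ Lp_le g h.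
Proof.
split=> [fgh|[fh gh]].
  by split; apply: filterS2 fgh (Lp_join_ae f g) => w + fg; rewrite fg ge_max => /andP[].
by apply: filterS3 fh gh (Lp_join_ae f g) => w fh gh ->; rewrite ge_max fh.
Qed.

Let Lp_absE (f : Lp mu r1) : {ae mu, forall w, Lp_join f (- f) w = `|f w|}.
Proof.
apply: filterS2 (Lp_join_ae f (- f)) (LpNE f) => w -> ->.
by rewrite maxrN.
Qed.

Let Lp_norm_mono (f g : Lp mu r1) :
  Lp_le (Lp_join f (- f)) (Lp_join g (- g)) -> `|f| <= `|g|.
Proof.
move=> fg; rewrite -lee_fin !Lp_normrE; apply: (LpN_mono r1); try exact: Lp_measurable.
by apply: filterS3 fg (Lp_absE f) (Lp_absE g) => w h a b; rewrite -a -b.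
Qed.

HB.instance Definition _ := @isBanachLattice.Build R (Lp mu r1) Lp_le Lp_join
  Lp_le_refl Lp_le_anti Lp_le_trans Lp_leD2r Lp_leZ Lp_joinP Lp_norm_mono.

Lemma Lp_joinE (f g : Lp mu r1) :
  {ae mu, forall w, (bjoin f g : Lp mu r1) w = Num.max (f w) (g w)}.
Proof. exact: Lp_join_ae. Qed.

Lemma Lp_sumE (I : Type) (s : seq I) (P : pred I) (f : I -> Lp mu r1) :
  {ae mu, forall w, (\sum_(i <- s | P i) f i : Lp mu r1) w = \sum_(i <- s | P i) f i w}.
Proof.
elim: s => [|i s IH].
  by apply: filterS Lp0E => w; rewrite !big_nil.
apply: filterS2 IH (LpDE (f i) (\sum_(i <- s | P i) f i)) => w.
by rewrite !big_cons; case: ifP => // _ <-.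
Qed.
End LpSpace.

(** * Functional calculus, p-convexity and strong factorization *)

Section functional_calculus_Lp.
Context (R : realType).

Lemma rV_norm_le_sum n (t : 'rV[R]_n) : `|t| <= \sum_j `|t ord0 j|.
Proof.
have [t0|t0] := eqVneq (mx_norm t) 0.
  by rewrite (_ : `|t| = 0)// sumr_ge0.
have [[i j] tij] := mx_norm_neq0 t0.
rewrite [leLHS](_ : _ = `|t i j|)// (ord1 i) (bigD1 j)//=.
by rewrite lerDl sumr_ge0.
Qed.

Lemma cvg_row n (u : nat -> 'I_n -> R) (l : 'I_n -> R) :
  (forall i, u m i @[m --> \oo] --> l i) ->
  (\row_i u m i : 'rV[R]_n) @[m --> \oo] --> (\row_i l i : 'rV[R]_n).
Proof.
move=> ul; apply/cvgrPdist_lt => e e0.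
have sum0 : (\sum_i `|l i - u m i|) @[m --> \oo] --> \sum_(i < n) `|l i - l i|.
  apply: cvg_big => [|i _]; first exact: add_continuous.
  by apply: cvg_norm; apply: cvgB => //; exact: cvg_cst.
have sum_lt : \sum_(i < n) `|l i - l i| < e.
  by rewrite big1// => i _; rewrite subrr normr0.
have H : \forall m \near \oo, \sum_i `|l i - u m i| < e.
  by move/cvgr_lt : sum0; apply.
apply: filterS H => m; apply: le_lt_trans.
by apply: le_trans (rV_norm_le_sum _) _; apply: ler_sum => i _; rewrite !mxE.
Qed.

(** Continuity at 0 bounds [h] by 1 on a ball, and homogeneity spreads the bound. This is what keeps
    [h(x_1, ..., x_n)] in [L_p], so that [Lp_of] does not fall back on 0. *)
Lemma cont_homogeneous_bound n (h : 'rV[R]_n -> R) : cont_homogeneous h ->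
  exists2 C, 0 <= C & forall t, `|h t| <= C * `|t|.
Proof.
move=> [ch hh].
have h0 : h 0 = 0 by rewrite -(scale0r (0 : 'rV[R]_n)) hh// mul0r.
have /cvgrPdist_le/(_ 1 ltr01) := ch 0.
move=> /nbhs_ballP[e /= e0]; rewrite h0 => he.
exists (2 / e) => [|t]; first by rewrite divr_ge0// ltW.
have [->|t0] := eqVneq t 0; first by rewrite h0 !normr0 mulr0.
have nt0 : 0 < `|t| by rewrite normr_gt0.
pose a := e / (2 * `|t|).
have a0 : 0 < a by rewrite divr_gt0// mulr_gt0.
have /he : ball (0 : 'rV[R]_n) e (a *: t).
  rewrite -ball_normE /ball_/= sub0r normrN normrZ gtr0_norm//.
  rewrite /a invfM mulrA mulfVK ?gt_eqF//; lra.
rewrite /= sub0r normrN hh ?(ltW a0)// normrM gtr0_norm//.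
rewrite -ler_pdivlMl// mulr1 => /le_trans; apply.
by rewrite /a invf_div mulrAC.
Qed.

Lemma cont_homogeneousD n (a : R) (h k : 'rV[R]_n -> R) :
  cont_homogeneous h -> cont_homogeneous k -> cont_homogeneous (a *: h + k).
Proof.
move=> [ch hh] [ck hk]; split=> [t|l t l0].
  have h1 := @continuousM _ _ _ _ t (@cst_continuous _ _ a t) (ch t).
  exact: (@continuousD _ _ _ _ _ t h1 (ck t)).
by rewrite !fctE hh// hk// mulrDr mulrCA.
Qed.

Lemma cont_homogeneous_max n (h k : 'rV[R]_n -> R) :
  cont_homogeneous h -> cont_homogeneous k -> cont_homogeneous (h \max k).
Proof.
move=> [ch hh] [ck hk]; split=> [t|l t l0].
  by apply: continuous_max; [exact: ch|exact: ck].
by rewrite /= hh// hk// maxr_pMr.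
Qed.

Lemma cont_homogeneous_coord n (i : 'I_n) : cont_homogeneous (fun t : 'rV[R]_n => t ord0 i).
Proof.
split=> [t|l t l0]; first exact: coord_continuous.
by rewrite mxE.
Qed.

Context d (Om : measurableType d).

Lemma measurable_floor (f : Om -> R) (z : int) : measurable_fun setT f ->
  measurable [set w | Num.floor (f w) = z].
Proof.
move=> mf.
have -> : [set w | Num.floor (f w) = z] = f @^-1` `[z%:~R, (z + 1)%:~R[.
  apply/seteqP; split=> w /=; rewrite in_itv/= -floor_eq; first by move=> ->.
  by move/eqP.
by rewrite -[X in measurable X]setTI; apply: mf.
Qed.

(** Rounding each [F i] down to a grid of mesh [1 / m.+1] leaves countably many rows, so the
    composite with [h] is a countable union of measurable pieces; continuity of [h] passes to the
    limit. *)
Lemma measurable_row_comp n (h : 'rV[R]_n -> R) (F : 'I_n -> Om -> R) :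
  continuous h -> (forall i, measurable_fun setT (F i)) ->
  measurable_fun setT (fun w => h (\row_i F i w)).
Proof.
move=> ch mF.
pose G (m : nat) i w : R := (Num.floor (m.+1%:R * F i w))%:~R / m.+1%:R.
apply: (@measurable_fun_cvg _ _ _ _ (fun m w => h (\row_i G m i w))) => [m|w _].
  move=> _ Y mY; rewrite setTI.
  have -> : (fun w => h (\row_i G m i w)) @^-1` Y =
     \bigcup_(z : {ffun 'I_n -> int}) (if `[< Y (h (\row_i ((z i)%:~R / m.+1%:R))) >] then
       \bigcap_(i in [set: 'I_n]) [set w | Num.floor (m.+1%:R * F i w) = z i] else set0).
    apply/seteqP; split=> [w /= Yw|w [z _]].
      exists [ffun i => Num.floor (m.+1%:R * F i w)] => //.
      rewrite asboolT; first by move=> i _ /=; rewrite ffunE.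
      by move: Yw; congr (Y (h _)); apply/rowP => i; rewrite !mxE ffunE.
    case: ifPn => // /asboolP Yz /= zw.
    by move: Yz; congr (Y (h _)); apply/rowP => i; rewrite !mxE /G (zw i).
  apply: countable_bigcupT_measurable => // z; case: ifP => // _.
  apply: fin_bigcap_measurable => // i _; apply: measurable_floor.
  exact: measurable_funM.
apply: (cvg_comp (fun m => \row_i G m i w) h); last exact: ch.
apply: cvg_row => i; apply/cvgrPdist_lt => e e0.
have : \forall m \near \oo, (m.+1%:R : R)^-1 < e.
  exact: near_infty_natSinv_lt (PosNum e0).
apply: filterS => m; apply: le_lt_trans.
have m0 : 0 < m.+1%:R :> R by [].
rewrite -(ler_pM2l m0) -[X in X * `|_|](gtr0_norm m0) -normrM mulrBr mulfV ?gt_eqF//.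
rewrite /G mulrCA mulfV ?gt_eqF// mulr1.
have /andP[a b] := floor_itv (m.+1%:R * F i w).
by rewrite intrD in b; rewrite ger0_norm; lra.
Qed.

End functional_calculus_Lp.

Section Lp_p_convex.
Context d (Om : measurableType d) (R : realType) (mu : {measure set Om -> \bar R}).
Context (p : R) (p1 : 1 <= p).

Let fc n (x : 'I_n -> Lp mu p1) (h : 'rV[R]_n -> R) : Lp mu p1 :=
  Lp_of mu p1 (fun w => h (\row_i x i w)).

Let fcE n (x : 'I_n -> Lp mu p1) h : cont_homogeneous h ->
  {ae mu, forall w, fc x h w = h (\row_i x i w)}.
Proof.
move=> hh; have [C C0 hC] := cont_homogeneous_bound hh.
apply: (@Lp_dominated _ _ _ _ _ _ _ (C *: \sum_i bjoin (x i) (- x i))).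
  by apply: measurable_row_comp hh.1 _ => i; exact: Lp_measurable.
have absE : {ae mu, forall w, forall i, (bjoin (x i) (- x i) : Lp mu p1) w = `|x i w|}.
  apply: filter_forall => i.
  by apply: filterS2 (Lp_joinE (x i) (- x i)) (LpNE (x i)) => w -> ->; rewrite maxrN.
near=> w.
rewrite (near (LpZE C (\sum_i bjoin (x i) (- x i))) w)//.
rewrite (near (Lp_sumE (index_enum 'I_n) xpredT (fun i => bjoin (x i) (- x i))) w)//.
have E : \sum_i (bjoin (x i) (- x i) : Lp mu p1) w = \sum_i `|x i w|.
  by apply: eq_bigr => i _; exact: (near absE w).
rewrite E; apply: le_trans (hC _) _; apply: le_trans (ler_norm _).
rewrite ler_wpM2l//; apply: le_trans (rV_norm_le_sum _) _.
by apply: ler_sum => i _; rewrite mxE.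
Unshelve. all: by end_near. Qed.

Lemma Lp_functional_calculus n (x : 'I_n -> Lp mu p1) : functional_calculus x (fc x).
Proof.
split=> [i|a h k hh hk|h k hh hk].
- apply: Lp_ext; apply: filterS (fcE x (cont_homogeneous_coord R i)) => w ->.
  by rewrite mxE.
- apply: Lp_ext; near=> w.
  rewrite (near (fcE x (cont_homogeneousD a hh hk)) w)//.
  rewrite (near (LpDE (a *: fc x h) (fc x k)) w)// (near (LpZE a (fc x h)) w)//.
  by rewrite (near (fcE x hh) w)// (near (fcE x hk) w).
- apply: Lp_ext; near=> w.
  rewrite (near (fcE x (cont_homogeneous_max hh hk)) w)//.
  rewrite (near (Lp_joinE (fc x h) (fc x k)) w)//.
  by rewrite (near (fcE x hh) w)// (near (fcE x hk) w).
Unshelve. all: by end_near. Qed.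

(** Sum and integral of the p-th powers are exchanged; this equality is why the p-convexity constant
    of [L_p] is 1. *)
Lemma LpN_lp_norm n (x : 'I_n -> Lp mu p1) :
  LpN mu p (fun w => lp_norm p (x^~ w)) = (lp_norm p (fun k => `|x k|))%:E.
Proof.
have p0 : 0 < p by exact: lt_le_trans p1.
have mx k : measurable_fun setT (x k) by exact: Lp_measurable.
rewrite LpN_powE.
under eq_integral => w _ do rewrite ger0_norm ?lp_norm_ge0// lp_norm_pow// -sumEFin.
rewrite ge0_integral_sum//; last first.
  by move=> k; exact: measurable_powR_norm.
under eq_bigr => k _.
  have -> : (\int[mu]_w (`|x k w| `^ p)%:E = (`| `|x k| | `^ p)%:E)%E.
    rewrite normr_id -poweR_EFin Lp_normrE LpN_powE -poweRrM mulVf ?gt_eqF// poweRe1//.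
    by apply: integral_ge0 => w _; rewrite lee_fin powR_ge0.
  over.
by rewrite sumEFin poweR_EFin.
Qed.

Lemma Lp_p_convex : p_convex (Lp mu p1) p 1.
Proof.
move=> n x; pose y := fc x (fun t => lp_norm p (fun i => t ord0 i)).
exists y; first by exists (fc x) => //; exact: Lp_functional_calculus.
rewrite mul1r -lee_fin -LpN_lp_norm Lp_normrE le_eqVlt; apply/orP; left; apply/eqP.
apply: LpN_ae.
- exact: Lp_measurable.
- apply: (@measurableT_comp _ _ _ _ _ _ (@powR R ^~ p^-1)) => //.
  apply: measurable_sum => k; apply/measurable_EFinP/measurable_powR_norm.
  exact: Lp_measurable.
- apply: filterS (fcE x (cont_homogeneous_lp_norm p1 n)) => w -> _.
  by apply: eq_lp_norm => k; rewrite mxE.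
Qed.

End Lp_p_convex.

Section constant_one.
Context (R : realType) (X : banachLatticeType R).

Lemma ble_joinl (x y : X) : ble x (bjoin x y).
Proof. by have /ble_joinP[] := ble_refl (bjoin x y). Qed.

Lemma norm_le_abs (x : X) : `|x| <= `|bjoin x (- x)|.
Proof. by apply: ble_norm; exact: ble_joinl. Qed.

(** In one variable the [l_p] norm is [t \/ (- t)], which the axioms of [functional_calculus]
    already determine; its general uniqueness is not called upon. *)
Lemma is_lp_sum1 (p : R) (x y : X) : 1 <= p -> is_lp_sum p (fun _ : 'I_1 => x) y ->
  y = bjoin x (- x).
Proof.
move=> p1 [tau [tc tD tM] ->].
pose c : 'rV[R]_1 -> R := fun t => t ord0 ord0.
have hc : cont_homogeneous c by exact: cont_homogeneous_coord.
have z0 : cont_homogeneous (0 : 'rV[R]_1 -> R).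
  by split=> [t|l t l0]; [exact: (@cst_continuous _ _ (0 : R) t)|rewrite mulr0].
have cN : cont_homogeneous ((-1) *: c + 0) by exact: cont_homogeneousD.
have t0 : tau 0 = 0.
  have := tD 1 0 0 z0 z0; rewrite !scale1r addr0.
  by move=> h; apply: (@addrI _ (tau 0)); rewrite addr0 -h.
have -> : (fun t : 'rV[R]_1 => lp_norm p (fun i => t ord0 i)) = c \max ((-1) *: c + 0).
  apply/funext => t /=; rewrite /lp_norm big_ord1 powRK//.
  by rewrite addr0 scaleN1r maxrN.
by rewrite tM// tD// tc t0 addr0 scaleN1r.
Qed.

(** The family consisting of [x] alone tests the constant: its p-sum is the modulus of [x], whose
    norm is at least [|x| > 0]. *)
Lemma p_convexity_constant1 (p : R) (x : X) : 1 <= p -> x != 0 -> p_convex X p 1 ->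
  p_convexity_constant X p 1.
Proof.
move=> p1 x0 X1; split=> // M /(_ 1%N (fun=> x))[y /(is_lp_sum1 p1) -> ].
have nx : 0 < `|x| by rewrite normr_gt0.
rewrite /lp_norm big_ord1 powRK// normr_id => h.
by have := le_trans (norm_le_abs x) h; rewrite ler_pMl.
Qed.

End constant_one.

Section strong_factorization.
Context (R : realType) d (Om : measurableType d) (mu : {measure set Om -> \bar R}).
Context (E : normedModType R) (p q : R) (p1 : 1 <= p) (q1 : 1 <= q).

Lemma Lp_linear0 (V : lmodType R) (T : V -> Lp mu q1) : Lp_linear T ->
  {ae mu, forall w, T 0 w = 0}.
Proof.
move=> /(_ (-1) 0 0); rewrite scaler0 addr0.
by apply: filterS => w ->; rewrite mulN1r addNr.
Qed.

Lemma Lp_linear_sum (V : lmodType R) (T : V -> Lp mu q1) (I : Type) (s : seq I)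
    (a : I -> R) (x : I -> V) : Lp_linear T ->
  {ae mu, forall w, T (\sum_(k <- s) a k *: x k) w = \sum_(k <- s) a k * T (x k) w}.
Proof.
move=> Tlin; elim: s => [|k s IH].
  by rewrite big_nil; apply: filterS (Lp_linear0 Tlin) => w ->; rewrite big_nil.
rewrite big_cons; apply: filterS2 IH (Tlin (a k) (x k) (\sum_(k <- s) a k *: x k)) => w h ->.
by rewrite big_cons h.
Qed.

(** The null set depends on [a], and there are uncountably many [a]. For each precision [1 / m.+1],
    [lp_norm_dense] leaves countably many, whose null sets can be united. *)
Lemma ae_lp_norm_le n (f : 'I_n -> Om -> R) (g : Om -> R) :
  (forall a : 'I_n -> R, (forall t, \sum_k a k * t k <= lp_norm p t) ->
     {ae mu, forall w, \sum_k a k * f k w <= g w}) ->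
  {ae mu, forall w, lp_norm p (f^~ w) <= g w}.
Proof.
move=> fg.
have h m : {ae mu, forall w, (1 - m.+1%:R^-1) * lp_norm p (f^~ w) <= g w}.
  have m0 : 0 < m.+1%:R^-1 :> R by rewrite invr_gt0.
  have [a [a1 a2]] := lp_norm_dense p1 n m0.
  have : {ae mu, forall w, forall i, \sum_k a i k * f k w <= g w}.
    by apply/ae_foralln => i; exact: fg.
  by apply: filterS => w aw; have [i /le_trans] := a2 (f^~ w); apply.
move/ae_foralln : h; apply: filterS => w h.
have lim : (1 - m.+1%:R^-1) * lp_norm p (f^~ w) @[m --> \oo] --> (1 - 0) * lp_norm p (f^~ w).
  apply: cvgM; last exact: cvg_cst.
  apply: cvgB; [exact: cvg_cst|exact: cvg_harmonic].
rewrite -[leLHS]mul1r -[X in X * _]subr0 -(cvg_lim _ lim)//.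
by apply: limr_le; [exact: cvgP lim|exact: nearW].
Qed.

(** A linear form [h] below [N] satisfies [h \max N = N], an identity that [tau] and then [U]
    preserve. Hence [sum_k a_k T x_k <= U y] a.e. for each admissible [a], and the p-sum of the
    [T x_k] lies below [U y], where [y] is the p-sum of the [S x_k]. *)
Lemma strongly_factors_p_convex (C : R) (X : banachLatticeType R) (T : E -> Lp mu q1) :
  0 <= C -> p_convex X p 1 -> Lp_linear T -> strongly_factors C X T ->
  p_convex_operator p C T.
Proof.
move=> C0 X1 Tlin [S [U [Sc Uh Ub TUS]]] n x.
have [y [tau [tc tD tM] yE] ny] := X1 n (fun k => S (x k)).
have p0 : 0 < p by exact: lt_le_trans p1.
pose N := fun t : 'rV[R]_n => lp_norm p (fun i => t ord0 i).
have hN : cont_homogeneous N by exact: cont_homogeneous_lp_norm.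
have z0 : cont_homogeneous (0 : 'rV[R]_n -> R).
  by split=> [t|l t l0]; [exact: (@cst_continuous _ _ (0 : R) t)|rewrite mulr0].
have t0 : tau 0 = 0.
  have := tD 1 0 0 z0 z0; rewrite !scale1r addr0.
  by move=> h; apply: (@addrI _ (tau 0)); rewrite addr0 -h.
have tlin (a : 'I_n -> R) (s : seq 'I_n) :
    cont_homogeneous (\sum_(k <- s) a k *: (fun t : 'rV[R]_n => t ord0 k)) /\
    tau (\sum_(k <- s) a k *: (fun t : 'rV[R]_n => t ord0 k)) = S (\sum_(k <- s) a k *: x k).
  elim: s => [|k s [IH1 IH2]]; first by rewrite !big_nil linear0.
  have hk := cont_homogeneous_coord R k.
  rewrite !big_cons; split; first exact: cont_homogeneousD.
  by rewrite tD// IH2 tc linearD linearZ.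
have key (a : 'I_n -> R) : (forall t, \sum_k a k * t k <= lp_norm p t) ->
    {ae mu, forall w, \sum_k a k * T (x k) w <= U y w}.
  move=> a1; have [h1 h2] := tlin a (index_enum 'I_n).
  set h := (\sum_(k <- _) _) in h1 h2.
  have hmax : h \max N = N.
    apply/funext => t /=; rewrite max_r// /h fct_sumE.
    exact: (a1 (fun k => t ord0 k)).
  have : bjoin (tau h) y = y by rewrite yE -/N -tM// hmax.
  rewrite h2 => hy; have := Uh.2 (S (\sum_k a k *: x k)) y; rewrite hy.
  apply: filterS3 (TUS (\sum_k a k *: x k)) (Lp_linear_sum (index_enum 'I_n) a x Tlin) => w e1 e2 ->.
  by rewrite -e2 e1 le_max lexx.
have := ae_lp_norm_le key => le.
have mT k : measurable_fun setT (T (x k)) by exact: Lp_measurable.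
apply: (@le_trans _ _ (LpN mu q (U y))).
  apply: (LpN_mono q1) => //; last 2 first.
  - exact: Lp_measurable.
  - by apply: filterS le => w h; rewrite ger0_norm ?lp_norm_ge0// (le_trans h)// ler_norm.
  apply: (@measurableT_comp _ _ _ _ _ _ (@powR R ^~ p^-1)) => //.
  apply: measurable_sum => k; apply/measurable_EFinP/measurable_powR_norm.
  exact: Lp_measurable.
apply: le_trans (Ub y) _; rewrite lee_fin ler_wpM2l//.
apply: le_trans ny _; rewrite mul1r; apply: ler_lp_norm => // k.
by rewrite !normr_id; exact: Sc.
Qed.

(** Unless [L_p(mu)] is zero, [X] is [L_p(mu)] itself: the a.e. linearity of [S] is genuine
    linearity between classes. *)
Lemma multiplicatively_factors_strongly (C : R) (T : E -> Lp mu q1) : 0 <= C ->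
  multiplicatively_factors C p1 T ->
  exists X : banachLatticeType R, p_convexity_constant X p 1 /\ strongly_factors C X T.
Proof.
move=> C0 [S [U [[Slin Sb] [Ul Um] Ub TUS [g mg Ug]]]].
have Slinear : linear (S : E -> Lp mu p1).
  move=> a x y; apply: Lp_ext; near=> w.
  rewrite (near (Slin a x y) w)// (near (LpDE (a *: S x) (S y)) w)//.
  by rewrite (near (LpZE a (S x)) w).
have [[f f0]|] := pselect (exists f : Lp mu p1, f != 0).
  exists (Lp mu p1); split; first by apply: p_convexity_constant1 f0 _ => //; exact: Lp_p_convex.
  pose S' : {linear E -> Lp mu p1} := HB.pack S (GRing.isLinear.Build _ _ _ _ S Slinear).
  exists S', U; split=> //.
  - by move=> x; rewrite -lee_fin Lp_normrE; exact: Sb.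
  - split=> [a u v|u v]; [apply: Ul|exact: Um (Lp_joinE u v)].
    by apply: filterS2 (LpDE (a *: u) v) (LpZE a u) => w -> ->.
  - by move=> u; rewrite EFinM Lp_normrE; exact: Ub.
(* If L_p(mu) = 0 its p-convexity constant is not 1, so we factor the zero map
   through L_p of a point. *)
move=> L0.
pose dl : {measure set unit -> \bar R} := dirac tt.
have N1 : LpN dl p (cst 1) = 1%E.
  rewrite /LpN (_ : EFin \o cst 1 = cst 1%E)// Lnorm_cst1.
  have -> : dl setT = 1%E by rewrite /dl/= diracE mem_set.
  exact: poweR1r.
exists (Lp dl p1); split.
  apply: (@p_convexity_constant1 _ _ _ (Lp_of dl p1 (cst 1))) => //; last exact: Lp_p_convex.
  have e1 : {ae dl, forall w, Lp_of dl p1 (cst 1) w = cst 1 w}.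
    by apply: Lp_ofE => //; rewrite N1 ltry.
  apply/eqP => z0; have : LpN dl p (cst 1) = 0%E.
    have -> : LpN dl p (cst 1) = LpN dl p (Lp_of dl p1 (cst 1)).
      by apply: LpN_ae => //; apply: filterS e1 => w ->.
    by rewrite -Lp_normrE z0 normr0.
  by rewrite N1 => /eqP; rewrite eqe oner_eq0.
exists \0, (fun=> 0); split.
- by move=> x; rewrite normr0.
- split=> [a x y|x y]; apply: filterS (Lp0E mu q1) => w ->; last by rewrite maxxx.
  by rewrite mulr0 addr0.
- move=> x; rewrite -Lp_normrE normr0 lee_fin mulr_ge0//.
- move=> x; near=> w; rewrite (near (Lp0E mu q1) w)// (near (TUS x) w)//.
  rewrite (near (Ug (S x)) w)//.
  have -> : S x = 0 by apply: contrapT => /eqP Sx; apply: L0; exists (S x).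
  by rewrite (near (Lp0E mu p1) w)// mulr0.
Unshelve. all: by end_near. Qed.

End strong_factorization.

(** * Maurey's factorization through L_p *)

Section concavity.
Context (R : realType).
Implicit Types a b t x y m : R.

Lemma powRM_exp x s t : 0 < x -> x `^ s * x `^ t = x `^ (s + t).
Proof. by move=> x0; rewrite powRD// (gt_eqF x0) implybT. Qed.

Lemma weighted_amgm t x y : 0 <= t <= 1 -> 0 <= x -> 0 <= y ->
  x `^ t * y `^ (1 - t) <= t * x + (1 - t) * y.
Proof.
move=> /andP[t0 t1] x0 y0.
have [->|tn0] := eqVneq t 0; first by rewrite powRr0 subr0 powRr1// mul0r mul1r add0r.
have [->|tn1] := eqVneq t 1; first by rewrite subrr powRr0 powRr1// mulr1 mul0r mul1r addr0.
have tp : 0 < t by rewrite lt_neqAle eq_sym tn0.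
have tp' : 0 < 1 - t by rewrite subr_gt0 lt_neqAle tn1.
have h := @conjugate_powR R (x `^ t) (y `^ (1 - t)) t^-1 (1 - t)^-1 _ _ _ _ _.
rewrite !invrK -!powRrM !mulfV ?gt_eqF// !powRr1// in h.
rewrite (mulrC t) (mulrC (1 - t)); apply: h; rewrite ?powR_ge0 ?invr_gt0//.
by rewrite addrC subrK.
Qed.

Lemma powR_tangent_le t x y : 0 <= t <= 1 -> 0 <= x -> 0 < y ->
  x `^ t <= y `^ t + t * y `^ (t - 1) * (x - y).
Proof.
move=> t01 x0 y0; have h := weighted_amgm t01 x0 (ltW y0).
have yp : 0 < y `^ (1 - t) by rewrite powR_gt0.
have e1 : y `^ t * y `^ (1 - t) = y.
  by rewrite powRM_exp// (_ : t + (1 - t) = 1) ?powRr1 ?ltW//; ring.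
have e2 : y `^ (t - 1) * y `^ (1 - t) = 1.
  by rewrite powRM_exp// (_ : t - 1 + (1 - t) = 0) ?powRr0//; ring.
rewrite -(ler_pM2r yp) (le_trans h)// [leRHS]mulrDl e1 mulrAC -(mulrA t) e2; lra.
Qed.

(** AM-GM is applied with weight [2 * t] to [sqrt (x * m)] and [m], which have the same weighted
    geometric mean; the arithmetic mean drops by exactly [t * (sqrt x - sqrt m) ^+ 2]. *)
Let refined_young_half t x m : 0 <= t -> t <= 2^-1 -> 0 <= x -> 0 <= m ->
  x `^ t * m `^ (1 - t) + t * (Num.sqrt x - Num.sqrt m) ^+ 2 <= t * x + (1 - t) * m.
Proof.
move=> t0 t1 x0 m0.
have [->|tn0] := eqVneq t 0; first by rewrite powRr0 subr0 powRr1// !mul0r !mul1r addr0 add0r.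
have t2 : 0 <= 2 * t <= 1 by apply/andP; split; lra.
have := weighted_amgm t2 (sqrtr_ge0 (x * m)) m0.
have -> : Num.sqrt (x * m) `^ (2 * t) * m `^ (1 - 2 * t) = x `^ t * m `^ (1 - t).
  rewrite powRrM powR_mulrn ?sqrtr_ge0// sqr_sqrtr ?mulr_ge0// powRM// -mulrA.
  have [->|mn0] := eqVneq m 0.
    by rewrite (@powR0 _ t)// (@powR0 _ (1 - t)) ?mul0r//; apply/eqP; lra.
  have mp : 0 < m by rewrite lt_neqAle eq_sym mn0.
  by rewrite powRM_exp//; congr (_ * _ `^ _); lra.
rewrite sqrtrM// sqrrB !sqr_sqrtr//; lra.
Qed.

Lemma refined_young t x m : 0 <= t <= 1 -> 0 <= x -> 0 <= m ->
  x `^ t * m `^ (1 - t) + Num.min t (1 - t) * (Num.sqrt x - Num.sqrt m) ^+ 2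
    <= t * x + (1 - t) * m.
Proof.
move=> /andP[t0 t1] x0 m0; have [h|h] := lerP t 2^-1.
  by rewrite min_l; [exact: refined_young_half|lra].
have := @refined_young_half (1 - t) m x _ _ m0 x0.
rewrite min_r; last by lra.
rewrite (_ : 1 - (1 - t) = t); last by ring.
rewrite (_ : (Num.sqrt x - Num.sqrt m) ^+ 2 = (Num.sqrt m - Num.sqrt x) ^+ 2); last by ring.
rewrite (mulrC (x `^ t)) (addrC (t * x)); apply; lra.
Qed.

(* The gap in the concavity of [x^t] that makes maximizing sequences converge. *)
Lemma powR_midpoint_gap t a b : 0 < t < 1 -> 0 <= a -> 0 <= b ->
  (a `^ t + b `^ t) / 2 + Num.min t (1 - t) / 4 * (a `^ (t / 2) - b `^ (t / 2)) ^+ 2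
    <= ((a + b) / 2) `^ t.
Proof.
move=> /andP[t0 t1].
wlog ba : a b / b <= a.
  move=> H a0 b0; have [/H|/ltW/H] := leP b a; first exact.
  rewrite (addrC b a) (addrC (b `^ t)).
  rewrite (_ : (b `^ (t / 2) - a `^ (t / 2)) ^+ 2 = (a `^ (t / 2) - b `^ (t / 2)) ^+ 2); last by ring.
  exact.
move=> a0 b0; set m := (a + b) / 2; set r0 := Num.min _ _.
have r00 : 0 <= r0 by rewrite /r0 le_min (ltW t0) subr_ge0 (ltW t1).
have [a_eq0|an0] := eqVneq a 0.
  have b_eq0 : b = 0 by apply/le_anti; rewrite b0 -a_eq0 ba.
  have tn0 : t != 0 by rewrite gt_eqF.
  by rewrite a_eq0 b_eq0 (powR0 tn0) subrr expr0n/= !(mulr0, addr0, mul0r) powR_ge0.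
have ap : 0 < a by rewrite lt_neqAle eq_sym an0.
have mp : 0 < m by rewrite divr_gt0// ltr_pwDl.
have ma : m <= a by rewrite /m; lra.
have t01 : 0 <= t <= 1 by rewrite !ltW.
have h1 := refined_young t01 a0 (ltW mp).
have h2 := refined_young t01 b0 (ltW mp).
rewrite -/r0 in h1 h2.
set sa := Num.sqrt a in h1; set sb := Num.sqrt b in h2; set sm := Num.sqrt m in h1 h2.
(* Parallelogram identity. The average of [h1] and [h2] carries [r0 / 2] times the right-hand side,
   whence the constant [r0 / 4]. *)
have h3 : (sa - sb) ^+ 2 / 2 <= (sa - sm) ^+ 2 + (sb - sm) ^+ 2.
  have -> : (sa - sm) ^+ 2 + (sb - sm) ^+ 2 =
     (sa - sb) ^+ 2 / 2 + (sa + sb - 2 * sm) ^+ 2 / 2 by field.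
  by rewrite lerDl divr_ge0// sqr_ge0.
have h4 : m `^ (1 - t) * ((a `^ t + b `^ t) / 2) + r0 / 4 * (sa - sb) ^+ 2 <= m.
  have h3' := ler_wpM2l r00 h3.
  have mE : t * a + t * b = 2 * (t * m) by rewrite /m; field.
  rewrite mulrDr in h3'; lra.
have mt0 : 0 < m `^ (t - 1) by rewrite powR_gt0.
have mE : m `^ t = m `^ (t - 1) * m by rewrite mulrC mulr_powRB1// ltW.
rewrite mE; apply: le_trans (ler_wpM2l (ltW mt0) h4).
rewrite mulrDr (mulrA (m `^ (t - 1)) (m `^ (1 - t))) powRM_exp//.
rewrite (_ : t - 1 + (1 - t) = 0); last by ring.
rewrite powRr0 mul1r lerD2l [leRHS]mulrCA ler_wpM2l ?divr_ge0//.
(* The normalization [b <= a] is used twice: [m <= a] lets the factor [m]^ (t - 1)[be replaced by]a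
   [^ (t - 1)], and [a]^ ((t - 1) / 2) <= b [^ ((t - 1) / 2)] turns square roots into powers
   [t / 2]. *)
have am : a `^ (t - 1) <= m `^ (t - 1).
  rewrite -opprB !powRN lef_pV2 ?posrE ?powR_gt0//.
  by apply: ge0_ler_powR; rewrite ?nnegrE ?subr_ge0 ?(ltW t1) ?(ltW mp).
apply: (@le_trans _ _ (a `^ (t - 1) * (sa - sb) ^+ 2)); last by rewrite ler_wpM2r ?sqr_ge0.
have -> : a `^ (t - 1) = (a `^ ((t - 1) / 2)) ^+ 2.
  by rewrite -powR_mulrn ?powR_ge0// -powRrM divfK.
have split_t x : 0 < x -> x `^ (t / 2) = x `^ ((t - 1) / 2) * x `^ 2^-1.
  by move=> x0; rewrite powRM_exp//; congr (_ `^ _); field.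
rewrite -exprMn ler_pXn2r ?nnegrE//.
- rewrite mulrBr split_t// powR12_sqrt// lerB//.
  have [bE|bn0] := eqVneq b 0; first by rewrite /sb bE sqrtr0 mulr0 powR_ge0.
  have bp : 0 < b by rewrite lt_neqAle eq_sym bn0.
  rewrite split_t// powR12_sqrt// ler_wpM2r ?sqrtr_ge0//.
  rewrite (_ : (t - 1) / 2 = - ((1 - t) / 2)); last by field.
  rewrite !powRN lef_pV2 ?posrE ?powR_gt0//.
  by apply: ge0_ler_powR; rewrite ?nnegrE ?divr_ge0 ?subr_ge0 ?(ltW t1).
- by rewrite subr_ge0; apply: ge0_ler_powR; rewrite ?nnegrE ?divr_ge0 ?(ltW t0).
- by rewrite mulr_ge0 ?powR_ge0// subr_ge0 ler_sqrt.
Qed.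

End concavity.

(** * A maximizer of [int f^al] over a convex family, and its first-order condition *)

Section extremal.
Context d (Om : measurableType d) (R : realType) (mu : {measure set Om -> \bar R}).

Let measurable_powRs (f : Om -> R) (s : R) : measurable_fun setT f ->
  measurable_fun setT (fun w => f w `^ s).
Proof. exact: (@measurableT_comp _ _ _ _ _ _ (@powR R ^~ s)). Qed.

Lemma ge0_integral_lin (D : set Om) (a b : R) (f g : Om -> R) : measurable D ->
  0 <= a -> 0 <= b ->
  measurable_fun setT f -> measurable_fun setT g ->
  (forall w, 0 <= f w) -> (forall w, 0 <= g w) ->
  (\int[mu]_(w in D) (a * f w + b * g w)%:E =
   a%:E * \int[mu]_(w in D) (f w)%:E + b%:E * \int[mu]_(w in D) (g w)%:E)%E.
Proof.
move=> mD a0 b0 mf mg f0 g0.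
have mfE : measurable_fun D (EFin \o f).
  by apply: measurable_funTS; exact/measurable_EFinP.
have mgE : measurable_fun D (EFin \o g).
  by apply: measurable_funTS; exact/measurable_EFinP.
under eq_integral do rewrite EFinD !EFinM.
rewrite ge0_integralD//; first last.
- by apply: emeasurable_funM => //; exact: measurable_cst.
- by move=> w _; rewrite -EFinM lee_fin mulr_ge0.
- by apply: emeasurable_funM => //; exact: measurable_cst.
- by move=> w _; rewrite -EFinM lee_fin mulr_ge0.
by congr (_ + _)%E; rewrite ge0_integralZl// => w _; rewrite lee_fin.
Qed.

(** A positive limit admits negative exponents; the extremal argument uses [al - 1] and [al - 2]. *)
Lemma cvg_powR_pos (s : R) (u : nat -> R) (l : R) : 0 < l -> (forall n, 0 <= u n) ->
  u @ \oo --> l -> u n `^ s @[n --> \oo] --> l `^ s.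
Proof.
move=> l0 u0 ul.
have pos (r : R) : 0 < r -> u n `^ r @[n --> \oo] --> l `^ r.
  move=> r0; have := cvg_norm_powR r0 ul; rewrite gtr0_norm//.
  by under eq_fun do rewrite ger0_norm//.
have [s0|s0|->] := ltgtP s 0.
- have := pos (- s); rewrite oppr_gt0 => /(_ s0) h.
  rewrite -(opprK s) powRN; under eq_fun do rewrite powRN.
  by apply: cvgV => //; rewrite gt_eqF// powR_gt0.
- exact: pos.
- by rewrite powRr0; under eq_fun do rewrite powRr0; exact: cvg_cst.
Qed.

Context (al K : R) (F : set (Om -> R)).
Hypothesis al01 : 0 < al < 1.
Hypothesis F0 : F !=set0.
Hypothesis Fm : forall f, F f -> measurable_fun setT f.
Hypothesis Fge0 : forall f, F f -> forall w, 0 <= f w.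
Hypothesis Fconvex : forall t f g, 0 <= t <= 1 -> F f -> F g ->
  F (fun w => (1 - t) * f w + t * g w).
Hypothesis FK : forall f, F f -> (\int[mu]_w (f w `^ al)%:E <= K%:E)%E.

Let al0 : 0 < al. Proof. by case/andP: al01. Qed.
Let al1 : al < 1. Proof. by case/andP: al01. Qed.
Let al01w : 0 <= al <= 1. Proof. by rewrite !ltW. Qed.

Let J (f : Om -> R) : R := fine (\int[mu]_w (f w `^ al)%:E)%E.

Let IJ f : F f -> (\int[mu]_w (f w `^ al)%:E = (J f)%:E)%E.
Proof.
move=> Ff; rewrite fineK// ge0_fin_numE; first by rewrite (le_lt_trans (FK Ff))// ltry.
by apply: integral_ge0 => w _; rewrite lee_fin powR_ge0.
Qed.

Let A := [set J f | f in F].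
Let M := sup A.

Let J_ge0 f : 0 <= J f.
Proof. by apply/fine_ge0/integral_ge0 => w _; rewrite lee_fin powR_ge0. Qed.

Let JK f : F f -> J f <= K.
Proof. by move=> Ff; rewrite -lee_fin -IJ//; exact: FK. Qed.

Let A_sup : has_sup A.
Proof.
split; first by have [f Ff] := F0; exists (J f); exists f.
by exists K => _ [f Ff <-]; exact: JK.
Qed.

Let JM f : F f -> J f <= M.
Proof. by move=> Ff; apply: sup_upper_bound => //; exists f. Qed.

Let M_ge0 : 0 <= M.
Proof. by have [f Ff] := F0; apply: le_trans (JM Ff). Qed.

Let MK : M <= K.
Proof. by apply: ge_sup; [exact: A_sup.1|move=> _ [f Ff <-]; exact: JK]. Qed.

(** The constant of [powR_midpoint_gap] at [t = al]. *)
Let r0 := Num.min al (1 - al) / 4.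

Let r0_gt0 : 0 < r0.
Proof. by rewrite divr_gt0// lt_min al0 subr_gt0. Qed.

(* Fast enough for [z_fast], and for [eps n / tt n --> 0] in [KKM]. *)
Let eps n : R := r0 * 16^-1 ^+ n.

Let eps_gt0 n : 0 < eps n. Proof. by rewrite mulr_gt0// exprn_gt0. Qed.

Let phi_ex : exists phi : nat -> Om -> R, forall n, F (phi n) /\ M - eps n < J (phi n).
Proof.
have /choice[phi phiP] : forall n, exists f, F f /\ M - eps n < J f.
  by move=> n; have [_ [f Ff <-] h] := sup_adherent (eps_gt0 n) A_sup; exists f.
by exists phi.
Qed.

Section with_phi.
Variable phi : nat -> Om -> R.
Hypothesis phiP : forall n, F (phi n) /\ M - eps n < J (phi n).

Let Fphi n : F (phi n) := (phiP n).1.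
Let mphi n : measurable_fun setT (phi n) := Fm (Fphi n).
Let phi0 n w : 0 <= phi n w := Fge0 (Fphi n) w.

Let z n w := phi n w `^ (al / 2).

Let mz n : measurable_fun setT (z n). Proof. exact: measurable_powRs. Qed.

(** The midpoint of two near-maximizers stays in [F], so its integral is at most [M]. Integrating
    [powR_midpoint_gap] leaves at most [eps n] for [r0] times the squared [L_2] distance, and
    [eps n / r0] is the square of [4^-1 ^+ n]. *)
Let z_fast n :
  (\int[mu]_w (`|z n.+1 w - z n w| `^ 2)%:E <= ((1 * 4^-1 ^+ n) `^ 2)%:E)%E.
Proof.
pose mid w := (1 - 2^-1) * phi n w + 2^-1 * phi n.+1 w.
have Fmid : F mid by apply: Fconvex => //; apply/andP; split; lra.
set D := (\int[mu]_w _)%E.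
have md : measurable_fun setT (fun w => `|z n.+1 w - z n w| `^ 2).
  by apply/measurable_EFinP/measurable_powR_norm; exact: measurable_funB.
have mp m : measurable_fun setT (fun w => phi m w `^ al) by exact: measurable_powRs.
have D0 : (0 <= D)%E by apply: integral_ge0 => w _; rewrite lee_fin powR_ge0.
have h1 : (1%:E * (2^-1%:E * (J (phi n))%:E + 2^-1%:E * (J (phi n.+1))%:E) + r0%:E * D <= M%:E)%E.
  have p0 m w : 0 <= phi m w `^ al by exact: powR_ge0.
  have i2 : 0 <= 2^-1 :> R by rewrite invr_ge0.
  have d0 w : 0 <= `|z n.+1 w - z n w| `^ 2 by exact: powR_ge0.
  pose s w := 2^-1 * phi n w `^ al + 2^-1 * phi n.+1 w `^ al.
  have ms : measurable_fun setT s by apply: measurable_funD; exact: measurable_funM.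
  have s0 w : 0 <= s w by rewrite addr_ge0// mulr_ge0.
  have E1 := ge0_integral_lin measurableT i2 i2 (mp n) (mp n.+1) (p0 n) (p0 n.+1).
  have E2 := ge0_integral_lin measurableT ler01 (ltW r0_gt0) ms md s0 d0.
  have IJn := IJ (Fphi n); have IJSn := IJ (Fphi n.+1); have IJm := IJ Fmid.
  have := JM Fmid; rewrite -lee_fin; move: IJn IJSn IJm.
  move: (J (phi n)) (J (phi n.+1)) (J mid) => a b c IJn IJSn IJm; apply: le_trans.
  rewrite -IJn -IJSn -IJm -E1 -E2.
  apply: ge0_le_integral => //.
  - by move=> w _; rewrite lee_fin mul1r addr_ge0// mulr_ge0// ltW.
  - by apply/measurable_EFinP; apply: measurable_funD; exact: measurable_funM.
  - by apply/measurable_EFinP/measurable_powRs; exact: Fm.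
  - move=> w _; rewrite lee_fin.
    have h := powR_midpoint_gap al01 (phi0 n w) (phi0 n.+1 w).
    rewrite /mid (_ : (1 - 2^-1) * _ + _ = (phi n w + phi n.+1 w) / 2); last by field.
    apply: le_trans h; rewrite powR_mulrn// real_normK ?num_real// -/(z n w) -/(z n.+1 w).
    rewrite /r0 /s le_eqVlt; apply/orP; left; apply/eqP; ring.
have h2 : (r0%:E * D <= r0%:E * ((1 * 4^-1 ^+ n) `^ 2)%:E)%E.
  rewrite -EFinM (_ : r0 * _ = eps n); last first.
    rewrite mul1r powR_mulrn ?exprn_ge0// exprAC /eps; congr (_ * _ ^+ n).
    by rewrite expr2 -invfM -natrM.
  have e1 : eps n.+1 <= eps n by rewrite /eps exprS; have := eps_gt0 n; rewrite /eps => ?; lra.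
  have [_ a1] := phiP n; have [_ a2] := phiP n.+1.
  move: h1 a1 a2; move: (J (phi n)) (J (phi n.+1)) => a b h1 a1 a2.
  move: h1; rewrite -EFinM mul1r addeC -leeBrDr//.
  move/le_trans; apply; rewrite -EFinB lee_fin; lra.
by move: h2; rewrite lee_pmul2l.
Qed.

Lemma maximizing_cvg : exists2 z0 : Om -> R, measurable_fun setT z0 &
  {ae mu, forall w, phi n w `^ (al / 2) @[n --> \oo] --> z0 w}.
Proof. exact: (@fast_cvg_ae _ _ _ mu 2 1 z (ler1n R 2) ler01 mz z_fast). Qed.

Let tt n : R := 2^-1 ^+ n.+1.

Let tt_gt0 n : 0 < tt n. Proof. by rewrite exprn_gt0. Qed.

Let tt_le n : tt n <= 2^-1.
Proof. by rewrite /tt exprS ler_piMr// exprn_ile1// invf_le1// ler1n. Qed.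

Let tt01 n : 0 <= tt n <= 1.
Proof. by have := tt_gt0 n; have := tt_le n => ? ?; apply/andP; split; lra. Qed.

Let tt_lt1 n : 0 < 1 - tt n. Proof. by have := tt_le n => ?; lra. Qed.

Let tt0 : tt @ \oo --> (0 : R).
Proof.
rewrite (_ : tt = geometric 2^-1 2^-1).
  by apply: cvg_geometric; rewrite ger0_norm// invf_lt1// ltr1n.
by apply/funext => n; rewrite /tt exprS.
Qed.

(* Maximality tested in the direction of [f]; the step [tt n] tends to 0 more slowly
   than [eps n], so the error disappears in the limit. *)
Let y (f : Om -> R) n w := (1 - tt n) * phi n w + tt n * f w.

Let Fy f n : F f -> F (y f n). Proof. by move=> Ff; exact: Fconvex. Qed.

(** The first term pays for shrinking [phi n] by [1 - tt n], the second for the distance of [phi n]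
    from maximality, divided by the step. *)
Let KK n : R := M * (1 - tt n) `^ (al - 1) + eps n / (al * tt n).

Let KKM : KK @ \oo --> M.
Proof.
rewrite -[X in _ --> X]addr0 -[X in _ --> X + _]mulr1; apply: cvgD.
  apply: cvgM; first exact: cvg_cst.
  have h := @cvg_powR_pos (al - 1) (fun n => 1 - tt n) 1 ltr01.
  rewrite powR1 in h; apply: h => [n|]; first exact: ltW.
  by rewrite -[X in _ --> X]subr0; apply: cvgB => //; exact: cvg_cst.
rewrite (_ : (fun n => _) = geometric (r0 * 2 / al) 8^-1).
  by apply: cvg_geometric; rewrite ger0_norm// invf_lt1// ltr1n.
apply/funext => n; rewrite /eps /tt /geometric/= (_ : 16^-1 = 2^-1 * 8^-1); last by field.
rewrite exprMn exprS; field.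
by rewrite expf_neq0 ?gt_eqF.
Qed.

(** The tangent at [y f n], evaluated at [(1 - tt n) * phi n], bounds [y f n]^ al[from below by]((1
    - tt n) * phi n) [^ al] plus [al * tt n] times the integrand. The integral of [y f n]^
    al[is at most]M[, that of]phi n [^ al] exceeds [M - eps n]. *)
Let est f n : F f -> (\int[mu]_w (f w * y f n w `^ (al - 1))%:E <= (KK n)%:E)%E.
Proof.
move=> Ff; have f0 := Fge0 Ff; have mf := Fm Ff.
have y0 := Fge0 (Fy n Ff); have my := Fm (Fy n Ff).
set X := (\int[mu]_w _)%E.
have c0 : 0 < al * tt n by rewrite mulr_gt0.
have mfy : measurable_fun setT (fun w => f w * y f n w `^ (al - 1)).
  by apply: measurable_funM => //; exact: measurable_powRs.
have mp : measurable_fun setT (fun w => phi n w `^ al) by exact: measurable_powRs.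
have fy0 w : 0 <= f w * y f n w `^ (al - 1) by rewrite mulr_ge0 ?powR_ge0.
have p0 w : 0 <= phi n w `^ al by exact: powR_ge0.
have d0 : 0 <= (1 - tt n) `^ al by exact: powR_ge0.
have E := ge0_integral_lin measurableT (ltW c0) d0 mfy mp fy0 p0.
have h : (\int[mu]_w (al * tt n * (f w * y f n w `^ (al - 1)) + (1 - tt n) `^ al * phi n w `^ al)%:E
    <= \int[mu]_w (y f n w `^ al)%:E)%E.
  apply: ge0_le_integral => //.
  - by move=> w _; rewrite lee_fin (addr_ge0 (mulr_ge0 (ltW c0) (fy0 w)) (mulr_ge0 d0 (p0 w))).
  - by apply/measurable_EFinP; apply: measurable_funD; exact: measurable_funM.
  - by apply/measurable_EFinP; exact: measurable_powRs.
  move=> w _; rewrite lee_fin -powRM ?(ltW (tt_lt1 n))//.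
  have a0 : 0 <= (1 - tt n) * phi n w by rewrite mulr_ge0 ?(ltW (tt_lt1 n)).
  have b0 : 0 <= tt n * f w by rewrite mulr_ge0 ?(ltW (tt_gt0 n)).
  have [yw0|yw0] := eqVneq (y f n w) 0.
    have [az bz] : (1 - tt n) * phi n w = 0 /\ tt n * f w = 0.
      by move: yw0; rewrite /y => yw0; split; lra.
    have fw0 : f w = 0 by move/eqP: bz; rewrite mulf_eq0 gt_eqF//= => /eqP.
    by rewrite az fw0 mul0r mulr0 powR0 ?gt_eqF// addr0 powR_ge0.
  have yp : 0 < y f n w by rewrite lt_neqAle eq_sym yw0 y0.
  have := powR_tangent_le al01w a0 yp.
  rewrite (_ : (1 - tt n) * phi n w - y f n w = - (tt n * f w)); last by rewrite /y; ring.
  move: (y f n w `^ (al - 1)) (y f n w `^ al) (((1 - tt n) * phi n w) `^ al) => u v t h; lra.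
(* The tangent at [1 - tt n] evaluated at 1. Multiplied by [M], it gives the first term of [KK]. *)
have t1 : 1 <= (1 - tt n) `^ al + al * (1 - tt n) `^ (al - 1) * tt n.
  have := powR_tangent_le al01w ler01 (tt_lt1 n).
  by rewrite powR1 (_ : 1 - (1 - tt n) = tt n)//; ring.
have [_ Jn] := phiP n.
have := JM (Fy n Ff); rewrite -lee_fin -(IJ (Fy n Ff)) => /(le_trans h).
rewrite E IJ; last exact: Fphi.
move: Jn; move: (J (phi n)) => a Ja hh.
have c0E : (0 < (al * tt n)%:E)%E by rewrite lte_fin.
rewrite -(lee_pmul2l _ c0E)//; move: hh; rewrite -EFinM -leeBrDr//.
move/le_trans; apply; rewrite -EFinM -EFinB lee_fin.
rewrite /KK mulrDr [X in _ <= _ + X]mulrC divfK ?gt_eqF//.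
have d1 : (1 - tt n) `^ al <= 1.
  rewrite [leRHS](_ : 1 = 1 `^ al); last by rewrite powR1.
  apply: ge0_ler_powR; rewrite ?nnegrE ?(ltW (tt_lt1 n)) ?(ltW al0)//.
  by have := tt_gt0 n => ?; lra.
have h3 := ler_wpM2l M_ge0 t1.
have h4 : (1 - tt n) `^ al * (M - a) <= eps n.
  have Mae : M - a <= eps n by lra.
  by apply: le_trans (ler_wpM2l d0 Mae) _; rewrite ler_piMl// ltW.
move: h3 h4; rewrite mulr1; move: (eps n) ((1 - tt n) `^ al) ((1 - tt n) `^ (al - 1)) (tt n) => e u v t h3 h4.
nra.
Qed.

Variable z0 : Om -> R.
Hypothesis mz0 : measurable_fun setT z0.
Hypothesis zz0 : {ae mu, forall w, z n w @[n --> \oo] --> z0 w}.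

(** Undoes the power [al / 2] of [z]; the absolute value is the form in which [cvg_norm_powR] passes
    to the limit. *)
Let f0 w := `|z0 w| `^ (2 / al).

Let mf0 : measurable_fun setT f0.
Proof. by apply: measurable_powRs; exact: measurableT_comp. Qed.

Let f0_ge0 w : 0 <= f0 w. Proof. exact: powR_ge0. Qed.

Let phi_f0 : {ae mu, forall w, phi n w @[n --> \oo] --> f0 w}.
Proof.
apply: filterS zz0 => w zw.
have a2 : 0 < 2 / al by rewrite divr_gt0.
have -> : phi ^~ w = (fun n => `|z n w| `^ (2 / al)); last exact: cvg_norm_powR.
apply/funext => n; rewrite ger0_norm ?powR_ge0// /z -powRrM (_ : al / 2 * (2 / al) = 1) ?powRr1//.
by field; rewrite gt_eqF.
Qed.

Let f0_int : (\int[mu]_w (f0 w `^ al)%:E <= M%:E)%E.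
Proof.
apply: (@fatou_ae_const _ _ _ mu (fun n w => phi n w `^ al)).
- by move=> n; exact: measurable_powRs.
- by move=> n w; exact: powR_ge0.
- exact: measurable_powRs.
- by move=> w; exact: powR_ge0.
- apply: filterS phi_f0 => w h; have := cvg_norm_powR al0 h; rewrite ger0_norm//.
  by under eq_fun do rewrite ger0_norm//.
- by move=> n; rewrite IJ// lee_fin; exact: JM.
Qed.

Let ee k : R := k.+1%:R^-1.

Let ee_gt0 k : 0 < ee k. Proof. by rewrite invr_gt0. Qed.

Let ee0 : ee @ \oo --> (0 : R). Proof. exact: cvg_harmonic. Qed.

(* Where [f0] vanishes [f0 `^ (al - 1)] blows up, while [0 `^ (al - 1) = 0] in
   the library: the limits are taken on truncations. *)
Let tr k (x : R) := Num.max x (ee k).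

Let tr_gt0 k x : 0 < tr k x. Proof. by rewrite lt_max ee_gt0 orbT. Qed.

Let mtr k (f : Om -> R) : measurable_fun setT f -> measurable_fun setT (fun w => tr k (f w)).
Proof. by move=> mf; apply: measurable_maxr. Qed.

Let powR_anti (x x' : R) : 0 < x -> x <= x' -> x' `^ (al - 1) <= x `^ (al - 1).
Proof.
move=> x0 xx'; have x'0 := lt_le_trans x0 xx'.
rewrite -opprB !powRN lef_pV2 ?posrE ?powR_gt0//.
by apply: ge0_ler_powR; rewrite ?nnegrE ?subr_ge0 ?(ltW al1) ?(ltW x0) ?(ltW x'0).
Qed.

(** Truncating from below only decreases a negative power, so [est] still applies, and away from 0
    that power is continuous: Fatou's lemma lets [n] tend to infinity. *)
Let trunc f k : F f -> (\int[mu]_w (f w * tr k (f0 w) `^ (al - 1))%:E <= M%:E)%E.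
Proof.
move=> Ff; have fge0 := Fge0 Ff; have mf := Fm Ff.
apply: (@fatou_ae _ _ _ mu (fun n w => f w * tr k (y f n w) `^ (al - 1)) _ KK) => //.
- move=> n; apply: measurable_funM => //; apply: measurable_powRs; apply: mtr.
  exact: Fm (Fy n Ff).
- by move=> n w; rewrite mulr_ge0 ?powR_ge0.
- by apply: measurable_funM => //; apply: measurable_powRs; exact: mtr.
- by move=> w; rewrite mulr_ge0 ?powR_ge0.
- apply: filterS phi_f0 => w h; apply: cvgM; first exact: cvg_cst.
  apply: cvg_powR_pos => //; first by move=> n; exact: ltW.
  have yw : y f n w @[n --> \oo] --> (1 - 0) * f0 w + 0 * f w.
    apply: cvgD; apply: cvgM => //; last exact: cvg_cst.
    by apply: cvgB => //; exact: cvg_cst.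
  rewrite subr0 mul1r mul0r addr0 in yw.
  have ct : {for f0 w, continuous (tr k)}.
    by apply: continuous_max; [exact: cvg_id|exact: cvg_cst].
  exact: (cvg_comp _ _ yw ct).
- move=> n; apply: le_trans (est n Ff).
  have y0 := Fge0 (Fy n Ff); have my := Fm (Fy n Ff).
  apply: ge0_le_integral => //.
  + by move=> w _; rewrite lee_fin mulr_ge0 ?powR_ge0.
  + apply/measurable_EFinP; apply: measurable_funM => //.
    by apply: measurable_powRs; exact: mtr.
  + by apply/measurable_EFinP; apply: measurable_funM => //; exact: measurable_powRs.
  move=> w _; rewrite lee_fin.
  have [yw0|yw0] := eqVneq (y f n w) 0.
    have a0 : 0 <= (1 - tt n) * phi n w by rewrite mulr_ge0 ?(ltW (tt_lt1 n)).
    have b0 : 0 <= tt n * f w by rewrite mulr_ge0 ?(ltW (tt_gt0 n)).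
    have bz : tt n * f w = 0 by move: yw0; rewrite /y => yw0; lra.
    have fw0 : f w = 0 by move/eqP: bz; rewrite mulf_eq0 gt_eqF//= => /eqP.
    by rewrite fw0 !mul0r.
  rewrite ler_wpM2l//; apply: powR_anti; last by rewrite le_max lexx.
  by rewrite lt_neqAle eq_sym yw0 y0.
Qed.

Let split_pow x : 0 < x -> x `^ (al - 1) = x * x `^ (al - 2).
Proof.
by move=> x0; rewrite -{2}(powRr1 (ltW x0)) powRM_exp//; congr (_ `^ _); ring.
Qed.

Let weighted f : F f -> (\int[mu]_w (f w * f0 w `^ (al - 1))%:E <= M%:E)%E.
Proof.
move=> Ff; have fge0 := Fge0 Ff; have mf := Fm Ff.
have mg k : measurable_fun setT (fun w => f w * (f0 w * tr k (f0 w) `^ (al - 2))).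
  apply: measurable_funM => //; apply: measurable_funM => //.
  by apply: measurable_powRs; exact: mtr.
apply: (@fatou_ae_const _ _ _ mu (fun k w => f w * (f0 w * tr k (f0 w) `^ (al - 2)))) => //.
- by move=> k w; rewrite !mulr_ge0 ?powR_ge0.
- by apply: measurable_funM => //; exact: measurable_powRs.
- by move=> w; rewrite mulr_ge0 ?powR_ge0.
- apply: aeW => w; apply: cvgM; first exact: cvg_cst.
  have [fw0|fw0] := eqVneq (f0 w) 0.
    rewrite fw0 powR0; last by rewrite lt_eqF// subr_lt0.
    by under eq_fun do rewrite mul0r; exact: cvg_cst.
  have fp : 0 < f0 w by rewrite lt_neqAle eq_sym fw0 f0_ge0.
  rewrite (split_pow fp).
  apply: cvgM; first exact: cvg_cst.
  apply: cvg_powR_pos => //; first by move=> n; exact: ltW.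
  have ct : {for 0, continuous (Num.max (f0 w))}.
    by apply: continuous_max; [exact: cvg_cst|exact: cvg_id].
  have := cvg_comp _ _ ee0 ct; rewrite max_l//; exact.
- move=> k; apply: le_trans (trunc k Ff); apply: ge0_le_integral => //.
  + by move=> w _; rewrite lee_fin !mulr_ge0 ?powR_ge0.
  + exact/measurable_EFinP.
  + apply/measurable_EFinP; apply: measurable_funM => //.
    by apply: measurable_powRs; exact: mtr.
  move=> w _; rewrite lee_fin ler_wpM2l//.
  rewrite (split_pow (tr_gt0 _ _)) ler_wpM2r ?powR_ge0//.
  by rewrite le_max lexx.
Qed.

(** On the zero set of [f0] the truncated weight is the constant [ee k]^ (al -
    1)[, so]trunc[bounds the integral of]f[there by]ee k [^ (1 - al) * M], which tends to 0. *)
Let vanish f : F f -> {ae mu, forall w, f0 w = 0 -> f w = 0}.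
Proof.
move=> Ff; have fge0 := Fge0 Ff; have mf := Fm Ff.
pose B := f0 @^-1` [set 0].
have mB : measurable B by rewrite -[B]setTI; exact: mf0.
have mfB : measurable_fun setT (fun w => f w * \1_B w).
  by apply: measurable_funM => //; exact: measurable_indic.
have fB0 w : 0 <= f w * \1_B w by rewrite mulr_ge0.
have I0 : (\int[mu]_w (f w * \1_B w)%:E <= 0%:E)%E.
  apply: (@fatou_ae _ _ _ mu (fun _ w => f w * \1_B w) _ (fun k => ee k `^ (1 - al) * M)) => //.
  - by apply: aeW => w; exact: cvg_cst.
  - move=> k; rewrite EFinM.
    have e0 : 0 <= ee k `^ (1 - al) by exact: powR_ge0.
    have eE : (0 <= (ee k `^ (1 - al))%:E)%E by rewrite lee_fin.
    apply: le_trans (lee_wpmul2l eE (trunc k Ff)).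
    have mt : measurable_fun setT (fun w => f w * tr k (f0 w) `^ (al - 1)).
      by apply: measurable_funM => //; apply: measurable_powRs; exact: mtr.
    rewrite -ge0_integralZl//; first last.
    + by move=> w _; rewrite lee_fin mulr_ge0 ?powR_ge0.
    + exact/measurable_EFinP.
    apply: ge0_le_integral => //.
    + by move=> w _; rewrite lee_fin.
    + exact/measurable_EFinP.
    + by apply: emeasurable_funM; [exact: measurable_cst|exact/measurable_EFinP].
    move=> w _; rewrite -EFinM lee_fin indicE.
    have [/set_mem/= wB|wB] := boolP (w \in B); last first.
      by rewrite mulr0 !mulr_ge0 ?powR_ge0.
    rewrite wB /tr max_r ?(ltW (ee_gt0 k))// mulr1 mulrCA powRM_exp// (_ : _ + _ = 0); last by ring.
    by rewrite powRr0 mulr1.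
  - rewrite -[X in _ --> X](mul0r M); apply: cvgM; last exact: cvg_cst.
    have a1 : 0 < 1 - al by rewrite subr_gt0.
    have := cvg_norm_powR a1 ee0; rewrite normr0 powR0 ?gt_eqF//.
    by under eq_fun do rewrite gtr0_norm//.
have {}I0 : (\int[mu]_w `|(f w * \1_B w)%:E| = 0)%E.
  under eq_integral do rewrite gee0_abs ?lee_fin//.
  by apply/le_anti; rewrite I0/= integral_ge0// => w _; rewrite lee_fin.
have : ae_eq mu setT (fun w => (f w * \1_B w)%:E) (cst 0%E).
  by apply/(ae_eq_integral_abs mu measurableT) => //; exact/measurable_EFinP.
apply: filterS => w /(_ I) [] h w0; move: h.
by rewrite indicE mem_set ?mulr1.
Qed.

Lemma extremal_of_limit : exists (f0 : Om -> R) (M : R),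
  [/\ measurable_fun setT f0, (forall w, 0 <= f0 w),
    0 <= M <= K, (\int[mu]_w (f0 w `^ al)%:E <= M%:E)%E &
    forall f, F f -> (\int[mu]_w (f w * f0 w `^ (al - 1))%:E <= M%:E)%E /\
      {ae mu, forall w, f0 w = 0 -> f w = 0}].
Proof.
exists f0, M; split=> //; first by rewrite M_ge0.
by move=> f Ff; split; [exact: weighted|exact: vanish].
Qed.

End with_phi.

(* [f0] maximizes [f |-> int f^al] over the a.e. closure of [F], so the derivative
   of this functional at [f0] in the direction of [f - f0] is nonpositive. The last
   clause matters because [0 `^ (al - 1) = 0]. *)
Lemma concave_extremal : exists f0 : Om -> R,
  [/\ measurable_fun setT f0, (forall w, 0 <= f0 w),
      (\int[mu]_w (f0 w `^ al)%:E <= K%:E)%E &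
      forall f, F f -> (\int[mu]_w (f w * f0 w `^ (al - 1))%:E <= K%:E)%E /\
        {ae mu, forall w, f0 w = 0 -> f w = 0}].
Proof.
have [phi phiP] := phi_ex.
have [z0 mz0 zz0] := maximizing_cvg phiP.
have [f0 [M' [mf0 f00 /andP[_ M'K] f0M f0P]]] := extremal_of_limit phiP mz0 zz0.
have M'KE : (M'%:E <= K%:E)%E by rewrite lee_fin.
exists f0; split=> //; first exact: le_trans M'KE.
by move=> f /f0P[h1 h2]; split=> //; exact: le_trans M'KE.
Qed.

End extremal.

(** * The multiplier built from the extremal density *)

Section maurey.
Context (R : realType) d (Om : measurableType d) (mu : {measure set Om -> \bar R}).
Context (E : normedModType R) (p q : R) (p1 : 1 <= p) (q1 : 1 <= q) (qp : q < p).

Let p0 : 0 < p. Proof. exact: lt_le_trans p1. Qed.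
Let q0 : 0 < q. Proof. exact: lt_le_trans q1. Qed.

(** Hoelder's inequality for [g]^ q[and]|h| [^ q] with exponents [1 / (1 - al)] and [1 / al]: the
    power [1 / (1 - al)] of [g]^ q[is]K [^ (al / (1 - al)) * f0]^ al[, so its norm is at most]K = C
    [^ q]. *)
Lemma LpN_mul_le (C : R) (f0 h : Om -> R) : 0 < C ->
  measurable_fun setT f0 -> (forall w, 0 <= f0 w) -> measurable_fun setT h ->
  (\int[mu]_w (f0 w `^ (q / p))%:E <= (C `^ q)%:E)%E ->
  (LpN mu q (fun w => (C `^ q) `^ p^-1 * f0 w `^ ((1 - q / p) / p) * h w)%R
    <= C%:E * LpN mu p h)%E.
Proof.
move=> C0 mf0 f00 mh f0K.
set al := q / p; set K := C `^ q.
have K0 : 0 < K by rewrite powR_gt0.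
have al0 : 0 < al by rewrite divr_gt0.
have al1 : 0 < 1 - al by rewrite subr_gt0 ltr_pdivrMr ?mul1r.
pose g w := K `^ p^-1 * f0 w `^ ((1 - al) / p).
have g0 w : 0 <= g w by rewrite mulr_ge0 ?powR_ge0.
have mpow (f : Om -> R) (s : R) : measurable_fun setT f ->
    measurable_fun setT (fun w => f w `^ s).
  exact: (@measurableT_comp _ _ _ _ _ _ (@powR R ^~ s)).
have mg : measurable_fun setT g by apply: measurable_funM => //; exact: mpow.
pose u w := g w `^ q; pose v w := `|h w| `^ q.
have mu' : measurable_fun setT u by exact: mpow.
have mv : measurable_fun setT v by apply: mpow; exact: measurableT_comp.
have i1 : 0 < (1 - al)^-1 by rewrite invr_gt0.
have i2 : 0 < al^-1 by rewrite invr_gt0.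
have i12 : (1 - al)^-1^-1 + al^-1^-1 = 1 by rewrite !invrK subrK.
have H := hoelder mu mu' mv i1 i2 i12.
have HL : ('N[mu]_1[EFin \o (u \* v)%R] = \int[mu]_w (`|g w * h w| `^ q)%:E)%E.
  rewrite Lnorm1; apply: eq_integral => w _ /=.
  rewrite ger0_norm ?mulr_ge0 ?powR_ge0// /u /v.
  by rewrite normrM (ger0_norm (g0 w)) (@powRM _ (g w) `|h w|).
have Hv : ('N[mu]_(al^-1)%:E[EFin \o v] = (\int[mu]_w (`|h w| `^ p)%:E) `^ al)%E.
  rewrite -/(LpN mu al^-1 v) LpN_powE invrK; congr (_ `^ _)%E.
  apply: eq_integral => w _; rewrite ger0_norm ?powR_ge0// /v -powRrM; congr (_ `^ _)%:E.
  by rewrite /al; field; rewrite !gt_eqF.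
have Hu : ('N[mu]_((1 - al)^-1)%:E[EFin \o u] <= K%:E)%E.
  rewrite [X in (X <= _)%E](_ : _ = LpN mu (1 - al)^-1 u)//.
  apply/LpN_leP; first by rewrite invf_ge1// lerBlDr lerDl ltW.
    exact: ltW.
  under eq_integral => w _.
    have -> : `|u w| `^ (1 - al)^-1 = K `^ (al / (1 - al)) * f0 w `^ al.
      rewrite ger0_norm ?powR_ge0// /u /g -powRrM powRM ?powR_ge0// -!powRrM.
      congr (_ `^ _ * _ `^ _); rewrite /al; field; rewrite ?gt_eqF//=.
        by rewrite subr_gt0.
      by rewrite subr_gt0.
    rewrite EFinM; over.
  rewrite ge0_integralZl//; first last.
  - by rewrite lee_fin powR_ge0.
  - by move=> w _; rewrite lee_fin powR_ge0.
  - by apply/measurable_EFinP; exact: mpow.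
  have KE : (0 <= (K `^ (al / (1 - al)))%:E)%E by rewrite lee_fin powR_ge0.
  apply: le_trans (lee_wpmul2l KE f0K) _; rewrite -EFinM lee_fin -/K.
  rewrite -[X in _ * X](powRr1 (ltW K0)) powRM_exp// le_eqVlt; apply/orP; left; apply/eqP.
  by congr (_ `^ _); field; rewrite gt_eqF.
rewrite -/(g _) LpN_powE.
have H2 : (\int[mu]_w (`|g w * h w| `^ q)%:E <= K%:E * (\int[mu]_w (`|h w| `^ p)%:E) `^ al)%E.
  rewrite -HL -Hv; apply: le_trans H _; apply: lee_wpmul2r => //; exact: Lnorm_ge0.
have I0 (f : Om -> R) (s : R) : (0 <= \int[mu]_w (`|f w| `^ s)%:E)%E.
  by apply: integral_ge0 => w _; rewrite lee_fin powR_ge0.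
have qi0 : 0 <= q^-1 by rewrite invr_ge0 ltW.
apply: (@le_trans _ _ ((K%:E * (\int[mu]_w (`|h w| `^ p)%:E) `^ al) `^ q^-1)%E).
  apply: (gt0_ler_poweR qi0) => //; rewrite in_itv/= leey andbT//.
  by rewrite mule_ge0 ?poweR_ge0// lee_fin ltW.
rewrite poweRM ?poweR_ge0 ?lee_fin ?(ltW K0)// LpN_powE -poweRrM poweR_EFin /K -powRrM.
by rewrite mulfV ?gt_eqF// powRr1 ?(ltW C0)// /al mulrC mulrA mulVf ?mul1r ?gt_eqF.
Qed.

Lemma p_convex_operator_factors (C : R) (T : E -> Lp mu q1) : 0 < C -> Lp_linear T ->
  p_convex_operator p C T -> multiplicatively_factors C p1 T.
Proof.
move=> C0 Tlin TC.
set al := q / p; set K := C `^ q.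
have K0 : 0 < K by rewrite powR_gt0.
have al0 : 0 < al by rewrite divr_gt0.
have al1 : 0 < 1 - al by rewrite subr_gt0 ltr_pdivrMr ?mul1r.
have al01 : 0 < al < 1 by rewrite al0 -subr_gt0 al1.
have mT x : measurable_fun setT (T x) by exact: Lp_measurable.
have mpow (f : Om -> R) (s : R) : measurable_fun setT f ->
    measurable_fun setT (fun w => f w `^ s).
  exact: (@measurableT_comp _ _ _ _ _ _ (@powR R ^~ s)).
have TZ a x : {ae mu, forall w, T (a *: x) w = a * T x w}.
  have := Tlin a x 0; rewrite addr0; apply: filterS2 (Lp_linear0 Tlin) => w z ->.
  by rewrite z addr0.
pose Phi n (x : 'I_n -> E) w := \sum_k `|T (x k) w| `^ p.
pose F : set (Om -> R) := [set f : Om -> R | [/\ measurable_fun setT f, (forall w, 0 <= f w) &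
  exists n (x : 'I_n -> E), \sum_k `|x k| `^ p <= 1 /\ {ae mu, forall w, f w = Phi n x w}]].
have F0 : F !=set0.
  exists (cst 0); split=> //; exists 0%N, (fun=> 0); split; first by rewrite big_ord0.
  by apply: aeW => w; rewrite /Phi big_ord0.
have Fcvx t f g : 0 <= t <= 1 -> F f -> F g -> F (fun w => (1 - t) * f w + t * g w).
  move=> /andP[t0 t1] [mf f0 [n [x [x1 xf]]]] [mg g0 [m [y [y1 yg]]]]; split.
  - by apply: measurable_funD; exact: measurable_funM.
  - by move=> w; rewrite addr_ge0// mulr_ge0// subr_ge0.
  pose xy (k : 'I_(n + m)) : E := match fintype.split k with
    | inl i => (1 - t) `^ p^-1 *: x i | inr j => t `^ p^-1 *: y j end.
  have xyl i : xy (lshift m i) = (1 - t) `^ p^-1 *: x i.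
    by rewrite /xy (unsplitK (inl i)).
  have xyr i : xy (rshift n i) = t `^ p^-1 *: y i.
    by rewrite /xy (unsplitK (inr i)).
  have nZ (s : R) (v : E) : 0 <= s -> `|s `^ p^-1 *: v| `^ p = s * `|v| `^ p.
    by move=> s0; rewrite normrZ powRM// ger0_norm ?powR_ge0// powRVK.
  exists (n + m)%N, xy; split.
    rewrite big_split_ord/=.
    under eq_bigr do rewrite xyl nZ ?subr_ge0//.
    under [X in _ + X <= _]eq_bigr do rewrite xyr nZ//.
    rewrite -!mulr_sumr; nra.
  have hx : {ae mu, forall w, forall i, T ((1 - t) `^ p^-1 *: x i) w = (1 - t) `^ p^-1 * T (x i) w}.
    by apply: filter_forall => i; exact: TZ.
  have hy : {ae mu, forall w, forall i, T (t `^ p^-1 *: y i) w = t `^ p^-1 * T (y i) w}.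
    by apply: filter_forall => i; exact: TZ.
  near=> w; rewrite (near xf w)// (near yg w)// /Phi big_split_ord/=; congr (_ + _).
    rewrite mulr_sumr; apply: eq_bigr => i _; rewrite xyl.
    have -> : T ((1 - t) `^ p^-1 *: x i) w = (1 - t) `^ p^-1 * T (x i) w.
      by have h := near hx w; exact: h.
    by rewrite normrM powRM// ger0_norm ?powR_ge0// powRVK ?subr_ge0.
  rewrite mulr_sumr; apply: eq_bigr => i _; rewrite xyr.
  have -> : T (t `^ p^-1 *: y i) w = t `^ p^-1 * T (y i) w.
    by have h := near hy w; exact: h.
  by rewrite normrM powRM// ger0_norm ?powR_ge0// powRVK.
have FK f : F f -> (\int[mu]_w (f w `^ al)%:E <= K%:E)%E.
  move=> [mf f0 [n [x [x1 xf]]]].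
  have mPhi : measurable_fun setT (fun w => lp_norm p (fun k => T (x k) w)).
    apply: (mpow (Phi n x)); apply: measurable_sum => k.
    by apply: mpow; exact: measurableT_comp.
  have -> : (\int[mu]_w (f w `^ al)%:E = \int[mu]_w (`|lp_norm p (fun k => T (x k) w)| `^ q)%:E)%E.
    apply: ae_eq_integral => //.
    - by apply/measurable_EFinP; exact: mpow.
    - exact: measurable_powR_norm.
    apply: filterS xf => w -> _; rewrite ger0_norm ?lp_norm_ge0// /lp_norm -powRrM.
    by rewrite /al mulrC.
  apply/(LpN_leP mu q1) => //; first exact: ltW.
  apply: le_trans (TC n x) _; rewrite lee_fin ler_piMr ?(ltW C0)//.
  rewrite lp_norm_leP// powR1; apply: le_trans x1.
  by rewrite le_eqVlt; apply/orP; left; apply/eqP/eq_bigr => k _; rewrite normr_id.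
have Fm f : F f -> measurable_fun setT f by case.
have Fge0 f : F f -> forall w, 0 <= f w by case.
have [f0 [mf0 f00 f0K f0F]] := concave_extremal al01 F0 Fm Fge0 Fcvx FK.
pose g w := K `^ p^-1 * f0 w `^ ((1 - al) / p).
have g0 w : 0 <= g w by rewrite mulr_ge0 ?powR_ge0.
have mg : measurable_fun setT g by apply: measurable_funM => //; exact: mpow.
have FT x : x != 0 -> F (fun w => `|T (`|x|^-1 *: x) w| `^ p).
  move=> x0; split; [|by move=> w; exact: powR_ge0|].
    by apply: mpow; exact: measurableT_comp.
  exists 1%N, (fun=> `|x|^-1 *: x); split.
    by rewrite big_ord1 normrZ normfV normr_id mulVf ?normr_eq0// powR1.
  by apply: aeW => w; rewrite /Phi big_ord1.
have Tx_eq x : x != 0 -> {ae mu, forall w, T x w = `|x| * T (`|x|^-1 *: x) w}.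
  move=> x0; apply: filterS (TZ `|x|^-1 x) => w ->.
  by rewrite mulrA mulfV ?mul1r// normr_eq0.
have gp w : (g w)^-1 `^ p = K^-1 * f0 w `^ (al - 1).
  rewrite /g invfM -!powRN powRM ?powR_ge0// -!powRrM.
  rewrite (_ : - p^-1 * p = -1); last by rewrite mulNr mulVf ?gt_eqF.
  by congr (_ `^ _ * _ `^ _); [ring|field; rewrite gt_eqF].
pose Sf x w := T x w * (g w)^-1.
have mSf x : measurable_fun setT (Sf x).
  apply: measurable_funM => //.
  rewrite (_ : (fun w => _) = (fun w => g w `^ (-1))); first exact: mpow.
  by apply/funext => w; rewrite powR_inv1.
have Sf_bound x : (LpN mu p (Sf x) <= `|x|%:E)%E.
  apply/(LpN_leP mu p1) => //.
  have [x0|x0] := eqVneq x 0.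
    rewrite (ae_eq_integral (cst 0%E)) ?integral0 ?lee_fin ?powR_ge0//.
      exact: measurable_powR_norm.
    apply: filterS (Lp_linear0 Tlin) => w Tw _ /=.
    by rewrite /Sf x0 Tw mul0r normr0 powR0// gt_eqF.
  have [hK _] := f0F _ (FT x x0).
  pose c := `|x| `^ p * K^-1.
  have c0 : 0 <= c by rewrite mulr_ge0 ?powR_ge0 ?invr_ge0 ?(ltW K0).
  have mh : measurable_fun setT (fun w => `|T (`|x|^-1 *: x) w| `^ p * f0 w `^ (al - 1)).
    by apply: measurable_funM; apply: mpow => //; exact: measurableT_comp.
  have -> : (\int[mu]_w (`|Sf x w| `^ p)%:E =
      c%:E * \int[mu]_w (`|T (`|x|^-1 *: x) w| `^ p * f0 w `^ (al - 1))%:E)%E.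
    rewrite -ge0_integralZl//; first last.
    - by move=> w _; rewrite lee_fin mulr_ge0 ?powR_ge0.
    - exact/measurable_EFinP.
    apply: ae_eq_integral => //.
    - exact: measurable_powR_norm.
    - by apply: emeasurable_funM; [exact: measurable_cst|exact/measurable_EFinP].
    apply: filterS (Tx_eq x x0) => w Tw _; rewrite -EFinM /Sf normrM powRM//.
    have gi0 : 0 <= (g w)^-1 by rewrite invr_ge0.
    rewrite (ger0_norm gi0) gp Tw normrM normr_id powRM// /c; congr EFin; ring.
  have cE : (0 <= c%:E)%E by rewrite lee_fin.
  apply: le_trans (lee_wpmul2l cE hK) _.
  by rewrite -EFinM lee_fin /c divfK ?gt_eqF.
have SE x : {ae mu, forall w, Lp_of mu p1 (Sf x) w = Sf x w}.
  by apply: Lp_ofE => //; apply: le_lt_trans (Sf_bound x) _; rewrite ltry.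
pose S x : Lp mu p1 := Lp_of mu p1 (Sf x).
pose U (h : Lp mu p1) : Lp mu q1 := Lp_of mu q1 (fun w => g w * h w).
have Ub (h : Lp mu p1) : (LpN mu q (fun w => g w * h w)%R <= C%:E * LpN mu p h)%E.
  by apply: LpN_mul_le => //; exact: Lp_measurable.
have mgh (h : Lp mu p1) : measurable_fun setT (fun w => g w * h w).
  by apply: measurable_funM => //; exact: Lp_measurable.
have UE (h : Lp mu p1) : {ae mu, forall w, U h w = g w * h w}.
  apply: Lp_ofE => //; apply: le_lt_trans (Ub h) _.
  by rewrite lte_mul_pinfty ?lee_fin ?(ltW C0)// Lp_finite.
have TgS x : {ae mu, forall w, T x w = g w * S x w}.
  have [x0|x0] := eqVneq x 0.
    near=> w; rewrite (near (SE x) w)// /Sf x0.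
    by rewrite (near (Lp_linear0 Tlin) w)// mul0r mulr0.
  have [_ van] := f0F _ (FT x x0).
  apply: filterS3 van (Tx_eq x x0) (SE x) => w van Tw ->; rewrite /Sf.
  (* Where [g] vanishes, so does [f0], and the last clause of [concave_extremal] makes [T x] vanish
     there too; the value [0^-1 = 0] is harmless. *)
  have [gw0|gw0] := eqVneq (g w) 0; last by rewrite mulrCA mulfV// mulr1.
  have fw0 : f0 w = 0.
    move/eqP: gw0; rewrite mulf_eq0 => /orP[|/eqP/powR_eq0_eq0//].
    by rewrite gt_eqF// powR_gt0.
  have /powR_eq0_eq0/normr0_eq0 T0 := van fw0.
  by rewrite Tw T0 mulr0 mul0r mulr0.
exists S, U; split.
- split=> [a x y|x].
    near=> w; rewrite (near (SE (a *: x + y)) w)// (near (SE x) w)// (near (SE y) w)//.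
    by rewrite /Sf (near (Tlin a x y) w)// mulrDl mulrA.
  rewrite (_ : LpN mu p (S x) = LpN mu p (Sf x))//.
  apply: LpN_ae => //; first exact: Lp_measurable.
  by apply: filterS (SE x) => w ->.
- split=> [a f h k|f h k] hk.
    apply: filterS3 hk (UE k) (filterI (UE f) (UE h)) => w -> -> [-> ->]; ring.
  by apply: filterS3 hk (UE k) (filterI (UE f) (UE h)) => w -> -> [-> ->]; rewrite maxr_pMr.
- move=> h; rewrite (_ : LpN mu q (U h) = LpN mu q (fun w => g w * h w)%R)//.
  apply: LpN_ae => //; first exact: Lp_measurable.
  by apply: filterS (UE h) => w ->.
- by move=> x; apply: filterS2 (TgS x) (UE (S x)) => w -> ->.
- by exists g.
Unshelve. all: by end_near. Qed.

End maurey.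

(** * Free Banach lattices *)

Section fbl_theory.
Context (R : realType) (E : normedModType R).
Implicit Types (r : R) (f g : dual_space E -> R).

Definition admissible r n (u : 'I_n -> dual_space E) :=
  forall x : E, `|x| <= 1 -> \sum_(k < n) `|u k x| `^ r <= 1.

Lemma admissible_le r n (u : 'I_n -> dual_space E) : 1 <= r -> admissible r u ->
  forall x : E, lp_norm r (fun k => u k x) <= `|x|.
Proof.
move=> r1 ur x; have [->|x0] := eqVneq x 0.
  by rewrite (eq_lp_norm _ (b := fun=> 0)) ?lp_norm0 ?normr0// => k; rewrite linear0.
have nx : 0 < `|x| by rewrite normr_gt0.
have h : lp_norm r (fun k => u k (`|x|^-1 *: x)) <= 1.
  rewrite lp_norm_leP// powR1; apply: ur.
  by rewrite normrZ normfV normr_id mulVf// normr_eq0.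
rewrite -(mulr1 `|x|); apply: le_trans (ler_wpM2l (ltW nx) h).
have := lp_normZ r1 `|x| (fun k => u k (`|x|^-1 *: x)); rewrite normr_id => <-.
apply: (ler_lp_norm r1) => k.
by rewrite linearZ/= mulrA mulfV ?mul1r// gt_eqF.
Qed.

Lemma fbl_norm_ge r f n (u : 'I_n -> dual_space E) : admissible r u ->
  ((lp_norm r (fun k => f (u k)))%:E <= fbl_norm r f)%E.
Proof. by move=> ur; apply: ereal_sup_ubound; exists n, u. Qed.

Lemma fbl_norm_le r f (c : \bar R) :
  (forall n (u : 'I_n -> dual_space E), admissible r u ->
     ((lp_norm r (fun k => f (u k)))%:E <= c)%E) -> (fbl_norm r f <= c)%E.
Proof. by move=> h; apply: ge_ereal_sup => _ [n [u [ur ->]]]; exact: h. Qed.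

Lemma fbl_norm_ge0 r f : 1 <= r -> (0 <= fbl_norm r f)%E.
Proof.
move=> r1; have u : 'I_0 -> dual_space E by case.
apply: le_trans (@fbl_norm_ge r f 0 u _); first by rewrite lee_fin lp_norm_ge0.
by move=> x _; rewrite big_ord0.
Qed.

Lemma fbl_norm_mono r f g : 1 <= r -> (forall u, `|f u| <= `|g u|) ->
  (fbl_norm r f <= fbl_norm r g)%E.
Proof.
move=> r1 fg; apply: fbl_norm_le => n u ur; apply: le_trans (fbl_norm_ge g ur).
by rewrite lee_fin; apply: ler_lp_norm.
Qed.

Lemma fbl_normD r f g : 1 <= r -> (fbl_norm r (f + g)%R <= fbl_norm r f + fbl_norm r g)%E.
Proof.
move=> r1; apply: fbl_norm_le => n u ur.
apply: (@le_trans _ _ ((lp_norm r (fun k => f (u k)))%:E + (lp_norm r (fun k => g (u k)))%:E)%E).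
  by rewrite -EFinD lee_fin; exact: ler_lp_normD.
by apply: leeD; exact: fbl_norm_ge.
Qed.

Lemma fbl_normZ r (a : R) f : 1 <= r -> (fbl_norm r (a *: f)%R <= `|a|%:E * fbl_norm r f)%E.
Proof.
move=> r1; apply: fbl_norm_le => n u ur.
rewrite (eq_lp_norm _ (b := fun k => a * f (u k)))// lp_normZ// EFinM.
by apply: lee_wpmul2l; [rewrite lee_fin|exact: fbl_norm_ge].
Qed.

Lemma fbl_norm0 r : 1 <= r -> fbl_norm r (0 : dual_space E -> R) = 0%E.
Proof.
move=> r1; apply/le_anti; rewrite fbl_norm_ge0// andbT.
by apply: fbl_norm_le => n u _; rewrite (eq_lp_norm _ (b := fun=> 0))// lp_norm0.
Qed.

Lemma fbl_norm_delta r (x : E) : 1 <= r -> (fbl_norm r (delta x) <= `|x|%:E)%E.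
Proof. by move=> r1; apply: fbl_norm_le => n u ur; rewrite lee_fin admissible_le. Qed.

Lemma pos_homogeneous_sublattice : sublattice [set f | @pos_homogeneous R E f].
Proof.
split=> [l u u' l0 _|a f g hf hg l u u' l0 uu'|f g hf hg l u u' l0 uu'].
- by rewrite /= mulr0.
- by rewrite /= !fctE (hf l u)// (hg l u)// mulrDr mulrCA.
- by rewrite /= (hf l u)// (hg l u)// maxr_pMr.
Qed.

Let gen : set (dual_space E -> R) := smallest (@sublattice R E) (range (@delta R E)).

Lemma gen_sublattice : sublattice gen.
Proof.
split=> [S [[S0 _ _] _]|a f g gf gg S SP|f g gf gg S SP] //.
- by have [[_ Sl _] _] := SP; apply: Sl; [exact: gf|exact: gg].
- by have [[_ _ Sm] _] := SP; apply: Sm; [exact: gf|exact: gg].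
Qed.

Lemma gen_delta x : gen (delta x).
Proof. by move=> S [_ sub]; apply: sub; exists x. Qed.

Lemma gen_pos_homogeneous f : gen f -> pos_homogeneous f.
Proof.
apply; split; first exact: pos_homogeneous_sublattice.
by move=> _ [x _ <-] l u u' l0 uu'; exact: uu'.
Qed.

Lemma FBL_delta r (x : E) : 1 <= r -> FBL r (delta x).
Proof.
move=> r1; split.
- by apply: gen_pos_homogeneous; exact: gen_delta.
- by apply: le_lt_trans (fbl_norm_delta x r1) _; rewrite ltry.
- move=> e e0; exists (delta x); first exact: gen_delta.
  by rewrite subrr fbl_norm0// lte_fin.
Qed.

(** Approximants of [f] and [g] combine into approximants of [f \max g] because a join moves by at
    most the sum of the moves of its arguments, which is [dmax]. *)
Lemma FBL_sublattice r : 1 <= r -> sublattice (@FBL R E r).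
Proof.
move=> r1; have [g0 gl gm] := gen_sublattice.
have [h0 hl hm] := pos_homogeneous_sublattice.
have dmax (f g f' g' : dual_space E -> R) :
    (fbl_norm r ((f \max g) - (f' \max g'))%R <= fbl_norm r (f - f')%R + fbl_norm r (g - g')%R)%E.
  have E1 (k : dual_space E -> R) : (fbl_norm r (fun u => `|k u|)%R <= fbl_norm r k)%E.
    by apply: fbl_norm_mono => // u; rewrite normr_id.
  apply: le_trans (leeD (E1 _) (E1 _)); apply: le_trans (fbl_normD _ _ r1).
  apply: fbl_norm_mono => // u; rewrite !fctE.
  rewrite [leRHS]ger0_norm ?addr_ge0//= !maxEle.
  move: (f u) (g u) (f' u) (g' u) => a b a' b'.
  have := ler_norm (a - a'); have := ler_norm (b - b').
  have := ler_norm (- (a - a')); have := ler_norm (- (b - b')); rewrite !normrN => ? ? ? ?.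
  by rewrite ler_norml; case: (leP a b) => ?; case: (leP a' b') => ?; apply/andP; split; lra.
split.
- split=> //; first by rewrite fbl_norm0.
  by move=> e e0; exists 0 => //; rewrite subrr fbl_norm0// lte_fin.
- move=> a f g [fh ff fa] [gh gf ga]; split; first exact: hl.
    apply: le_lt_trans (fbl_normD (a *: f) g r1) _; apply: lte_add_pinfty; last exact: gf.
    apply: le_lt_trans (fbl_normZ a f r1) _; apply: lte_mul_pinfty; last exact: ff.
      by rewrite lee_fin.
    by [].
  move=> e e0; pose e' := e / (`|a| + 1).
  have a1 : 0 < `|a| + 1 by rewrite ltr_wpDl.
  have e'0 : 0 < e' by rewrite divr_gt0.
  have [f' gf' ff'] := fa _ e'0; have [g' gg' gg''] := ga _ e'0.
  exists (a *: f' + g'); first exact: gl.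
  have -> : a *: f + g - (a *: f' + g') = a *: (f - f') + (g - g').
    by rewrite scalerBr opprD addrACA.
  apply: le_lt_trans (fbl_normD (a *: (f - f')) (g - g') r1) _.
  have -> : e = `|a| * e' + e' by rewrite /e'; field; rewrite gt_eqF.
  rewrite EFinD; apply: lee_ltD; last exact: gg''.
    have fin' : (fbl_norm r (a *: (f - f'))%R < +oo)%E.
      apply: le_lt_trans (fbl_normZ a (f - f') r1) _; apply: lte_mul_pinfty.
      - by rewrite lee_fin.
      - by [].
      - by apply: lt_trans ff' _; rewrite ltry.
    by rewrite ge0_fin_numE ?fbl_norm_ge0.
  apply: le_trans (fbl_normZ a (f - f') r1) _; rewrite EFinM.
  apply: lee_wpmul2l; last exact: (ltW ff').
  by rewrite lee_fin.
- move=> f g [fh ff fa] [gh gf ga]; split; first exact: hm.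
    have := dmax f g 0 0; rewrite !subr0.
    have -> : (0 : dual_space E -> R) \max 0 = 0 by apply/funext => u /=; rewrite maxxx.
    rewrite (subr0 (f \max g)) => h.
    exact: le_lt_trans h (lte_add_pinfty ff gf).
  move=> e e0; have e2 : 0 < e / 2 by rewrite divr_gt0.
  have [f' gf' ff'] := fa _ e2; have [g' gg' gg''] := ga _ e2.
  exists (f' \max g'); first exact: gm.
  apply: le_lt_trans (dmax f g f' g') _.
  rewrite [X in X%:E](splitr e) EFinD; exact: (lteD ff' gg'').
Qed.

End fbl_theory.

(** * From a lattice isomorphism to the finite inequality *)

Section fbl_isomorphism.
Context (R : realType) (E : normedModType R).
Local Notation fct := (dual_space E -> R).

Lemma FBL_fin r (f : fct) : 1 <= r -> FBL r f -> fbl_norm r f = (fine (fbl_norm r f))%:E.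
Proof. by move=> r1 [_ fy _]; rewrite fineK// ge0_fin_numE ?fbl_norm_ge0. Qed.

Lemma FBLZ r (a : R) (f : fct) : 1 <= r -> FBL r f -> FBL r (a *: f).
Proof.
by move=> r1 rf; have [f0 fl _] := FBL_sublattice E r1; rewrite -[_ *: _]addr0; exact: fl.
Qed.

Lemma op_norm_FBL_ge0 r s (V : fct -> fct) : 1 <= r -> 1 <= s ->
  (0 <= op_norm (@FBL R E r) (fbl_norm r) (fbl_norm s) V)%E.
Proof.
move=> r1 s1; apply: le_trans (fbl_norm_ge0 (V 0) s1) _.
apply: ereal_sup_ubound; exists 0 => //; split; first by have [] := FBL_sublattice E r1.
by rewrite /= fbl_norm0.
Qed.

(** The function is rescaled by [N + e / (c + 1)] and not by its norm [N], which may be 0; the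
    excess costs [c * e / (c + 1) <= e]. *)
Lemma op_norm_FBL r s (V : fct -> fct) (f : fct) (c : R) : 1 <= r -> 1 <= s ->
  (forall a (g : fct), FBL r g -> V (a *: g) = a *: V g) -> FBL r f -> 0 <= c ->
  op_norm (@FBL R E r) (fbl_norm r) (fbl_norm s) V = c%:E ->
  (fbl_norm s (V f) <= (c * fine (fbl_norm r f))%:E)%E.
Proof.
move=> r1 s1 VZ rf c0 Vc; have fE := FBL_fin r1 rf.
set N := fine _ in fE *.
have N0 : 0 <= N by apply: fine_ge0; exact: fbl_norm_ge0.
apply/lee_addgt0Pr => e e0.
have c1 : 0 < c + 1 by rewrite ltr_wpDl.
pose t := N + e / (c + 1).
have t0 : 0 < t by rewrite ltr_wpDl// divr_gt0.
have rf' : FBL r (t^-1 *: f) by exact: FBLZ.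
have n1 : (fbl_norm r (t^-1 *: f)%R <= 1%:E)%E.
  apply: le_trans (fbl_normZ t^-1 f r1) _.
  rewrite fE -EFinM lee_fin gtr0_norm ?invr_gt0// ler_pdivrMl// mulr1.
  by rewrite lerDl divr_ge0// ltW.
have h : (fbl_norm s (V (t^-1 *: f)%R) <= c%:E)%E.
  by rewrite -Vc; apply: ereal_sup_ubound; exists (t^-1 *: f).
have -> : V f = t *: V (t^-1 *: f).
  by rewrite -VZ// scalerA mulfV ?scale1r// gt_eqF.
apply: le_trans (fbl_normZ t _ s1) _.
have tE : (0 <= `|t|%:E)%E by rewrite lee_fin.
apply: le_trans (lee_wpmul2l tE h) _.
rewrite -EFinM -EFinD lee_fin gtr0_norm// /t mulrDl mulrC lerD2l.
by rewrite mulrAC ler_pdivrMr// ler_pM2l// lerDl.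
Qed.

(** The base value 0 lies in both lattices, satisfies [V 0 = 0], and makes the maximum nonnegative,
    so that an upper bound also bounds its modulus. *)
Let maxs (I : Type) (F : I -> fct) (s : seq I) : fct := foldr (fun j f => F j \max f) 0 s.

Let maxs_le (I : Type) (F : I -> fct) s w (c : R) : 0 <= c -> (forall j, F j w <= c) ->
  0 <= maxs F s w <= c.
Proof.
move=> c0 Fc; elim: s => [|j s /andP[IH1 IH2]] /=; first by rewrite lexx.
by rewrite le_max IH1 orbT ge_max Fc.
Qed.

Let maxs_ge (I : eqType) (F : I -> fct) s w j : j \in s -> F j w <= maxs F s w.
Proof.
elim: s => //= i s IH; rewrite inE le_max => /orP[/eqP->|/IH ->]; first by rewrite lexx.
by rewrite orbT.
Qed.

Lemma lattice_isomorphism_finite (p q C : R) (V : fct -> fct) : 1 <= p -> 1 <= q ->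
  lattice_C_isomorphism C (@FBL R E p) (@fbl_norm R E p) (@FBL R E q) (@fbl_norm R E q) V ->
  forall m (u : 'I_m -> dual_space E) n (x : 'I_n -> E), admissible q u ->
    lp_norm q (fun j => lp_norm p (fun k => u j (x k))) <= C * lp_norm p (fun k => `|x k|).
Proof.
move=> p1 q1 [Vl Vm [W [VW WV Vy Wy VWC]]] m u n x uq.
have [Fp0 Fpl Fpm] := FBL_sublattice E p1; have [Fq0 Fql Fqm] := FBL_sublattice E q1.
have V0 : V 0 = 0.
  have := Vl 1 0 0 Fp0 Fp0; rewrite !scale1r addr0.
  by move=> h; apply: (@addrI _ (V 0)); rewrite addr0 -h.
have VZ a (g : fct) : FBL p g -> V (a *: g) = a *: V g.
  by move=> gp; have := Vl a g 0 gp Fp0; rewrite !addr0 V0 addr0.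
have WZ a (g : fct) : FBL q g -> W (a *: g) = a *: W g.
  move=> gq; have [pg VWg] := WV g gq.
  by rewrite -{1}VWg -VZ// (VW _ (FBLZ _ p1 pg)).2.
have nV0 := op_norm_FBL_ge0 V p1 q1; have nW0 := op_norm_FBL_ge0 W q1 p1.
have [cV Vc] : {c | op_norm (@FBL R E p) (fbl_norm p) (fbl_norm q) V = c%:E}.
  exists (fine (op_norm (@FBL R E p) (fbl_norm p) (fbl_norm q) V)).
  exact: (esym (fineK (etrans (ge0_fin_numE nV0) Vy))).
have [cW Wc] : {c | op_norm (@FBL R E q) (fbl_norm q) (fbl_norm p) W = c%:E}.
  exists (fine (op_norm (@FBL R E q) (fbl_norm q) (fbl_norm p) W)).
  exact: (esym (fineK (etrans (ge0_fin_numE nW0) Wy))).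
have cV0 : 0 <= cV := eq_ind _ (fun z => (0 <= z)%E) nV0 _ Vc.
have cW0 : 0 <= cW := eq_ind _ (fun z => (0 <= z)%E) nW0 _ Wc.
have cVW : cV * cW <= C.
  have h1 := eq_ind _ (fun z => (z * _ <= C%:E)%E) VWC _ Vc.
  exact: (eq_ind _ (fun z => (cV%:E * z <= C%:E)%E) h1 _ Wc).
pose g k := W (delta (x k)).
have dq k : FBL q (delta (x k)) by exact: FBL_delta.
have gp k : FBL p (g k) := (WV _ (dq k)).1.
have gN k l (v : 'I_l -> dual_space E) : admissible p v ->
    lp_norm p (fun i => g k (v i)) <= cW * `|x k|.
  move=> vp; rewrite -lee_fin; apply: le_trans (fbl_norm_ge (g k) vp) _.
  apply: le_trans (op_norm_FBL q1 p1 WZ (dq k) cW0 Wc) _.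
  rewrite lee_fin ler_wpM2l// -lee_fin -(FBL_fin q1 (dq k)).
  exact: fbl_norm_delta.
have /choice[a aP] : forall j, exists a : 'I_n -> R,
    (forall t, \sum_k a k * t k <= lp_norm p t) /\
    \sum_k a k * u j (x k) = lp_norm p (fun k => u j (x k)).
  by move=> j; exact: lp_norm_support.
pose F j : fct := \sum_k a j k *: g k.
pose D j : fct := \sum_k a j k *: delta (x k).
have FD j : FBL p (F j) /\ V (F j) = D j.
  rewrite /F /D; elim: (index_enum _) => [|k s [IH1 IH2]].
    by rewrite !big_nil; split; [exact: Fp0|exact: V0].
  rewrite !big_cons; split; first exact: (Fpl _ _ _ (gp k) IH1).
  rewrite (Vl _ _ _ (gp k) IH1) IH2; congr (_ *: _ + _); exact: (WV _ (dq k)).2.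
pose s := enum 'I_m.
have mFD : FBL p (maxs F s) /\ V (maxs F s) = maxs D s.
  elim: s => [|j s [IH1 IH2]] /=; first by split; [exact: Fp0|exact: V0].
  split; first exact: Fpm (FD j).1 IH1.
  by rewrite (Vm _ _ (FD j).1 IH1) IH2 (FD j).2.
have [hp Vh] := mFD; set h := maxs F s in hp Vh.
have hb w : 0 <= h w <= lp_norm p (fun k => g k w).
  apply: maxs_le => [|j]; first exact: lp_norm_ge0.
  rewrite /F fct_sumE; exact: (aP j).1.
(* The p-convexity of the FBL^(p) norm with constant 1: the sums over functionals and over [k] are
   exchanged, and [gN] bounds each [g k]. *)
have hN : (fbl_norm p h <= (cW * lp_norm p (fun k => `|x k|))%:E)%E.
  apply: fbl_norm_le => l v vp; rewrite lee_fin.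
  rewrite lp_norm_leP ?mulr_ge0 ?lp_norm_ge0//.
  apply: (@le_trans _ _ (\sum_(i < l) \sum_(k < n) `|g k (v i)| `^ p)).
    apply: ler_sum => i _; have /andP[h0 h1] := hb (v i).
    rewrite ger0_norm// -lp_norm_pow//; apply: ge0_ler_powR; rewrite ?nnegrE ?lp_norm_ge0//.
    exact: le_trans p1.
  rewrite exchange_big/= powRM ?lp_norm_ge0// lp_norm_pow// mulr_sumr.
  apply: ler_sum => k _; rewrite -lp_norm_pow// -powRM// normr_id.
  apply: ge0_ler_powR; rewrite ?nnegrE ?lp_norm_ge0 ?mulr_ge0//; first exact: le_trans p1.
  exact: gN.
have VhN : (fbl_norm q (V h) <= (C * lp_norm p (fun k => `|x k|))%:E)%E.
  apply: le_trans (op_norm_FBL p1 q1 VZ hp cV0 Vc) _; rewrite lee_fin.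
  have hN' : fine (fbl_norm p h) <= cW * lp_norm p (fun k => `|x k|).
    by rewrite -lee_fin -(FBL_fin p1 hp).
  apply: le_trans (ler_wpM2l cV0 hN') _; rewrite mulrA ler_wpM2r// lp_norm_ge0//.
rewrite -lee_fin; apply: le_trans VhN; apply: le_trans (fbl_norm_ge _ uq).
rewrite lee_fin; apply: (ler_lp_norm q1) => j; rewrite ger0_norm ?lp_norm_ge0//.
apply: le_trans (ler_norm _); rewrite Vh -(aP j).2.
have -> : \sum_k a j k * u j (x k) = D j (u j) by rewrite /D fct_sumE.
by apply: maxs_ge; rewrite mem_enum.
Qed.

End fbl_isomorphism.

(** * From multiplicative factorization to the canonical isomorphism *)

Section dual_construction.
Context (R : realType) (E : normedModType R).

Lemma dual_of_bounded (phi : E -> R) (c : R) :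
  (forall a x y, phi (a *: x + y) = a * phi x + phi y) ->
  (forall x, `|phi x| <= c * `|x|) -> exists u : dual_space E, forall x, u x = phi x.
Proof.
move=> philin phib.
pose L : {linear E -> R^o} :=
  HB.pack (phi : E -> R^o) (GRing.isLinear.Build _ _ _ _ (phi : E -> R^o) philin).
have Lc : continuous L.
  move=> x; apply/cvgrPdist_lt => e e0.
  have c1 : 0 < `|c| + 1 by rewrite ltr_wpDl.
  have d0 : 0 < e / (`|c| + 1) by rewrite divr_gt0.
  apply/nbhs_ballP; exists (e / (`|c| + 1)) => //= y.
  rewrite -ball_normE /ball_/= ltr_pdivlMr// mulrC => xy.
  have -> : phi x - phi y = phi (x - y) by exact: (esym (linearB L x y)).
  apply: le_lt_trans (phib _) _; apply: le_lt_trans xy.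
  by rewrite ler_wpM2r// (le_trans (ler_norm c))// lerDl.
by exists (DualSpace Lc).
Qed.

Lemma dual_scale (l : R) (u : dual_space E) : exists v : dual_space E, forall x, v x = l * u x.
Proof.
have [c cu] : exists c, forall x, `|u x| <= c * `|x|.
  have /cvgrPdist_lt/(_ 1 ltr01)/nbhs_ballP[e /= e0 he] := @dual_fun_continuous _ _ u 0.
  exists (2 / e) => x; have [->|x0] := eqVneq x 0; first by rewrite linear0 !normr0 mulr0.
  have nx0 : 0 < `|x| by rewrite normr_gt0.
  pose a := e / (2 * `|x|).
  have a0 : 0 < a by rewrite divr_gt0// mulr_gt0.
  have /he : ball (0 : E) e (a *: x).
    rewrite -ball_normE /ball_/= sub0r normrN normrZ gtr0_norm//.
    rewrite /a invfM mulrA mulfVK ?gt_eqF//; lra.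
  rewrite linear0 sub0r normrN linearZ/= normrM gtr0_norm// => /ltW h.
  rewrite -ler_pdivlMl// mulr1 in h; apply: le_trans h _.
  by rewrite /a invf_div mulrAC.
apply: (@dual_of_bounded _ (`|l| * c)) => [a x y|x].
  by rewrite linearP/= mulrDr mulrCA.
by rewrite normrM -mulrA ler_wpM2l.
Qed.

(** With [a k] the share of [|f (u k)|]^ p[in]S[, weighted AM-GM bounds]|l k * u k x| [^ q] by
    [(1 - al) * a k + al * |u k x|]^ p[, whose sum is at most 1. By homogeneity the q-powers
    of]f[on the new family add up to]S [^ al]. *)
Lemma fbl_norm_decreasing (p q : R) (f : dual_space E -> R) : 1 <= q -> q < p ->
  pos_homogeneous f -> (fbl_norm p f <= fbl_norm q f)%E.
Proof.
move=> q1 qp fh; have p1 : 1 <= p := le1_lt q1 qp.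
have q0 : 0 < q by exact: lt_le_trans q1. have p0 : 0 < p by exact: lt_le_trans p1.
apply: fbl_norm_le => n u up.
set S := \sum_k `|f (u k)| `^ p.
have [S0|S0] := eqVneq S 0.
  by rewrite /lp_norm -/S S0 powR0 ?invr_eq0 ?gt_eqF// fbl_norm_ge0.
have Sp : 0 < S by rewrite lt_neqAle eq_sym S0; exact: sum_powR_ge0.
(* The weights [l k] turn [u] into a q-admissible family on which [f] has the same
   q-norm as its p-norm on [u]. *)
pose al := q / p.
have al01 : 0 <= al <= 1.
  by rewrite divr_ge0 ?(ltW q0) ?(ltW p0)//= ler_pdivrMr// mul1r ltW.
pose a k := `|f (u k)| `^ p / S.
have a0 k : 0 <= a k by rewrite divr_ge0 ?powR_ge0// ltW.
have a1 : \sum_k a k = 1 by rewrite -mulr_suml mulfV.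
pose l k := a k `^ ((1 - al) / q).
have lq k : l k `^ q = a k `^ (1 - al) by rewrite /l -powRrM divfK// gt_eqF.
have pal (x : R) : (`|x| `^ p) `^ al = `|x| `^ q.
  by rewrite -powRrM /al mulrC divfK// gt_eqF.
have /choice[v vE] : forall k, exists v : dual_space E, forall x, v x = l k * u k x.
  by move=> k; exact: dual_scale.
have vq : admissible q v.
  move=> x x1; have := up x x1 => ux.
  apply: (@le_trans _ _ (\sum_k ((1 - al) * a k + al * `|u k x| `^ p))).
    apply: ler_sum => k _; rewrite vE normrM powRM// ger0_norm ?powR_ge0// lq -pal.
    have al01' : 0 <= 1 - al <= 1 by move: al01 => /andP[? ?]; apply/andP; split; lra.
    have := weighted_amgm al01' (a0 k) (powR_ge0 `|u k x| p).
    by rewrite (_ : 1 - (1 - al) = al)//; ring.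
  rewrite big_split/= -!mulr_sumr a1; move: al01 => /andP[? ?]; nra.
apply: le_trans (fbl_norm_ge f vq); rewrite lee_fin.
rewrite /lp_norm -/S; have -> : \sum_k `|f (v k)| `^ q = S `^ al.
  have E1 k : `|f (v k)| `^ q = S `^ (al - 1) * `|f (u k)| `^ p.
    rewrite (fh (l k) (u k) (v k) (powR_ge0 _ _) (vE k)).
    rewrite normrM powRM// ger0_norm ?powR_ge0// lq -pal /a.
    rewrite powRM ?powR_ge0 ?invr_ge0 ?(ltW Sp)//.
    have -> : S^-1 `^ (1 - al) = S `^ (al - 1).
      by rewrite -powR_inv1 ?(ltW Sp)// -powRrM; congr (_ `^ _); ring.
    rewrite mulrAC [LHS]mulrC; congr (_ * _).
    have [->|fu0] := eqVneq `|f (u k)| 0; last first.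
      have fup : 0 < `|f (u k)| by rewrite lt_neqAle eq_sym fu0/=.
      rewrite powRM_exp ?powR_gt0// (_ : 1 - al + al = 1) ?powRr1 ?powR_ge0//; ring.
    rewrite [0 `^ p]powR0 ?gt_eqF// (@powR0 _ al) ?mulr0//.
    by rewrite /al mulf_neq0 ?invr_eq0 ?gt_eqF.
  rewrite (eq_bigr _ (fun k _ => E1 k)) -mulr_sumr -/S -{2}(powRr1 (ltW Sp)) powRM_exp//.
  by congr (_ `^ _); ring.
rewrite -powRrM (_ : al * q^-1 = p^-1)// /al mulrAC mulfV ?mul1r// gt_eqF//.
Qed.

End dual_construction.

HB.instance Definition _ (R : realType) := @isSFinite.Build _ nat R (@counting nat R)
  (sfinite_measure_sigma_finite (sigma_finite_counting R)).

Section counting_nat.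
Context (R : realType).

Let cnt := (@counting nat R : {sigma_finite_measure set nat -> \bar R}).

(** Each point has mass 1, so a null set is empty: over [cnt] the a.e. identities of (4) hold at
    every coordinate. *)
Lemma ae_counting (P : nat -> Prop) : {ae cnt, forall k, P k} -> forall k, P k.
Proof.
move=> [N [mN N0 PN]] k; apply: contrapT => Pk.
have : (cnt [set k] <= cnt N)%E.
  by apply: le_measure; rewrite ?inE//; move=> _ ->; exact: PN.
rewrite N0 /cnt/= /counting asboolT ?finite_set1// fset_set1 finmap.cardfs1.
by rewrite lee_fin ler10.
Qed.

(** Extension by 0 places families of every length in sequence spaces over the single measure space
    [nat]. *)
Definition ext_fun m (a : 'I_m -> R) (k : nat) : R := if insub k is Some i then a i else 0.

Lemma ext_funE m (a : 'I_m -> R) (i : 'I_m) : ext_fun a i = a i.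
Proof. by rewrite /ext_fun valK. Qed.

Lemma LpN_counting (r : R) (f : nat -> R) :
  LpN cnt r f = ((\sum_(0 <= k <oo) (`|f k| `^ r)%:E) `^ r^-1)%E.
Proof.
by rewrite LpN_powE; congr poweR; rewrite ge0_integral_count// => k; rewrite lee_fin powR_ge0.
Qed.

Lemma lp_norm_le_counting (r : R) m (f : nat -> R) : 1 <= r ->
  ((lp_norm r (fun i : 'I_m => f i))%:E <= LpN cnt r f)%E.
Proof.
move=> r1; rewrite LpN_counting -poweR_EFin.
have ri : 0 <= r^-1 by rewrite invr_ge0 (le_trans ler01).
apply: (gt0_ler_poweR ri).
- by rewrite in_itv/= leey lee_fin sum_powR_ge0.
- by rewrite in_itv/= leey andbT nneseries_ge0// => k _ _; rewrite lee_fin powR_ge0.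
rewrite -sumEFin -(big_mkord xpredT (fun i => (`|f i| `^ r)%:E)).
by apply: nneseries_lim_ge => k _ _; rewrite lee_fin powR_ge0.
Qed.

Lemma LpN_ext_fun (r : R) m (a : 'I_m -> R) : 1 <= r ->
  LpN cnt r (ext_fun a) = (lp_norm r a)%:E.
Proof.
move=> r1; rewrite LpN_counting -poweR_EFin; congr (_ `^ _)%E.
rewrite (@nneseries_split _ _ 0 m)//.
rewrite add0n big_mkord eseries0 ?adde0.
  by rewrite -sumEFin; apply: eq_bigr => i _; rewrite ext_funE.
move=> k mk _; rewrite /ext_fun insubF; last by rewrite ltnNge mk.
by rewrite normr0 powR0// gt_eqF// (lt_le_trans ltr01).
Qed.

Lemma fbl_norm_factor (E : normedModType R) (p q C : R) (p1 : 1 <= p) (q1 : 1 <= q) :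
  0 <= C ->
  (forall T : E -> Lp cnt q1, Lp_contraction T -> multiplicatively_factors C p1 T) ->
  forall f : dual_space E -> R, pos_homogeneous f ->
  (fbl_norm q f <= C%:E * fbl_norm p f)%E.
Proof.
move=> C0 H f fh; apply: fbl_norm_le => m u uq.
have mN (a : nat -> R) : measurable_fun setT a by [].
have inj (r : R) (r1 : 1 <= r) (a : 'I_m -> R) k :
    Lp_of cnt r1 (ext_fun a) k = ext_fun a k.
  have fin : (LpN cnt r (ext_fun a) < +oo)%E by rewrite LpN_ext_fun// ltry.
  exact: (ae_counting (Lp_ofE r1 (mN (ext_fun a)) fin) k).
pose T x : Lp cnt q1 := Lp_of cnt q1 (ext_fun (fun i => u i x)).
have [|S [U [[Slin Sb] _ Ub TUS [g mg Ug]]]] := H T.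
  split=> [a x y|x].
    apply: filterE => k; rewrite /T !inj /ext_fun; case: insubP => [i _ _|_].
      by rewrite linearP.
    by rewrite mulr0 addr0.
  rewrite (_ : (T x : nat -> R) = ext_fun (fun i => u i x)); last exact/funext/inj.
  by rewrite LpN_ext_fun// lee_fin admissible_le.
have uE (i : 'I_m) x : u i x = g i * S x i.
  by rewrite -(ae_counting (Ug (S x)) i) -(ae_counting (TUS x) i) /T inj ext_funE.
have Sx x : lp_norm p (fun i : 'I_m => S x i) <= `|x|.
  by rewrite -lee_fin; apply: le_trans (Sb x); exact: lp_norm_le_counting.
(* [f] is homogeneous for nonnegative scalars only, so the sign of [g i] is moved into [v i],
   leaving [u i = |g i| * v i]. *)
have /choice[v vE] : forall i : 'I_m, exists v : dual_space E,
    forall x, v x = Num.sg (g i) * S x i.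
  move=> i; have [||w wE] := @dual_of_bounded _ E (fun x => S x i) 1.
  - by move=> a x y; rewrite (ae_counting (Slin a x y) i).
  - move=> x; rewrite mul1r; apply: le_trans (Sx x).
    exact: (le_coord_lp_norm p1 (fun i : 'I_m => S x i)).
  by have [v vE] := dual_scale (Num.sg (g i)) w; exists v => x; rewrite vE wE.
have vp : admissible p v.
  move=> x x1; have := le_trans (Sx x) x1; rewrite lp_norm_leP// powR1.
  apply: le_trans; apply: ler_sum => i _; rewrite vE normrM.
  apply: ge0_ler_powR; rewrite ?nnegrE ?mulr_ge0// ?(le_trans ler01 p1)//.
  by rewrite ler_piMl// normr_sg lern1 leq_b1.
have fu i : f (u i) = `|g i| * f (v i).
  by apply: fh => // x; rewrite uE vE mulrA [`|g i| * _]mulrC mulr_sg_norm.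
(* The norm bound of [U] is used on a sequence outside the range of [S]: up to sign, [U] sends
   [(f (v i))_i] to [(f (u i))_i]. *)
pose h : Lp cnt p1 := Lp_of cnt p1 (ext_fun (fun i => f (v i))).
have hE : (h : nat -> R) = ext_fun (fun i => f (v i)) by apply/funext/inj.
apply: (@le_trans _ _ (LpN cnt q (U h))).
  apply: le_trans (lp_norm_le_counting m (U h) q1); rewrite lee_fin.
  apply: ler_lp_norm => // i; rewrite fu (ae_counting (Ug h) i) hE ext_funE.
  by rewrite !normrM normr_id.
apply: le_trans (Ub h) _; apply: lee_wpmul2l; first by rewrite lee_fin.
by rewrite hE LpN_ext_fun//; exact: fbl_norm_ge.
Qed.

End counting_nat.

Section canonical.
Context (R : realType) (E : normedModType R) (p q C : R).
Hypotheses (q1 : 1 <= q) (qp : q < p) (C1 : 1 <= C).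

(** The two norms are comparable on all positively homogeneous functions, in particular on [f - g]
    with [g] generated by the [delta x]; so both closures are the same set. The operator norms are
    at most [C] and 1. *)
Lemma canonical_isomorphism :
  (forall f : dual_space E -> R, pos_homogeneous f ->
     (fbl_norm q f <= C%:E * fbl_norm p f)%E) ->
  lattice_C_isomorphism C
    (@FBL R E p) (@fbl_norm R E p) (@FBL R E q) (@fbl_norm R E q) id.
Proof.
move=> H; have p1 := le1_lt q1 qp.
have C0 : 0 < C by exact: lt_le_trans C1.
have D := @fbl_norm_decreasing R E p q _ q1 qp.
have phB (f g : dual_space E -> R) : pos_homogeneous f ->
    smallest (@sublattice R E) (range (@delta R E)) g -> pos_homogeneous (f - g).
  move=> fh /gen_pos_homogeneous gh; have [_ hl _] := pos_homogeneous_sublattice E.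
  by rewrite addrC -scaleN1r; exact: hl.
have qp_sub (f : dual_space E -> R) : FBL q f -> FBL p f.
  move=> [fh fy fa]; split; [exact: fh|exact: le_lt_trans (D _ fh) fy|].
  move=> e e0; have [g gg fg] := fa e e0; exists g; first exact: gg.
  exact: le_lt_trans (D _ (phB _ _ fh gg)) fg.
have pq_sub (f : dual_space E -> R) : FBL p f -> FBL q f.
  move=> [fh fy fa]; split; [exact: fh| |].
    apply: le_lt_trans (H _ fh) _.
    by apply: lte_mul_pinfty; [rewrite lee_fin ltW|exact: isT|exact: fy].
  move=> e e0; have [|g gg fg] := fa (e / C); first by rewrite divr_gt0.
  exists g; first exact: gg.
  apply: le_lt_trans (H _ (phB _ _ fh gg)) _.
  by rewrite -lte_pdivlMl// -EFinM mulrC; exact: fg.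
have n1 : (op_norm (@FBL R E p) (fbl_norm p) (fbl_norm q) id <= C%:E)%E.
  apply: ge_ereal_sup => _ [f [[fh _ _] f1] <-].
  apply: le_trans (H _ fh) _; rewrite -[leRHS]mule1.
  by apply: lee_wpmul2l; [rewrite lee_fin ltW|exact: f1].
have n2 : (op_norm (@FBL R E q) (fbl_norm q) (fbl_norm p) id <= 1)%E.
  by apply: ge_ereal_sup => _ [f [[fh _ _] f1] <-]; exact: le_trans (D _ fh) f1.
split; [move=> *; exact: erefl|move=> *; exact: erefl|exists id; split].
- by move=> f fp; split; [exact: pq_sub|exact: erefl].
- by move=> f fq; split; [exact: qp_sub|exact: erefl].
- by apply: le_lt_trans n1 _; rewrite ltry.
- by apply: le_lt_trans n2 _; rewrite ltry.
- rewrite -[leRHS]mule1; apply: lee_pmul; [| |exact: n1|exact: n2];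
    exact: op_norm_FBL_ge0.
Qed.

End canonical.

(** * From the finite inequality to p-convexity *)

Section p_convexity_from_finite.
Context d (Om : measurableType d) (R : realType) (mu : {measure set Om -> \bar R}).
Context (E : normedModType R) (q : R) (q1 : 1 <= q).

(** The functional is [x |-> int_A k * T x] with the explicit density [k] that norms [T y] in
    [L_q(A)]; for [q = 1] it is the sign of [T y]. If [T y] vanishes on [A], the zero functional
    serves. *)
Lemma local_functional (T : E -> Lp mu q1) (A : set Om) (y : E) :
  Lp_contraction T -> measurable A -> exists u : dual_space E,
  (forall x, (`|u x| `^ q)%:E <= \int[mu]_(w in A) (`|T x w| `^ q)%:E)%E /\
  ((`|u y| `^ q)%:E = \int[mu]_(w in A) (`|T y w| `^ q)%:E)%E.
Proof.
move=> [Tlin Tb] mA; have q0 : 0 < q by exact: lt_le_trans q1.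
have iq01 : 0 <= q^-1 <= 1 by rewrite invr_ge0 (ltW q0) invf_le1.
have [iq0 _] := andP iq01.
have iq1 : 0 <= 1 - q^-1 by rewrite subr_ge0; case/andP: iq01.
have mT x : measurable_fun setT (T x) by exact: Lp_measurable.
have mP x : measurable_fun setT (fun w => `|T x w| `^ q).
  by have /measurable_EFinP := measurable_powR_norm q (mT x).
pose I x := (\int[mu]_(w in A) (`|T x w| `^ q)%:E)%E.
have I0 x : (0 <= I x)%E by apply: integral_ge0 => w _; rewrite lee_fin powR_ge0.
have Ib x : (I x <= (`|x| `^ q)%:E)%E.
  have /(LpN_leP mu q1 (T x) (normr_ge0 x)) := Tb x; apply: le_trans.
  by apply: ge0_subset_integral => //; exact: measurable_powR_norm.
have IE x : I x = (fine (I x))%:E.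
  by rewrite fineK// ge0_fin_numE// (le_lt_trans (Ib x))// ltry.
have fI0 x : 0 <= fine (I x) by rewrite fine_ge0.
set c := fine (I y).
have [c0|c0] := eqVneq c 0.
  have [||u uE] := @dual_of_bounded R E (fun=> 0) 0.
  - by move=> a x z; rewrite mulr0 addr0.
  - by move=> x; rewrite normr0 mul0r.
  by exists u; split=> [x|]; rewrite uE normr0 powR0 ?gt_eqF//;
    [exact: I0|rewrite -/(I y) IE -/c c0].
have cp : 0 < c by rewrite lt_neqAle eq_sym c0 fI0.
pose ga := c `^ q^-1; have ga0 : 0 < ga by rewrite powR_gt0.
have gaq : ga `^ q = c by rewrite /ga -powRrM mulVf ?powRr1 ?(ltW cp)// gt_eqF.
pose s w : R := if 0 <= T y w then 1 else -1.
have ms : measurable_fun setT s.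
  by apply: measurable_fun_ifT => //; apply: measurable_fun_ler.
have s1 w : `|s w| = 1 by rewrite /s; case: ifP; rewrite ?normrN normr1.
have sT w : s w * T y w = `|T y w|.
  by rewrite /s; case: ger0P; rewrite ?mul1r ?mulN1r.
(* [k] norms [T y] in L_q(A). *)
pose k w : R := (`|T y w| / ga) `^ (q - 1) * s w.
have mk : measurable_fun setT k.
  apply: measurable_funM => //.
  apply: (@measurableT_comp _ _ _ _ _ _ (@powR R ^~ (q - 1))) => //.
  by apply: measurable_funM => //; exact: measurableT_comp.
have mkT x : measurable_fun setT (fun w => k w * T x w) by exact: measurable_funM.
(* The coefficients of Young's inequality for [|T y| / ga] and [|T x| / b], multiplied by [b]. The
   free scale [b] is later taken close to the norm of [T x] in [L_q(A)], where the integrated bound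
   becomes [b] itself. *)
pose a1 b : R := b * (1 - q^-1) / c; pose b1 b : R := b * q^-1 / b `^ q.
have a10 b : 0 < b -> 0 <= a1 b by move=> b0; rewrite /a1 divr_ge0 ?mulr_ge0 ?(ltW b0) ?(ltW cp).
have b10 b : 0 < b -> 0 <= b1 b.
  by move=> b0; rewrite /b1 divr_ge0 ?powR_ge0// mulr_ge0 ?(ltW b0)// invr_ge0 ltW.
have kT x b w : 0 < b ->
    `|k w * T x w| <= a1 b * `|T y w| `^ q + b1 b * `|T x w| `^ q.
  move=> b0; have := young_powR q1 (divr_ge0 (normr_ge0 (T y w)) (ltW ga0))
    (divr_ge0 (normr_ge0 (T x w)) (ltW b0)).
  rewrite !normrM s1 mulr1 ger0_norm ?powR_ge0// -(ler_pM2l b0).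
  move: (_ `^ (q - 1)) => X.
  have powRMV (t z : R) : 0 <= t -> 0 < z -> (t / z) `^ q = t `^ q / z `^ q.
    move=> t0 z0; rewrite powRM ?invr_ge0 ?(ltW z0)//.
    by rewrite -powR_inv1 ?(ltW z0)// -powRrM mulN1r powRN.
  rewrite !powRMV// gaq /a1 /b1.
  rewrite (_ : b * (X * (`|T x w| / b)) = X * `|T x w|); last by field; rewrite gt_eqF.
  by move=> h; apply: (le_trans h); rewrite mulrDr lerD// le_eqVlt; apply/orP; left; apply/eqP; ring.
have mEF (f : Om -> R) : measurable_fun setT f -> measurable_fun A (EFin \o f).
  by move=> mf; apply: measurable_funTS; exact/measurable_EFinP.
have majI x b : 0 < b ->
    (\int[mu]_(w in A) (a1 b * `|T y w| `^ q + b1 b * `|T x w| `^ q)%:E =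
     (a1 b * c + b1 b * fine (I x))%:E)%E.
  move=> b0; rewrite (ge0_integral_lin mu mA (a10 b b0) (b10 b b0) (mP y) (mP x)).
  - by rewrite -/(I x) -/(I y) (IE x) (IE y) -!EFinM -EFinD.
  - by move=> w; exact: powR_ge0.
  - by move=> w; exact: powR_ge0.
have mmaj x b : measurable_fun setT (fun w => a1 b * `|T y w| `^ q + b1 b * `|T x w| `^ q).
  by apply: measurable_funD; apply: measurable_funM.
have majb x b : 0 < b -> (`|\int[mu]_(w in A) (k w * T x w)%:E| <=
    (a1 b * c + b1 b * fine (I x))%:E)%E.
  move=> b0; rewrite -majI//; apply: le_trans (le_abse_integral mu mA (mEF _ (mkT x))) _.
  apply: ge0_le_integral => //.
  - by apply: measurableT_comp => //; exact: mEF.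
  - by exact: (mEF _ (mmaj x b)).
  - by move=> w _; rewrite lee_fin; exact: kT.
have ik x : mu.-integrable A (EFin \o (fun w => k w * T x w)).
  have : mu.-integrable A (EFin \o (fun w => a1 1 * `|T y w| `^ q + b1 1 * `|T x w| `^ q)).
    apply/integrableP; split; first exact: mEF.
    under eq_integral.
      move=> w _; rewrite /= ger0_norm; last first.
        exact: addr_ge0 (mulr_ge0 (a10 1 ltr01) (powR_ge0 _ _))
          (mulr_ge0 (b10 1 ltr01) (powR_ge0 _ _)).
      over.
    by rewrite majI// ltry.
  apply: le_integrable => //; first exact: mEF.
  move=> w _; rewrite lee_fin; apply: le_trans (kT x 1 w ltr01) _.
  by rewrite ler_norm.
pose phi x := fine (\int[mu]_(w in A) (k w * T x w)%:E).
have phiE x : (\int[mu]_(w in A) (k w * T x w)%:E = (phi x)%:E)%E.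
  by rewrite fineK//; apply: integrable_fin_num => //; exact: ik.
have phib x b : 0 < b -> `|phi x| <= a1 b * c + b1 b * fine (I x).
  by move=> b0; have := majb x b b0; rewrite phiE lee_fin.
have phiI x : `|phi x| `^ q <= fine (I x).
  (* Young's inequality scaled by [B `^ q^-1], which is positive even if [I x = 0]. *)
  apply/ler_addgt0Pr => e e0; set B := fine (I x) + e.
  have B0 : 0 < B := ltr_wpDl (fI0 x) e0.
  have b0 : 0 < B `^ q^-1 by rewrite powR_gt0.
  have bq : (B `^ q^-1) `^ q = B by rewrite -powRrM mulVf ?powRr1 ?(ltW B0)// gt_eqF.
  rewrite -bq; apply: ge0_ler_powR; rewrite ?nnegrE ?(ltW q0) ?(ltW b0)//.
  apply: le_trans (phib x _ b0) _; rewrite /a1 /b1 bq divfK//.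
  have h : fine (I x) / B <= 1 by rewrite ler_pdivrMr// mul1r lerDl ltW.
  set bt := B `^ q^-1 in b0 *; move: (fine (I x)) h => J h.
  rewrite (_ : bt * (1 - q^-1) + bt / q / B * J = bt - bt * q^-1 * (1 - J / B)); last by ring.
  by rewrite gerBl mulr_ge0 ?mulr_ge0 ?(ltW b0)// subr_ge0.
have [||u uE] := @dual_of_bounded R E phi 1.
- move=> a x z; apply: EFin_inj; rewrite EFinD EFinM -!phiE.
  rewrite -(integralZl mA (ik x)) -(integralD mA (integrableZl mA a (ik x)) (ik z)).
  apply: ae_eq_integral => //; first exact: mEF.
    by apply: emeasurable_funD; [apply: emeasurable_funM => //|]; exact: mEF.
  apply: filterS (Tlin a x z) => w -> _ /=.
  by rewrite -EFinM -EFinD mulrDr mulrCA.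
- move=> x; rewrite mul1r -(powRK q1 (normr_ge0 x)) -(powRK q1 (normr_ge0 (phi x))).
  apply: ge0_ler_powR; [exact: iq0|by rewrite nnegrE powR_ge0|by rewrite nnegrE powR_ge0|].
  by apply: le_trans (phiI x) _; rewrite -lee_fin -IE; exact: Ib.
exists u; split=> [x|]; first by rewrite uE -/(I x) IE lee_fin; exact: phiI.
rewrite uE -/(I y) IE -/c; congr EFin.
suff -> : phi y = ga by rewrite gtr0_norm.
apply: EFin_inj; rewrite -phiE.
transitivity (\int[mu]_(w in A) ((ga `^ (1 - q))%:E * (`|T y w| `^ q)%:E))%E.
  apply: eq_integral => w _; rewrite -EFinM /k -mulrA sT; congr EFin.
  rewrite powRM ?invr_ge0 ?(ltW ga0)// -(powR_inv1 (ltW ga0)) -powRrM mulN1r opprB.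
  rewrite mulrAC [RHS]mulrC; congr (_ * _).
  have [->|Ty0] := eqVneq `|T y w| 0; first by rewrite mulr0 powR0// gt_eqF.
  by rewrite -{2}(powRr1 (normr_ge0 _)) -powRD ?subrK// Ty0 implybT.
rewrite ge0_integralZl//.
- by rewrite -/(I y) IE -EFinM -/c -gaq -powRD ?subrK ?powRr1 ?(ltW ga0)// (gt_eqF ga0) implybT.
- exact: mEF.
- by rewrite lee_fin powR_ge0.
Qed.

Lemma disjoint_functionals (T : E -> Lp mu q1) (A : nat -> set Om) (y : nat -> E) N :
  Lp_contraction T -> (forall i, measurable (A i)) -> trivIset setT A ->
  exists2 u : 'I_N -> dual_space E, admissible q u &
    forall i : 'I_N, ((`|u i (y i)| `^ q)%:E = \int[mu]_(w in A i) (`|T (y i) w| `^ q)%:E)%E.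
Proof.
move=> Tc mA tA; have [Tlin Tb] := Tc.
have /choice[u uP] : forall i : 'I_N, exists u : dual_space E,
    (forall x, (`|u x| `^ q)%:E <= \int[mu]_(w in A i) (`|T x w| `^ q)%:E)%E /\
    ((`|u (y i)| `^ q)%:E = \int[mu]_(w in A i) (`|T (y i) w| `^ q)%:E)%E.
  by move=> i; exact: local_functional.
exists u => [x x1|i]; last by have [] := uP i.
rewrite -lee_fin -sumEFin.
have mT : measurable_fun setT (fun w => (`|T x w| `^ q)%:E).
  by apply: measurable_powR_norm; exact: Lp_measurable.
apply: (@le_trans _ _ (\sum_(i < N) \int[mu]_(w in A i) (`|T x w| `^ q)%:E)%E).
  by apply: lee_sum => i _; have [] := uP i.
rewrite -(big_mkord xpredT (fun i => \int[mu]_(w in A i) (`|T x w| `^ q)%:E)%E).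
rewrite -ge0_integral_bigsetU//; last 3 first.
- exact: iota_uniq.
- exact: sub_trivIset tA.
- exact: measurable_funTS.
have /(LpN_leP mu q1 (T x) ler01) : (LpN mu q (T x) <= 1%:E)%E.
  by apply: le_trans (Tb x) _; rewrite lee_fin.
rewrite powR1; apply: le_trans.
apply: ge0_subset_integral => //; first exact: bigsetU_measurable.
Qed.

Lemma p_convex_operator_of_finite (p C : R) (T : E -> Lp mu q1) : 1 <= p -> 0 <= C ->
  (forall m (u : 'I_m -> dual_space E) n (x : 'I_n -> E), admissible q u ->
    lp_norm q (fun j => lp_norm p (fun k => u j (x k))) <= C * lp_norm p (fun k => `|x k|)) ->
  Lp_contraction T -> p_convex_operator p C T.
Proof.
move=> p1 C0 H Tc n x; have [Tlin Tb] := Tc.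
have q0 : 0 < q by exact: lt_le_trans q1.
set K := C * _; have K0 : 0 <= K by rewrite mulr_ge0 ?lp_norm_ge0.
pose Phi w := lp_norm p (fun k => T (x k) w).
have mT z : measurable_fun setT (T z) by exact: Lp_measurable.
have mPhi : measurable_fun setT Phi.
  apply: (@measurableT_comp _ _ _ _ _ _ (@powR R ^~ p^-1)) => //.
  apply: measurable_sum => k; apply: (@measurableT_comp _ _ _ _ _ _ (@powR R ^~ p)) => //.
  by apply: measurableT_comp => //; exact: mT.
have Phi0 w : 0 <= Phi w by exact: lp_norm_ge0.
have main e : 0 < e -> e < 1 -> ((1 - e)%:E * LpN mu q Phi <= K%:E)%E.
  move=> e0 e1; have e10 : 0 <= 1 - e by rewrite subr_ge0 ltW.
  have [a [ale age]] := lp_norm_dense p1 n e0.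
  have aabs i t : `|\sum_k a i k * t k| <= lp_norm p t.
    rewrite ler_norml ale andbT lerNl -mulN1r mulr_sumr.
    apply: le_trans (_ : lp_norm p (fun k => -1 * t k) <= _).
      apply: le_trans (ale i (fun k => -1 * t k)); apply: ler_sum => k _.
      by rewrite mulrCA.
    by rewrite lp_normZ// normrN1 mul1r.
  pose y i := \sum_(k < n) a i k *: x k.
  pose Y i w := \sum_(k < n) a i k * T (x k) w.
  have mY i : measurable_fun setT (Y i).
    by apply: measurable_sum => k; apply: measurable_funM => //; exact: mT.
  pose B i := [set w | (1 - e) * Phi w <= `|Y i w|].
  have mB i : measurable (B i).
    rewrite -[B i]setTI; apply: measurable_fun_le => //.
    - exact: measurable_funM.
    - exact: measurableT_comp.
  have cB : \bigcup_i B i = setT.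
    apply/seteqP; split=> // w _; have [i h] := age (fun k => T (x k) w).
    by exists i => //; apply: le_trans h _; exact: ler_norm.
  have mA i : measurable (seqDU B i).
    by apply: measurableD => //; apply: bigsetU_measurable.
  rewrite -[(1 - e)%:E](_ : (`|1 - e|)%:E = _); last by rewrite ger0_norm.
  rewrite -LpNZ//; apply/(LpN_leP mu q1 _ K0).
  rewrite -cB seqDU_bigcup_eq ge0_integral_bigcup//; last first.
    by apply: measurable_funTS; apply: measurable_powR_norm; exact: measurable_funM.
  apply: lime_le.
    by apply: is_cvg_nneseries => i _ _; apply: integral_ge0 => w _; rewrite lee_fin powR_ge0.
  apply: nearW => N /=.
  have [u uq uE] := disjoint_functionals y N Tc mA (trivIset_seqDU B).
  have := H _ u _ x uq; rewrite -/K lp_norm_leP// => h.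
  apply: (@le_trans _ _ (\sum_(i < N) (`|u i (y i)| `^ q)%:E)%E); last first.
    (* [u i (y i)] is the form [a i] at [(u i (x k))_k], hence at most its [l_p] norm, the quantity
       bounded by the finite inequality. *)
    rewrite sumEFin lee_fin; apply: le_trans h; apply: ler_sum => i _.
    apply: ge0_ler_powR; rewrite ?nnegrE ?(ltW q0)// [leRHS]ger0_norm ?lp_norm_ge0//.
    rewrite /y linear_sum; under eq_bigr do rewrite linearZ.
    exact: aabs.
  rewrite big_mkord; apply: lee_sum => i _; rewrite uE.
  apply: ae_ge0_le_integral => //.
  - by apply: measurable_funTS; apply: measurable_powR_norm; exact: measurable_funM.
  - by apply: measurable_funTS; apply: measurable_powR_norm; exact: mT.
  apply: filterS (Lp_linear_sum (index_enum 'I_n) (a i) x Tlin) => w Tw.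
  move=> Aw; have Bw : B i w by exact: (@subset_seqDU _ B i).
  rewrite lee_fin /y Tw.
  rewrite (ger0_norm (mulr_ge0 e10 (Phi0 w))); apply: (ge0_ler_powR (ltW q0) _ _ Bw).
    by rewrite nnegrE; exact: mulr_ge0 e10 (Phi0 w).
  by rewrite nnegrE; exact: normr_ge0.
have N0 : (0 <= LpN mu q Phi)%E by exact: Lnorm_ge0.
(* The value [e = 1/2] shows that the norm is finite. If it were some [L > K], then
   [e = (L - K) / (2 * L)] would give [(1 - e) * L = (L + K) / 2 > K]. *)
have h2 : 0 < (2^-1 : R) by []. have h21 : (2^-1 : R) < 1 by lra.
have := main _ h2 h21; move: N0 main; rewrite -/Phi.
case: (LpN mu q Phi) => [L|_ _|//]; last first.
  by rewrite gt0_muley ?leye_eq// lte_fin; lra.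
rewrite !lee_fin => L0 main _; rewrite leNgt; apply/negP => KL.
have Lp : 0 < L by exact: le_lt_trans KL.
have e0 : 0 < (L - K) / (2 * L) by rewrite divr_gt0 ?subr_gt0 ?mulr_gt0.
have e1 : (L - K) / (2 * L) < 1 by rewrite ltr_pdivrMr ?mulr_gt0//; lra.
have := main _ e0 e1; rewrite -EFinM lee_fin mulrBl mul1r.
rewrite (_ : (L - K) / (2 * L) * L = (L - K) / 2); first by lra.
by field; rewrite gt_eqF.
Qed.

End p_convexity_from_finite.

Theorem proposition9p38 (R : realType) (E : completeNormedModType R) (p q C : R)
    (q1 : 1 <= q) (qp : q < p) (C1 : 1 <= C) :
  [<->
    (exists V, lattice_C_isomorphism C
       (@FBL R E p) (@fbl_norm R E p) (@FBL R E q) (@fbl_norm R E q) V);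
    (exists V, lattice_C_isomorphism C
       (@FBL R E p) (@fbl_norm R E p) (@FBL R E q) (@fbl_norm R E q) V /\
       forall x : E, V (delta x) = delta x);
    (forall d (Om : measurableType d)
       (mu : {sigma_finite_measure set Om -> \bar R}) (T : E -> Lp mu q1),
       Lp_contraction T ->
       exists X : banachLatticeType R,
         p_convexity_constant X p 1 /\ strongly_factors C X T);
    (forall d (Om : measurableType d)
       (mu : {sigma_finite_measure set Om -> \bar R}) (T : E -> Lp mu q1),
       Lp_contraction T -> multiplicatively_factors C (le1_lt q1 qp) T);
    (forall d (Om : measurableType d)
       (mu : {sigma_finite_measure set Om -> \bar R}) (T : E -> Lp mu q1),
       Lp_contraction T -> p_convex_operator p C T)].
Proof.
pose p1 := le1_lt q1 qp; have C0 : 0 < C by exact: lt_le_trans C1.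
have iso_convex V : lattice_C_isomorphism C
    (@FBL R E p) (@fbl_norm R E p) (@FBL R E q) (@fbl_norm R E q) V ->
    forall d (Om : measurableType d)
      (mu : {sigma_finite_measure set Om -> \bar R}) (T : E -> Lp mu q1),
      Lp_contraction T -> p_convex_operator p C T.
  move=> /(lattice_isomorphism_finite p1 q1) H d Om mu T.
  exact: p_convex_operator_of_finite p1 (ltW C0) H.
have convex_mul d (Om : measurableType d)
    (mu : {sigma_finite_measure set Om -> \bar R}) (T : E -> Lp mu q1) :
    Lp_contraction T -> p_convex_operator p C T ->
    multiplicatively_factors C (le1_lt q1 qp) T.
  by move=> [Tlin _]; exact: p_convex_operator_factors.
have convex_canonical : (forall d (Om : measurableType d)
       (mu : {sigma_finite_measure set Om -> \bar R}) (T : E -> Lp mu q1),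
       Lp_contraction T -> p_convex_operator p C T) ->
    lattice_C_isomorphism C
      (@FBL R E p) (@fbl_norm R E p) (@FBL R E q) (@fbl_norm R E q) id.
  move=> H; apply: (canonical_isomorphism q1 qp C1); apply: (fbl_norm_factor (ltW C0)).
  by move=> T Tc; apply: convex_mul => //; exact: H.
(* Every arrow of the cycle is routed through (5). Passing from (3) to (5) and from (5) to (4) works
   for one [T] at a time. The given [V] is only used to reach (5): the canonical isomorphism is then
   obtained anew, as the identity. *)
tfae.
- move=> [V /iso_convex H]; exists id; split; last by move=> x; exact: erefl.
  exact: convex_canonical.
- move=> [V [/iso_convex H _]] d Om mu T Tc.
  apply: (multiplicatively_factors_strongly (ltW C0)).
  exact: convex_mul Tc (H _ _ _ _ Tc).
- move=> H d Om mu T Tc; apply: (convex_mul _ _ _ _ Tc).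
  have [X [[X1 _] XT]] := H _ _ _ _ Tc; have [Tlin _] := Tc.
  exact: strongly_factors_p_convex (ltW C0) X1 Tlin XT.
(* Factorization over the counting measure on [nat] yields the canonical isomorphism, and this gives
   p-convexity for every measure. *)
- move=> H; apply: (iso_convex id); apply: (canonical_isomorphism q1 qp C1).
  by apply: (fbl_norm_factor (ltW C0)) => T; exact: H.
- by move=> /convex_canonical H; exists id.
Qed.
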